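(* Let $(\Omega^{(\bullet,\bullet)},\wedge,\partial,\overline\partial)$ be a factorizable $A$-covariant complex structure on a quantum homogeneous space $B=A^{\mathrm{co}(H)}$, where $A$ is a Hopf $\ast$-algebra, $\Omega^1$ is an object of ${}^{A}_{B}\mathrm{mod}_0$, and $\Omega^{(1,0)}$, $\Omega^{(0,1)}$ are non-isomorphic simple objects in ${}^{A}_{B}\mathrm{mod}_0$. Let $(g,(\ ,\ ))$ be a real $A$-covariant metric on $\Omega^1$ and let $\mathscr{H}_1,\mathscr{H}_2$ be the $A$-covariant Hermitian metrics on $\Omega^{(1,0)}$ and $\Omega^{(0,1)}$ respectively constructed from it by $\mathscr{H}_i(\overline\omega)(\eta)=(\eta,\omega^* )$. Let $\nabla_{\mathrm{Ch}}$ be the Chern connection of $(\Omega^{(1,0)},\mathscr{H}_1)$ and $\nabla_{\mathrm{Ch},\mathrm{op}}$ the Chern connection of $(\Omega^{(0,1)},\mathscr{H}_2)$ for the opposite complex structure. Then the connection $\nabla=\nabla_{\mathrm{Ch}}+\nabla_{\mathrm{Ch},\mathrm{op}}$ is an $A$-covariant bimodule connection on $\Omega^1$.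
   Context: All algebras are unital over $\mathbb{C}$; antipodes are bijective; Sweedler notation is $\Delta(a)=a_{(1)}\otimes a_{(2)}$ and $m\mapsto m_{(-1)}\otimes m_{(0)}$ for left coactions; $\epsilon$ is the counit and $S$ the antipode. Quantum homogeneous space: $A,H$ are Hopf algebras, $\pi:A\to H$ is a surjective Hopf algebra map, $B=A^{\mathrm{co}(H)}=\{a\in A: a_{(1)}\otimes\pi(a_{(2)})=a\otimes 1\}$, and $A$ is faithfully flat as a right $B$-module. $B$ is a left $A$-comodule algebra via $\Delta$; when one speaks of a complex structure on $B$, $B$ is a left $A$-comodule $\ast$-algebra. ${}^{A}_{B}\mathcal{M}_B$ is the category of $B$-bimodules $M$ with a left $A$-coaction satisfying $\delta(bmc)=b_{(1)}m_{(-1)}c_{(1)}\otimes b_{(2)}m_{(0)}c_{(2)}$; morphisms are $B$-bilinear, left $A$-colinear maps. With $B^+=B\cap\ker\epsilon$, ${}^{A}_{B}\mathrm{mod}_0$ is the full subcategory of objects finitely generated as left $B$-modules with $MB^+=B^+M$ (such objects are automatically projective as left $B$-modules). A differential calculus over $B$ is a differential graded algebra $(\Omega^\bullet,\wedge,d)$ with $\Omega^0=B$, generated by $B$ and $dB$; a $\ast$-calculus has a degree-preserving conjugate-linear involution extending $\ast$ on $B$ with $(d\omega)^*=d(\omega^* )$, $(\omega\wedge\nu)^*=(-1)^{kl}\nu^*\wedge\omega^*$ for $\omega\in\Omega^k$, $\nu\in\Omega^l$; it is $A$-covariant if the coaction of $B$ extends to a comodule $\ast$-algebra coaction on $\Omega^\bullet$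 with every $\Omega^k\in{}^{A}_{B}\mathcal{M}_B$ and $d$ colinear. A complex structure on a $\ast$-calculus is an $\mathbb{N}_0^2$-algebra grading $\Omega^\bullet=\bigoplus\Omega^{(p,q)}$ with $\Omega^k=\bigoplus_{p+q=k}\Omega^{(p,q)}$, $(\Omega^{(p,q)})^*=\Omega^{(q,p)}$, $d\Omega^{(p,q)}\subseteq\Omega^{(p+1,q)}\oplus\Omega^{(p,q+1)}$; $\pi^{(p,q)}$ are the projections, $\partial=\pi^{(p+1,q)}\circ d$ and $\overline\partial=\pi^{(p,q+1)}\circ d$ on $\Omega^{(p,q)}$. It is $A$-covariant if the $\ast$-calculus is and all $\Omega^{(p,q)}$ are left $A$-comodules. It is factorizable if the wedge maps $\Omega^{(0,q)}\otimes_B\Omega^{(p,0)}\to\Omega^{(p,q)}$ and $\Omega^{(p,0)}\otimes_B\Omega^{(0,q)}\to\Omega^{(p,q)}$ are invertible for all $p,q\in\mathbb{N}$, with inverses $\theta_l^{(p,q)}$, $\theta_r^{(p,q)}$. The opposite complex structure is $\Omega^{(a,b),\mathrm{op}}=\Omega^{(b,a)}$, $\partial_{\mathrm{op}}=\overline\partial$, $\overline\partial_{\mathrm{op}}=\partial$. A metric on $\Omega^1$ is a pair $(g,(\ ,\ ))$, $g\in\Omega^1\otimes_B\Omega^1$, $(\ ,\ ):\Omega^1\otimes_B\Omega^1\to B$ $B$-bilinear, with $((\omega,\ )\otimes_B\mathrm{id})g=\omega=(\mathrm{id}\otimes_B(\ ,\omega))g$ for all $\omega\in\Omega^1$. It is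 $A$-covariant if $(\ ,\ )$ and $b\mapsto bg$ are left $A$-colinear, and real if $g^\dagger=g$, where $(\omega\otimes_B\eta)^\dagger=\eta^*\otimes_B\omega^*$ (antilinear). For a $B$-bimodule $M$, $\overline{M}=\{\overline m:m\in M\}$ is the conjugate vector space with $b\cdot\overline m=\overline{m b^*}$, $\overline m\cdot b=\overline{b^*m}$, and coaction $\overline m\mapsto m_{(-1)}^*\otimes\overline{m_{(0)}}$; ${}_B\mathrm{Hom}(M,B)$ (left $B$-linear maps) has $(bf)(m)=f(mb)$, $(fb)(m)=f(m)b$, and coaction determined by $f_{(-1)}\otimes f_{(0)}(m)=S(m_{(-1)})[f(m_{(0)})]_{(-1)}\otimes[f(m_{(0)})]_{(0)}$ ($M$ finitely generated projective as a left $B$-module). A Hermitian metric on $\mathcal{E}$ is a $B$-bimodule isomorphism $\mathscr{H}:\overline{\mathcal{E}}\to{}_B\mathrm{Hom}(\mathcal{E},B)$ with $\langle f,\overline e\rangle^*=\langle e,\overline f\rangle$, where $\langle e,\overline f\rangle:=\mathscr{H}(\overline f)(e)$; it is $A$-covariant if $\mathscr{H}$ is left $A$-colinear. A left connection on $\mathcal{E}$ is a linear map $\nabla:\mathcal{E}\to\Omega^1\otimes_B\mathcal{E}$ with $\nabla(be)=b\nabla e+db\otimes_Be$; it is $A$-covariant if $A$-colinear; it is a bimodule connection if there is a $B$-bimodule map $\sigma:\mathcal{E}\otimes_B\Omega^1\to\Omega^1\otimes_B\mathcal{E}$ with $\nabla(eb)=\nabla(e)b+\sigma(e\otimes_Bdb)$.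 A left $\overline\partial$-connection is a linear map $\overline\partial_{\mathcal{E}}:\mathcal{E}\to\Omega^{(0,1)}\otimes_B\mathcal{E}$ with $\overline\partial_{\mathcal{E}}(be)=b\overline\partial_{\mathcal{E}}e+\overline\partial b\otimes_Be$; $(\mathcal{E},\overline\partial_{\mathcal{E}})$ is holomorphic if $(\overline\partial\otimes_B\mathrm{id}-\mathrm{id}\wedge\overline\partial_{\mathcal{E}})\overline\partial_{\mathcal{E}}=0$. $\nabla$ is compatible with $\mathscr{H}$ if $d\langle e,\overline f\rangle=(\mathrm{id}\otimes_B\langle\ ,\ \rangle)(\nabla e\otimes_B\overline f)+(\langle\ ,\ \rangle\otimes_B\mathrm{id})(e\otimes_B\widetilde\nabla\overline f)$, where $\widetilde\nabla(\overline f)=\sum_i\overline{x_i}\otimes_B\omega_i^*$ if $\nabla f=\sum_i\omega_i\otimes_Bx_i$. The Chern connection of a holomorphic bimodule $(\mathcal{E},\overline\partial_{\mathcal{E}})$ (finitely generated projective as left $B$-module) with Hermitian metric $\mathscr{H}$ is the unique left connection compatible with $\mathscr{H}$ with $(\pi^{(0,1)}\otimes_B\mathrm{id})\nabla=\overline\partial_{\mathcal{E}}$. Here $\Omega^{(1,0)}$ has holomorphic structure $\theta_l^{(1,1)}\circ\overline\partial$ and $\Omega^{(0,1)}=\Omega^{(1,0),\mathrm{op}}$ has, for the opposite complex structure, $\theta_r^{(1,1)}\circ\partial$. For $\omega\in\Omega^{(1,0)}$, $\eta\in\Omega^{(0,1)}$, $\nabla(\omega+\eta)=\nabla_{\mathrm{Ch}}(\omega)+\nabla_{\mathrm{Ch},\mathrm{op}}(\eta)$.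 *)

(* Defs.v *)
From HB Require Import structures.
From mathcomp Require Import all_boot all_order all_algebra.
From mathcomp Require Import boolp functions reals complex.

Set Implicit Arguments.
Unset Strict Implicit.
Unset Printing Implicit Defensive.

Import GRing.Theory Num.Theory.
Local Open Scope ring_scope.
Local Open Scope quotient_scope.

(* [r] is a right action of the scalars [K] on [M], [l] a left action on [N];
   [tens r l] is M (x)_K N.  It is built from finite formal sums of pairs, two
   formal sums being identified when no balanced biadditive map into an abelian
   group separates them.  [tens_lift_pure], [tens_lift_additive] and
   [tens_lift_unique] are the universal property. *)
Section Tensor.
Variables (K : Type) (M N : zmodType) (r : M -> K -> M) (l : K -> N -> N).

Definition balanced (V : zmodType) (f : M -> N -> V) : Prop :=
  [/\ forall m m' n, f (m + m') n = f m n + f m' n,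
      forall m n n', f m (n + n') = f m n + f m n'
    & forall m k n, f (r m k) n = f m (l k n)].

Definition feval (V : zmodType) (f : M -> N -> V) (s : seq (M * N)) : V :=
  \sum_(p <- s) f p.1 p.2.

Definition teq (s t : seq (M * N)) : bool :=
  `[< forall (V : zmodType) (f : M -> N -> V),
        balanced f -> feval f s = feval f t >].

Lemma teqP s t :
  reflect (forall (V : zmodType) (f : M -> N -> V),
             balanced f -> feval f s = feval f t) (teq s t).
Proof. exact: asboolP. Qed.

Lemma teq_refl : reflexive teq. Proof. by move=> s; apply/teqP. Qed.
Lemma teq_sym : symmetric teq.
Proof.
by move=> s t; apply/teqP/teqP => h V f bf; rewrite (h V f bf).
Qed.
Lemma teq_trans : transitive teq.
Proof.
by move=> t s u /teqP h1 /teqP h2; apply/teqP => V f bf; rewrite h1 ?h2.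
Qed.

Canonical teq_equiv := EquivRel teq teq_refl teq_sym teq_trans.

Definition tens := {eq_quot teq}.
HB.instance Definition _ := Choice.on tens.
HB.instance Definition _ := EqQuotient.on tens.

(* Total in [f]; meaningful when [f] is balanced. *)
Definition tlift (V : zmodType) (f : M -> N -> V) (x : tens) : V :=
  feval f (repr x).

Definition tclass (s : seq (M * N)) : tens := \pi_tens s.

Definition tpure (m : M) (n : N) : tens := tclass [:: (m, n)].

Lemma tlift_class (V : zmodType) (f : M -> N -> V) s :
  balanced f -> tlift f (tclass s) = feval f s.
Proof.
move=> bf; have /eqmodP/teqP h : repr (tclass s) = s %[mod tens].
  by rewrite reprK.
exact: h.
Qed.

Lemma tens_ext (x y : tens) :
  (forall (V : zmodType) (f : M -> N -> V),
     balanced f -> tlift f x = tlift f y) -> x = y.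
Proof.
by move=> h; rewrite -[x]reprK -[y]reprK; apply/eqmodP/teqP.
Qed.

Definition tadd (x y : tens) : tens := tclass (repr x ++ repr y).
Definition topp (x : tens) : tens :=
  tclass [seq (- p.1, p.2) | p <- repr x].

Lemma feval_cat (V : zmodType) (f : M -> N -> V) s t :
  feval f (s ++ t) = feval f s + feval f t.
Proof. exact: big_cat. Qed.

Lemma balanced0l (V : zmodType) (f : M -> N -> V) n :
  balanced f -> f 0 n = 0.
Proof.
by case=> fD _ _; apply: (@addIr _ (f 0 n)); rewrite -fD !add0r.
Qed.

Lemma balancedNl (V : zmodType) (f : M -> N -> V) m n :
  balanced f -> f (- m) n = - f m n.
Proof.
move=> bf; apply: (@addIr _ (f m n)); rewrite addNr.
by case: (bf) => fD _ _; rewrite -fD addNr balanced0l.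
Qed.

Lemma tlift_tadd (V : zmodType) (f : M -> N -> V) x y :
  balanced f -> tlift f (tadd x y) = tlift f x + tlift f y.
Proof. by move=> bf; rewrite tlift_class // feval_cat. Qed.

Lemma tlift_topp (V : zmodType) (f : M -> N -> V) x :
  balanced f -> tlift f (topp x) = - tlift f x.
Proof.
move=> bf; rewrite tlift_class // /feval big_map /= /tlift /feval.
by rewrite -sumrN; apply: eq_bigr => p _; rewrite balancedNl.
Qed.

Lemma tlift_t0 (V : zmodType) (f : M -> N -> V) :
  balanced f -> tlift f (tclass [::]) = 0.
Proof. by move=> bf; rewrite tlift_class // /feval big_nil. Qed.

Fact taddA : associative tadd.
Proof.
by move=> x y z; apply: tens_ext => V f bf; rewrite !tlift_tadd // addrA.
Qed.
Fact taddC : commutative tadd.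
Proof.
by move=> x y; apply: tens_ext => V f bf; rewrite !tlift_tadd // addrC.
Qed.
Fact tadd0 : left_id (tclass [::]) tadd.
Proof.
by move=> x; apply: tens_ext => V f bf; rewrite tlift_tadd // tlift_t0 // add0r.
Qed.
Fact taddN : left_inverse (tclass [::]) topp tadd.
Proof.
move=> x; apply: tens_ext => V f bf.
by rewrite tlift_tadd // tlift_topp // tlift_t0 // addNr.
Qed.

HB.instance Definition _ :=
  GRing.isZmodule.Build tens taddA taddC tadd0 taddN.

Lemma tens_lift_additive (V : zmodType) (f : M -> N -> V) :
  balanced f -> {morph tlift f : x y / x + y}.
Proof. by move=> bf x y; rewrite -tlift_tadd. Qed.

Lemma tens_lift_pure (V : zmodType) (f : M -> N -> V) m n :
  balanced f -> tlift f (tpure m n) = f m n.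
Proof. by move=> bf; rewrite tlift_class // /feval big_seq1. Qed.

Lemma tpure_balanced : balanced tpure.
Proof.
split=> [m m' n|m n n'|m k n]; apply: tens_ext => V f bf.
- rewrite tens_lift_additive // !tens_lift_pure //; by case: bf.
- rewrite tens_lift_additive // !tens_lift_pure //; by case: bf.
- rewrite !tens_lift_pure //; by case: bf.
Qed.

Lemma tclassE s : tclass s = \sum_(p <- s) tpure p.1 p.2.
Proof.
apply: tens_ext => V f bf; rewrite tlift_class //.
elim: s => [|p s IHs]; first by rewrite /feval !big_nil tlift_t0.
by rewrite /feval !big_cons tens_lift_additive // tens_lift_pure // -IHs.
Qed.

Lemma tens_sumE (x : tens) : x = \sum_(p <- repr x) tpure p.1 p.2.
Proof. by rewrite -tclassE /tclass reprK. Qed.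

Lemma tens_ind (P : tens -> Prop) :
  (forall m n, P (tpure m n)) -> P 0 -> (forall x y, P x -> P y -> P (x + y)) ->
  forall x, P x.
Proof.
by move=> Pp P0 PD x; rewrite (tens_sumE x); apply: big_ind => // p _.
Qed.

Lemma tens_lift_unique (V : zmodType) (f : M -> N -> V) (h : tens -> V) :
  balanced f -> {morph h : x y / x + y} -> (forall m n, h (tpure m n) = f m n) ->
  h =1 tlift f.
Proof.
move=> bf hD hp; apply: tens_ind => [m n||x y hx hy].
- by rewrite hp tens_lift_pure.
- rewrite -[RHS](_ : tlift f (tclass [::]) = _) ?tlift_t0 //.
  by apply: (@addIr _ (h 0)); rewrite -hD !add0r.
- by rewrite hD tens_lift_additive // hx hy.
Qed.

End Tensor.

Section TensorC.
Variable C : numClosedFieldType.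

Definition tensC (M N : lmodType C) : Type :=
  tens (fun (m : M) (c : C) => c *: m) (fun (c : C) (n : N) => c *: n).

Section Instances.
Variables M N : lmodType C.
HB.instance Definition _ := GRing.Zmodule.on (tensC M N).

Definition tpureC (m : M) (n : N) : tensC M N := tpure _ _ m n.

Definition tliftC (V : zmodType) (f : M -> N -> V) (x : tensC M N) : V :=
  tlift f x.

Definition cbalanced (V : zmodType) (f : M -> N -> V) : Prop :=
  balanced (fun (m : M) (c : C) => c *: m) (fun (c : C) (n : N) => c *: n) f.

Lemma tpureC_balanced : cbalanced tpureC.
Proof. exact: tpure_balanced. Qed.

Lemma tliftCD (V : zmodType) (f : M -> N -> V) :
  cbalanced f -> {morph tliftC f : x y / x + y}.
Proof. exact: tens_lift_additive. Qed.

Lemma tliftCE (V : zmodType) (f : M -> N -> V) m n :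
  cbalanced f -> tliftC f (tpureC m n) = f m n.
Proof. exact: tens_lift_pure. Qed.

Lemma tliftC0 (V : zmodType) (f : M -> N -> V) :
  cbalanced f -> tliftC f 0 = 0.
Proof.
by move=> bf; apply: (@addIr _ (tliftC f 0)); rewrite -tliftCD // !add0r.
Qed.

Lemma tensC_ind (P : tensC M N -> Prop) :
  (forall m n, P (tpureC m n)) -> P 0 -> (forall x y, P x -> P y -> P (x + y)) ->
  forall x, P x.
Proof. exact: tens_ind. Qed.

Definition tscale (c : C) (x : tensC M N) : tensC M N :=
  tliftC (fun m n => tpureC (c *: m) n) x.

Lemma tscale_balanced c : cbalanced (fun m n => tpureC (c *: m) n).
Proof.
have [pD1 pD2 pK] := tpureC_balanced.
split=> [m m' n|m n n'|m k n]; first by rewrite scalerDr pD1.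
  exact: pD2.
by rewrite scalerA mulrC -scalerA pK.
Qed.
Hint Resolve tscale_balanced : core.

Lemma tscaleE c m n : tscale c (tpureC m n) = tpureC (c *: m) n.
Proof. exact: tliftCE. Qed.
Lemma tscaleDr c : {morph tscale c : x y / x + y}.
Proof. exact: tliftCD. Qed.
Lemma tscale0 c : tscale c 0 = 0.
Proof. exact: tliftC0. Qed.

Fact tscaleA a b x : tscale a (tscale b x) = tscale (a * b) x.
Proof.
elim/tensC_ind: x => [m n||x y hx hy].
- by rewrite !tscaleE scalerA.
- by rewrite !tscale0.
- by rewrite !tscaleDr hx hy.
Qed.
Fact tscale1 : left_id 1 tscale.
Proof.
elim/tensC_ind => [m n||x y hx hy].
- by rewrite tscaleE scale1r.
- by rewrite tscale0.
- by rewrite tscaleDr hx hy.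
Qed.
Fact tscaleDl x : {morph tscale^~ x : a b / a + b}.
Proof.
move=> a b; elim/tensC_ind: x => [m n||x y hx hy].
- by rewrite !tscaleE scalerDl; case: tpureC_balanced.
- by rewrite !tscale0 addr0.
- by rewrite !tscaleDr hx hy addrACA.
Qed.
HB.instance Definition _ :=
  GRing.Zmodule_isLmodule.Build C (tensC M N) tscaleA tscale1 tscaleDr tscaleDl.

Lemma tpureCDl m m' n : tpureC (m + m') n = tpureC m n + tpureC m' n.
Proof. by case: tpureC_balanced. Qed.
Lemma tpureCDr m n n' : tpureC m (n + n') = tpureC m n + tpureC m n'.
Proof. by case: tpureC_balanced. Qed.
Lemma tpureCZl c m n : tpureC (c *: m) n = c *: tpureC m n.
Proof. exact: (esym (tscaleE c m n)). Qed.
Lemma tpureCZr c m n : tpureC m (c *: n) = c *: tpureC m n.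
Proof. by rewrite -tpureCZl; case: tpureC_balanced => _ _ ->. Qed.

End Instances.
End TensorC.

Arguments tliftC {C M N V} f x.
Arguments tpureC {C M N} m n.
Notation "M ⊗ N" := (tensC M%type N%type) (at level 40, left associativity) : type_scope.
Notation "m ⊗ n" := (tpureC m n) (at level 40, left associativity) : ring_scope.

Section TensorMaps.
Variable C : numClosedFieldType.

Definition tmap (M N M' N' : lmodType C) (f : M -> M') (g : N -> N') :
  M ⊗ N -> M' ⊗ N' := tliftC (fun m n => f m ⊗ g n).

Definition tassoc (M N P : lmodType C) : (M ⊗ N) ⊗ P -> M ⊗ (N ⊗ P) :=
  tliftC (fun x p => tliftC (fun m n => m ⊗ (n ⊗ p)) x).

(* (m ⊗ n) . (m' ⊗ n') = f m m' ⊗ g n n' *)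
Definition tmul (M N M' N' M'' N'' : lmodType C)
    (f : M -> M' -> M'') (g : N -> N' -> N'') (x : M ⊗ N) (y : M' ⊗ N') :
  M'' ⊗ N'' :=
  tliftC (fun m n => tliftC (fun m' n' => f m m' ⊗ g n n') y) x.

Lemma tmap_balanced (M N M' N' : lmodType C) (f : {linear M -> M'})
    (g : {linear N -> N'}) : cbalanced (fun m n => f m ⊗ g n).
Proof.
split=> *; rewrite ?linearD ?linearZ ?tpureCDl ?tpureCDr //=.
by rewrite tpureCZl tpureCZr.
Qed.

Lemma tmapE (M N M' N' : lmodType C) (f : {linear M -> M'})
    (g : {linear N -> N'}) m n : tmap f g (m ⊗ n) = f m ⊗ g n.
Proof. by rewrite /tmap tliftCE //; exact: tmap_balanced. Qed.

Lemma tmapD (M N M' N' : lmodType C) (f : {linear M -> M'})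
    (g : {linear N -> N'}) : {morph tmap f g : x y / x + y}.
Proof. by apply: tliftCD; exact: tmap_balanced. Qed.

Lemma tmap0 (M N M' N' : lmodType C) (f : {linear M -> M'})
    (g : {linear N -> N'}) : tmap f g 0 = 0.
Proof. by apply: tliftC0; exact: tmap_balanced. Qed.

Lemma tmapZ (M N M' N' : lmodType C) (f : {linear M -> M'})
    (g : {linear N -> N'}) c x : tmap f g (c *: x) = c *: tmap f g x.
Proof.
elim/tensC_ind: x => [m n||x y hx hy].
- by rewrite -tpureCZl !tmapE linearZ /= tpureCZl.
- by rewrite scaler0 tmap0 scaler0.
- by rewrite scalerDr !tmapD hx hy scalerDr.
Qed.

Section Mul.
Variables A1 A2 : algType C.
Implicit Types x y : A1 ⊗ A2.

Definition tmulA : A1 ⊗ A2 -> A1 ⊗ A2 -> A1 ⊗ A2 := tmul *%R *%R.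

Lemma tmulA_balanced_in a1 a2 :
  cbalanced (fun (b1 : A1) (b2 : A2) => (a1 * b1) ⊗ (a2 * b2)).
Proof.
split=> *; rewrite ?mulrDr ?tpureCDl ?tpureCDr //.
by rewrite -!scalerAr tpureCZl tpureCZr.
Qed.

Lemma tmulA_balanced y : cbalanced (fun (a1 : A1) (a2 : A2) =>
  tliftC (fun b1 b2 => (a1 * b1) ⊗ (a2 * b2)) y).
Proof.
have h a1 a2 := tmulA_balanced_in a1 a2.
elim/tensC_ind: y => [b1 b2||x y [x1 x2 x3] [y1 y2 y3]].
- split=> *; rewrite !tliftCE // ?mulrDl ?tpureCDl ?tpureCDr //.
  by rewrite -!scalerAl tpureCZl tpureCZr.
- by split=> *; rewrite !tliftC0 ?addr0.
- split=> *; rewrite !tliftCD //.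
  + by rewrite x1 y1 addrACA.
  + by rewrite x2 y2 addrACA.
  + by rewrite x3 y3.
Qed.

Lemma tmulAE a1 a2 b1 b2 : tmulA (a1 ⊗ a2) (b1 ⊗ b2) = (a1 * b1) ⊗ (a2 * b2).
Proof.
rewrite /tmulA /tmul tliftCE; last exact: tmulA_balanced.
by rewrite tliftCE //; exact: tmulA_balanced_in.
Qed.
Lemma tmulADl y : {morph tmulA^~ y : x x' / x + x'}.
Proof. by apply: tliftCD; exact: tmulA_balanced. Qed.
Lemma tmulA0l y : tmulA 0 y = 0.
Proof. by apply: tliftC0; exact: tmulA_balanced. Qed.
Lemma tmulADr x : {morph tmulA x : y y' / y + y'}.
Proof.
move=> y y'; elim/tensC_ind: x => [a1 a2||x x' hx hx'].
- rewrite /tmulA /tmul !tliftCE; try exact: tmulA_balanced.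
  by rewrite tliftCD //; exact: tmulA_balanced_in.
- by rewrite !tmulA0l addr0.
- by rewrite !tmulADl hx hx' addrACA.
Qed.
Lemma tmulA0r x : tmulA x 0 = 0.
Proof. by apply: (@addIr _ (tmulA x 0)); rewrite -tmulADr !add0r. Qed.
End Mul.

Lemma tmap_tmulA (A1 A2 B1 B2 : algType C) (f : {lrmorphism A1 -> B1})
    (g : {lrmorphism A2 -> B2}) x y :
  tmap f g (tmulA x y) = tmulA (tmap f g x) (tmap f g y).
Proof.
elim/tensC_ind: x => [a1 a2||x x' hx hx'].
- elim/tensC_ind: y => [b1 b2||y y' hy hy'].
  + by rewrite tmulAE !tmapE tmulAE !rmorphM.
  + by rewrite tmulA0r !tmap0 tmulA0r.
  + by rewrite tmulADr !tmapD hy hy' tmulADr.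
- by rewrite tmulA0l !tmap0 tmulA0l.
- by rewrite tmulADl !tmapD hx hx' tmulADl.
Qed.

End TensorMaps.

Section Hopf.
Variable C : numClosedFieldType.

Record hopfAlg := HopfAlg {
  hopf_alg :> algType C;
  comul : {linear hopf_alg -> (hopf_alg ⊗ hopf_alg)%type};
  counit : {lrmorphism hopf_alg -> C^o};
  antipode : {linear hopf_alg -> hopf_alg};
  comul_coassoc : forall a,
    tassoc (tmap comul id (comul a)) = tmap id comul (comul a);
  counit_l : forall a, tliftC (fun a1 a2 => counit a1 *: a2) (comul a) = a;
  counit_r : forall a, tliftC (fun a1 a2 => counit a2 *: a1) (comul a) = a;
  comul1 : comul 1 = 1 ⊗ 1;
  comulM : forall a b, comul (a * b) = tmulA (comul a) (comul b);
  antipode_l : forall a,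
    tliftC (fun a1 a2 => antipode a1 * a2) (comul a) = (counit a)%:A;
  antipode_r : forall a,
    tliftC (fun a1 a2 => a1 * antipode a2) (comul a) = (counit a)%:A;
  antipode_bij : bijective antipode
}.
Arguments comul {h}.
Arguments counit {h}.
Arguments antipode {h}.

Record starOp (B : algType C) := StarOp {
  star_fun :> B -> B;
  starD : {morph star_fun : x y / x + y};
  starZ : forall (c : C) x, star_fun (c *: x) = c^* *: star_fun x;
  starM : forall x y, star_fun (x * y) = star_fun y * star_fun x;
  starK : involutive star_fun
}.

Record hopfStarAlg := HopfStarAlg {
  hopf_star_alg :> hopfAlg;
  hstar : starOp hopf_star_alg;
  comul_star : forall a : hopf_star_alg,
    comul (hstar a) = tmap hstar hstar (comul a)
}.

(* Compatibility with the antipodes is automatic. *)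
Record hopfMap (A H : hopfAlg) := HopfMap {
  hopf_map :> {lrmorphism A -> H};
  hopf_map_comul : forall a, comul (hopf_map a) = tmap hopf_map hopf_map (comul a);
  hopf_map_counit : forall a, counit (hopf_map a) = counit a
}.

End Hopf.

Arguments comul {C h}.
Arguments counit {C h}.
Arguments antipode {C h}.
Arguments hstar {C h}.

Section Coinvariants.
Variables (C : numClosedFieldType) (A H : hopfAlg C) (pi : hopfMap A H).

Definition coinv_pred : {pred A} :=
  fun a => tmap idfun pi (comul a) == a ⊗ 1.

Fact coinv_subalg : subalg_closed coinv_pred.
Proof.
split=> [|c a b|a b]; rewrite !unfold_in /coinv_pred.
- by apply/eqP; rewrite comul1 tmapE; congr (_ ⊗ _); exact: rmorph1.
- move=> /eqP ha /eqP hb; apply/eqP.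
  by rewrite linearP tmapD tmapZ ha hb tpureCDl tpureCZl.
- move=> /eqP ha /eqP hb; apply/eqP.
  by rewrite comulM tmap_tmulA ha hb tmulAE mulr1.
Qed.
HB.instance Definition _ := GRing.isSubalgClosed.Build C A coinv_pred coinv_subalg.

Record coinv := Coinv { coinv_val :> A; coinv_valP : coinv_val \in coinv_pred }.
HB.instance Definition _ := [isSub for coinv_val].
HB.instance Definition _ := [Choice of coinv by <:].
HB.instance Definition _ := [SubChoice_isSubAlgebra of coinv by <:].

End Coinvariants.

(* A is flat over B iff A ⊗_B - preserves exactness, faithfully so iff it
   also reflects it. *)
Section FaithfullyFlat.
Variables (C : numClosedFieldType) (A H : hopfAlg C) (pi : hopfMap A H).
Local Notation B := (coinv pi).

Definition tensA (X : lmodType B) : zmodType :=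
  tens (fun (a : A) (b : B) => a * val b) (fun (b : B) (x : X) => b *: x).

Definition tensA_map (X Y : lmodType B) (f : X -> Y) : tensA X -> tensA Y :=
  tlift (fun a x => tpure _ _ a (f x)).

Definition exact_at (X Y Z : zmodType) (f : X -> Y) (g : Y -> Z) : Prop :=
  forall y, g y = 0 <-> exists x, f x = y.

Definition faithfully_flat : Prop :=
  forall (X Y Z : lmodType B) (f : {linear X -> Y}) (g : {linear Y -> Z}),
    exact_at f g <-> exact_at (tensA_map f) (tensA_map g).
End FaithfullyFlat.

Section Bimodules.
Variables (C : numClosedFieldType) (B : algType C).

Record bimod := Bimod {
  bimod_sort :> lmodType C;
  lact : B -> bimod_sort -> bimod_sort;
  ract : bimod_sort -> B -> bimod_sort;
  lactDl : forall b b' m, lact (b + b') m = lact b m + lact b' m;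
  lactDr : forall b m m', lact b (m + m') = lact b m + lact b m';
  lactA : forall b b' m, lact b (lact b' m) = lact (b * b') m;
  lactC : forall c m, lact c%:A m = c *: m;
  ractDl : forall m m' b, ract (m + m') b = ract m b + ract m' b;
  ractDr : forall m b b', ract m (b + b') = ract m b + ract m b';
  ractA : forall m b b', ract (ract m b) b' = ract m (b * b');
  ractC : forall m c, ract m c%:A = c *: m;
  lractA : forall b m b', ract (lact b m) b' = lact b (ract m b')
}.
Arguments lact {b} : rename.
Arguments ract {b} : rename.

Definition bimod_map (M N : bimod) (f : M -> N) : Prop :=
  [/\ {morph f : m m' / m + m'},
      forall b m, f (lact b m) = lact b (f m)
    & forall m b, f (ract m b) = ract (f m) b].

Definition regular_bimod : bimod.
Proof.
refine (@Bimod B (fun b m => b * m) (fun m b => m * b) _ _ _ _ _ _ _ _ _).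
- by move=> *; rewrite mulrDl.
- by move=> *; rewrite mulrDr.
- by move=> *; rewrite mulrA.
- by move=> *; rewrite -scalerAl mul1r.
- by move=> *; rewrite mulrDl.
- by move=> *; rewrite mulrDr.
- by move=> *; rewrite mulrA.
- by move=> *; rewrite -scalerAr mulr1.
- by move=> *; rewrite mulrA.
Defined.

Section TensB.
Variables M N : bimod.

Definition tensB_sort : Type := tens (@ract M) (@lact N).
HB.instance Definition _ := GRing.Zmodule.on tensB_sort.

Definition bbalanced (V : zmodType) (f : M -> N -> V) : Prop :=
  balanced (@ract M) (@lact N) f.
Definition tpB (m : M) (n : N) : tensB_sort := tpure _ _ m n.
Definition tliftB (V : zmodType) (f : M -> N -> V) (x : tensB_sort) : V :=
  tlift f x.

Lemma tpB_balanced : bbalanced tpB. Proof. exact: tpure_balanced. Qed.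
Lemma tliftBD (V : zmodType) (f : M -> N -> V) :
  bbalanced f -> {morph tliftB f : x y / x + y}.
Proof. exact: tens_lift_additive. Qed.
Lemma tliftBE (V : zmodType) (f : M -> N -> V) m n :
  bbalanced f -> tliftB f (tpB m n) = f m n.
Proof. exact: tens_lift_pure. Qed.
Lemma tliftB0 (V : zmodType) (f : M -> N -> V) :
  bbalanced f -> tliftB f 0 = 0.
Proof.
by move=> bf; apply: (@addIr _ (tliftB f 0)); rewrite -tliftBD // !add0r.
Qed.
Lemma tensB_ind (P : tensB_sort -> Prop) :
  (forall m n, P (tpB m n)) -> P 0 -> (forall x y, P x -> P y -> P (x + y)) ->
  forall x, P x.
Proof. exact: tens_ind. Qed.

Definition tlact (b : B) : tensB_sort -> tensB_sort :=
  tliftB (fun m n => tpB (lact b m) n).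
Definition tract (x : tensB_sort) (b : B) : tensB_sort :=
  tliftB (fun m n => tpB m (ract n b)) x.

Lemma tlact_balanced b : bbalanced (fun m n => tpB (lact b m) n).
Proof.
have [pD1 pD2 pK] := tpB_balanced.
by split=> *; rewrite ?lactDr ?pD1 ?pD2 // -lractA pK.
Qed.
Lemma tract_balanced b : bbalanced (fun m n => tpB m (ract n b)).
Proof.
have [pD1 pD2 pK] := tpB_balanced.
by split=> *; rewrite ?ractDl ?pD1 ?pD2 // lractA pK.
Qed.
Hint Resolve tlact_balanced tract_balanced : core.

Lemma tlactE b m n : tlact b (tpB m n) = tpB (lact b m) n.
Proof. exact: tliftBE. Qed.
Lemma tractE m n b : tract (tpB m n) b = tpB m (ract n b).
Proof. exact: tliftBE. Qed.
Lemma tlactDr b x y : tlact b (x + y) = tlact b x + tlact b y.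
Proof. exact: tliftBD. Qed.
Lemma tractDl x y b : tract (x + y) b = tract x b + tract y b.
Proof. exact: tliftBD. Qed.
Lemma tlact0 b : tlact b 0 = 0. Proof. exact: tliftB0. Qed.
Lemma tract0 b : tract 0 b = 0. Proof. exact: tliftB0. Qed.
Lemma tlactDl b b' x : tlact (b + b') x = tlact b x + tlact b' x.
Proof.
elim/tensB_ind: x => [m n||x y hx hy].
- by rewrite !tlactE lactDl; case: tpB_balanced.
- by rewrite !tlact0 addr0.
- by rewrite !tlactDr hx hy addrACA.
Qed.
Lemma tlactA b b' x : tlact b (tlact b' x) = tlact (b * b') x.
Proof.
elim/tensB_ind: x => [m n||x y hx hy].
- by rewrite !tlactE lactA.
- by rewrite !tlact0.
- by rewrite !tlactDr hx hy.
Qed.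
Lemma lact1 (P : bimod) (m : P) : lact 1 m = m.
Proof. by rewrite -[1](scale1r 1) lactC scale1r. Qed.
Lemma tlact1 x : tlact 1 x = x.
Proof.
elim/tensB_ind: x => [m n||x y hx hy].
- by rewrite tlactE lact1.
- by rewrite tlact0.
- by rewrite tlactDr hx hy.
Qed.

Fact tBscaleA a b x : tlact a%:A (tlact b%:A x) = tlact (a * b)%:A x.
Proof. by rewrite tlactA -scalerAl mul1r scalerA. Qed.
Fact tBscale1 x : tlact 1%:A x = x.
Proof. by rewrite scale1r tlact1. Qed.
Fact tBscaleDr a : {morph tlact a%:A : x y / x + y}.
Proof. exact: tlactDr. Qed.
Fact tBscaleDl x : {morph (fun c => tlact c%:A x) : a b / a + b}.
Proof. by move=> a b; rewrite scalerDl tlactDl. Qed.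
HB.instance Definition _ :=
  GRing.Zmodule_isLmodule.Build C tensB_sort tBscaleA tBscale1 tBscaleDr tBscaleDl.

Definition tensB : bimod.
Proof.
refine (@Bimod tensB_sort tlact tract _ _ _ _ _ _ _ _ _).
- exact: tlactDl.
- exact: tlactDr.
- exact: tlactA.
- by [].
- exact: tractDl.
- move=> x b b'; elim/tensB_ind: x => [m n||x y hx hy].
  + by rewrite !tractE ractDr; case: tpB_balanced.
  + by rewrite !tract0 addr0.
  + by rewrite !tractDl hx hy addrACA.
- move=> x b b'; elim/tensB_ind: x => [m n||x y hx hy].
  + by rewrite !tractE ractA.
  + by rewrite !tract0.
  + by rewrite !tractDl hx hy.
- move=> x c; rewrite /GRing.scale /=; elim/tensB_ind: x => [m n||x y hx hy].
  + rewrite tractE tlactE ractC lactC -lactC -ractC.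
    by case: tpB_balanced => _ _ ->.
  + by rewrite tract0 tlact0.
  + by rewrite tractDl tlactDr hx hy.
- move=> b x b'; elim/tensB_ind: x => [m n||x y hx hy].
  + by rewrite !(tlactE, tractE).
  + by rewrite !(tlact0, tract0).
  + by rewrite !(tlactDr, tractDl) hx hy.
Defined.
End TensB.

Definition tmapB (M N M' N' : bimod) (f : M -> M') (g : N -> N') :
  tensB M N -> tensB M' N' := tliftB (fun m n => tpB (f m) (g n)).

Record bproj (M : bimod) := BProj {
  bproj_fun :> {linear M -> M};
  bprojK : forall m, bproj_fun (bproj_fun m) = bproj_fun m;
  bprojl : forall b m, bproj_fun (lact b m) = lact b (bproj_fun m);
  bprojr : forall m b, bproj_fun (ract m b) = ract (bproj_fun m) b
}.

Section Summand.
Variables (M : bimod) (P : bproj M).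

Definition summand_pred : {pred M} := fun m => P m == m.
Fact summand_submod : submod_closed summand_pred.
Proof.
split=> [|c m n]; rewrite !unfold_in /summand_pred ?linear0 //.
by move=> /eqP hm /eqP hn; rewrite linearP hm hn.
Qed.
HB.instance Definition _ :=
  GRing.isSubmodClosed.Build C M summand_pred summand_submod.

Record summand_sort :=
  Summand { summand_val :> M; summand_valP : summand_val \in summand_pred }.
HB.instance Definition _ := [isSub for summand_val].
HB.instance Definition _ := [Choice of summand_sort by <:].
HB.instance Definition _ := [SubChoice_isSubLmodule of summand_sort by <:].

Fact summand_lact_mem b (m : summand_sort) : lact b (val m) \in summand_pred.
Proof.
by rewrite unfold_in /summand_pred bprojl (eqP (summand_valP m)).
Qed.
Fact summand_ract_mem (m : summand_sort) b : ract (val m) b \in summand_pred.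
Proof.
by rewrite unfold_in /summand_pred bprojr (eqP (summand_valP m)).
Qed.

Fact summand_proj_mem m : P m \in summand_pred.
Proof. by rewrite unfold_in /summand_pred bprojK. Qed.
Definition corestr (m : M) : summand_sort := Summand (summand_proj_mem m).

Definition summand : bimod.
Proof.
refine (@Bimod summand_sort (fun b m => Summand (summand_lact_mem b m))
  (fun m b => Summand (summand_ract_mem m b)) _ _ _ _ _ _ _ _ _).
- by move=> *; apply: val_inj; exact: lactDl.
- by move=> *; apply: val_inj; exact: lactDr.
- by move=> *; apply: val_inj; exact: lactA.
- by move=> *; apply: val_inj; exact: lactC.
- by move=> *; apply: val_inj; exact: ractDl.
- by move=> *; apply: val_inj; exact: ractDr.
- by move=> *; apply: val_inj; exact: ractA.
- by move=> *; apply: val_inj; exact: ractC.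
- by move=> *; apply: val_inj; exact: lractA.
Defined.
End Summand.

Section Conj.
Variables (sB : starOp B) (M : bimod).

Definition conj_sort : Type := M.
HB.instance Definition _ := GRing.Zmodule.on conj_sort.
Definition cj (m : M) : conj_sort := m.
Definition uncj (m : conj_sort) : M := m.

Definition cscale (c : C) (m : conj_sort) : conj_sort := cj (c^* *: uncj m).
Fact cscaleA a b x : cscale a (cscale b x) = cscale (a * b) x.
Proof. by rewrite /cscale /cj /uncj scalerA rmorphM. Qed.
Fact cscale1 : left_id 1 cscale.
Proof. by move=> x; rewrite /cscale /cj /uncj rmorph1 scale1r. Qed.
Fact cscaleDr : right_distributive cscale +%R.
Proof. by move=> c x y; rewrite /cscale /cj /uncj scalerDr. Qed.
Fact cscaleDl x : {morph cscale^~ x : a b / a + b}.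
Proof. by move=> a b; rewrite /cscale /cj /uncj rmorphD scalerDl. Qed.
HB.instance Definition _ :=
  GRing.Zmodule_isLmodule.Build C conj_sort cscaleA cscale1 cscaleDr cscaleDl.

Lemma star1 : sB 1 = 1.
Proof. by rewrite -[LHS]mulr1 -{2}[1](starK sB) -starM mulr1 starK. Qed.
Lemma star_alg c : sB c%:A = c^*%:A.
Proof. by rewrite starZ star1. Qed.

Definition conjB : bimod.
Proof.
refine (@Bimod conj_sort (fun b m => cj (ract (uncj m) (sB b)))
  (fun m b => cj (lact (sB b) (uncj m))) _ _ _ _ _ _ _ _ _);
  rewrite /cj /uncj.
- by move=> *; rewrite starD ractDr.
- by move=> *; rewrite ractDl.
- by move=> *; rewrite ractA starM.
- by move=> *; rewrite star_alg ractC.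
- by move=> *; rewrite lactDr.
- by move=> *; rewrite starD lactDl.
- by move=> *; rewrite lactA starM.
- by move=> *; rewrite star_alg lactC.
- by move=> *; rewrite lractA.
Defined.
End Conj.

Definition conj_elt (sB : starOp B) (M : bimod) (m : M) : conjB sB M := cj m.

Section Hom.
Variable M : bimod.

Definition lhom_pred : {pred M -> B} := fun f =>
  `[< {morph f : m m' / m + m'} /\ forall b m, f (lact b m) = b * f m >].
Fact lhom_submod : submod_closed lhom_pred.
Proof.
split=> [|c f g]; rewrite !unfold_in /lhom_pred.
  have E z : (0 : M -> B) z = 0 by [].
  by apply/asboolP; split=> [m m'|b m]; rewrite !E ?addr0 ?mulr0.
move=> /asboolP [fD fL] /asboolP [gD gL]; apply/asboolP.
have E z : (c *: f + g) z = c *: f z + g z by [].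
split=> [m m'|b m]; rewrite !E; first by rewrite fD gD scalerDr addrACA.
by rewrite fL gL mulrDr scalerAr.
Qed.
HB.instance Definition _ :=
  GRing.isSubmodClosed.Build C (M -> B) lhom_pred lhom_submod.

Record lhom := LHom { lhom_fun :> M -> B; lhom_funP : lhom_fun \in lhom_pred }.
HB.instance Definition _ := [isSub for lhom_fun].
HB.instance Definition _ := [Choice of lhom by <:].
HB.instance Definition _ := [SubChoice_isSubLmodule of lhom by <:].

Lemma lhomD (f : lhom) : {morph f : m m' / m + m'}.
Proof. by case: (asboolP _ (lhom_funP f)). Qed.
Lemma lhomL (f : lhom) b m : f (lact b m) = b * f m.
Proof. by case: (asboolP _ (lhom_funP f)). Qed.

Fact lhom_lact_mem b (f : lhom) : (fun m => f (ract m b)) \in lhom_pred.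
Proof.
apply/asboolP; split=> [m m'|b' m]; first by rewrite ractDl lhomD.
by rewrite lractA lhomL.
Qed.
Fact lhom_ract_mem (f : lhom) b : (fun m => f m * b) \in lhom_pred.
Proof.
apply/asboolP; split=> [m m'|b' m]; first by rewrite lhomD mulrDl.
by rewrite lhomL mulrA.
Qed.

Definition homB : bimod.
Proof.
refine (@Bimod lhom (fun b f => LHom (lhom_lact_mem b f))
  (fun f b => LHom (lhom_ract_mem f b)) _ _ _ _ _ _ _ _ _).
- by move=> b b' f; apply/val_inj/funext => m /=; rewrite ractDr lhomD.
- by move=> b f f'; apply/val_inj/funext => m.
- by move=> b b' f; apply/val_inj/funext => m /=; rewrite ractA.
- move=> c f; apply/val_inj/funext => m /=.
  by rewrite ractC -lactC lhomL -scalerAl mul1r.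
- by move=> f f' b; apply/val_inj/funext => m /=; rewrite mulrDl.
- by move=> f b b'; apply/val_inj/funext => m /=; rewrite mulrDr.
- by move=> f b b'; apply/val_inj/funext => m /=; rewrite mulrA.
- move=> f c; apply/val_inj/funext => m /=.
  by rewrite -scalerAr mulr1.
- by move=> b f b'; apply/val_inj/funext => m.
Defined.

Definition heval (f : homB) (m : M) : B := (f : lhom) m.
End Hom.

End Bimodules.

Arguments lact {C B b} : rename.
Arguments ract {C B b} : rename.
Arguments tpB {C B M N}.
Arguments tliftB {C B M N V}.
Arguments conj_elt {C B} sB {M} m.
Arguments heval {C B M} f m.

Section Hermitian.
Variables (C : numClosedFieldType) (B : algType C) (sB : starOp B) (M : bimod B).
Variable h : conjB sB M -> homB M.

(* <e, \overline{f}> *)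
Definition herm (e f : M) : B := heval (h (conj_elt sB f)) e.

Definition hermitian_metric : Prop :=
  [/\ bimod_map h, bijective h & forall e f, sB (herm f e) = herm e f].
End Hermitian.

Section Comodules.
Variables (C : numClosedFieldType) (A : hopfAlg C).

Definition is_coaction (M : lmodType C) (delta : M -> (A ⊗ M)%type) : Prop :=
  [/\ linear delta,
      forall m, tassoc (tmap comul id (delta m)) = tmap id delta (delta m)
    & forall m, tliftC (fun a m' => counit a *: m') (delta m) = m].

Definition colinear (M N : lmodType C) (dM : M -> (A ⊗ M)%type)
    (dN : N -> (A ⊗ N)%type) (f : M -> N) : Prop :=
  forall m, dN (f m) = tmap id f (dM m).

End Comodules.

(* [base_coact] is the corestriction of the coproduct of A to B -> A ⊗ B.  The
   involution [base_star] of B need not be the restriction of that of A. *)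
Record baseStar (C : numClosedFieldType) (A : hopfStarAlg C) (H : hopfAlg C)
    (pi : hopfMap A H) := BaseStar {
  base_coact : coinv pi -> (A ⊗ coinv pi)%type;
  base_coactE : forall b, tmap id val (base_coact b) = comul (val b);
  base_coactP : is_coaction base_coact;
  base_coact1 : base_coact 1 = 1 ⊗ 1;
  base_coactM : forall b b', base_coact (b * b') = tmulA (base_coact b) (base_coact b');
  base_star : starOp (coinv pi);
  base_coact_star : forall b,
    base_coact (base_star b) = tmap hstar base_star (base_coact b)
}.

Section Covariant.
Variables (C : numClosedFieldType) (A : hopfStarAlg C) (H : hopfAlg C).
Variables (pi : hopfMap A H) (D : baseStar pi).
Local Notation B := (coinv pi).
Local Notation bimod := (bimod B).
Local Notation dB := (base_coact D).
Local Notation sB := (base_star D).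

(* b_(1) m_(-1) c_(1) ⊗ b_(2) m_(0) c_(2) *)
Definition coact_lr (M : bimod) (delta : M -> (A ⊗ M)%type) (b : B) (m : M) (c : B) :
    (A ⊗ M)%type :=
  tmul *%R ract (tmul *%R lact (dB b) (delta m)) (dB c).

Definition covariant_bimod (M : bimod) (delta : M -> (A ⊗ M)%type) : Prop :=
  is_coaction delta /\
  forall b m c, delta (ract (lact b m) c) = coact_lr delta b m c.

Definition augm (b : B) : Prop := counit (val b) = 0.

Definition in_right_augm (M : bimod) (N : M -> Prop) (m : M) : Prop :=
  exists s : seq (M * B), (forall p, p \in s -> N p.1 /\ augm p.2) /\
    m = \sum_(p <- s) ract p.1 p.2.

Definition in_left_augm (M : bimod) (N : M -> Prop) (m : M) : Prop :=
  exists s : seq (M * B), (forall p, p \in s -> N p.1 /\ augm p.2) /\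
    m = \sum_(p <- s) lact p.2 p.1.

(* N is a subobject of M in [^A_B M_B] that belongs to [^A_B mod_0]. *)
Record subobject0 (M : bimod) (delta : M -> (A ⊗ M)%type) (N : M -> Prop) : Prop := {
  sub0_0 : N 0;
  sub0_D : forall m m', N m -> N m' -> N (m + m');
  sub0_l : forall b m, N m -> N (lact b m);
  sub0_r : forall m b, N m -> N (ract m b);
  sub0_coact : forall m, N m -> exists s : seq (A * M),
    (forall p, p \in s -> N p.2) /\ delta m = \sum_(p <- s) p.1 ⊗ p.2;
  sub0_fg : exists s : seq M, (forall x, x \in s -> N x) /\
    forall m, N m -> exists c : M -> B, m = \sum_(x <- s) lact (c x) x;
  sub0_augm : forall m, in_right_augm N m <-> in_left_augm N m
}.

Definition mod0 (M : bimod) (delta : M -> (A ⊗ M)%type) : Prop :=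
  covariant_bimod delta /\ subobject0 delta (fun _ => True).

Definition simple_mod0 (M : bimod) (delta : M -> (A ⊗ M)%type) : Prop :=
  [/\ mod0 delta, exists m : M, m <> 0
    & forall N, subobject0 delta N -> (forall m, N m -> m = 0) \/ (forall m, N m)].

Definition isomorphic (M N : bimod) (dM : M -> (A ⊗ M)%type)
    (dN : N -> (A ⊗ N)%type) : Prop :=
  exists f : M -> N, [/\ bimod_map f, colinear dM dN f & bijective f].

(* m_(-1) n_(-1) ⊗ (m_(0) ⊗_B n_(0)) *)
Definition tens_coact (M N : bimod) (dM : M -> (A ⊗ M)%type)
    (dN : N -> (A ⊗ N)%type) : tensB M N -> (A ⊗ tensB M N)%type :=
  tliftB (fun m n => tmul *%R (tpB : M -> N -> tensB M N) (dM m) (dN n)).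

Definition conj_coact (M : bimod) (dM : M -> (A ⊗ M)%type) :
    conjB sB M -> (A ⊗ conjB sB M)%type :=
  fun m => tmap hstar ((@conj_elt _ _ sB M)) (dM (uncj m)).

(* F = f_(-1) ⊗ f_(0) *)
Definition hom_coact (M : bimod) (dM : M -> (A ⊗ M)%type) (f : homB M)
    (F : (A ⊗ homB M)%type) : Prop :=
  forall m : M,
    tmap id (heval^~ m) F =
    tliftC (fun a m0 => tmap (fun x => antipode a * x) id (dB (heval f m0))) (dM m).

Definition summand_coact (M : bimod) (P : bproj M) (dM : M -> (A ⊗ M)%type) :
    summand P -> (A ⊗ summand P)%type :=
  fun m => tmap id (corestr P : M -> summand P) (dM (val m)).

Definition hermitian_covariant (M : bimod) (dM : M -> (A ⊗ M)%type)
    (h : conjB sB M -> homB M) : Prop :=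
  forall e : conjB sB M, hom_coact dM (h e) (tmap id h (conj_coact dM e)).

End Covariant.

(* A grading is given by its projections; [homog p i] is the component of
   degree i. *)
Section Gradings.
Variables (C : numClosedFieldType) (I : eqType) (V : lmodType C).

Definition is_grading (p : I -> {linear V -> V}) : Prop :=
  (forall i j v, p i (p j v) = if i == j then p j v else 0) /\
  (forall v, exists2 s : seq I, uniq s & v = \sum_(i <- s) p i v).

Definition homog (p : I -> {linear V -> V}) (i : I) (v : V) : Prop := p i v = v.

Lemma grading_commutes (p : I -> {linear V -> V}) (L : V -> V) :
  is_grading p -> {morph L : x y / x + y} ->
  (forall i v, homog p i v -> homog p i (L v)) ->
  forall i v, p i (L v) = L (p i v).
Proof.
move=> [pp ps] LD Lh i v.
have L0 : L 0 = 0 by apply: (@addIr _ (L 0)); rewrite -LD !add0r.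
have hom j : homog p j (p j v) by rewrite /homog pp eqxx.
have pL j : p i (L (p j v)) = L (p i (p j v)).
  by rewrite -(Lh _ _ (hom j)) !pp; case: eqP => [_|]; rewrite ?(Lh _ _ (hom j)) ?L0.
have [s _ {1 2}->] := ps v.
rewrite (big_morph L LD L0) !linear_sum /= (big_morph L LD L0).
by apply: eq_bigr => j _; rewrite pL.
Qed.
End Gradings.

Record calculus (C : numClosedFieldType) (B : algType C) := Calculus {
  forms :> algType C;
  degp : nat -> {linear forms -> forms};
  degp_grading : is_grading degp;
  degM : forall k l (w v : forms),
    homog degp k w -> homog degp l v -> homog degp (k + l)%N (w * v);
  iota0 : {lrmorphism B -> forms};
  iota0_inj : injective iota0;
  iota0_im : forall w, homog degp 0%N w <-> exists b, iota0 b = w;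
  diff : {linear forms -> forms};
  diff_deg : forall k w, homog degp k w -> homog degp k.+1 (diff w);
  diffK : forall w, diff (diff w) = 0;
  diff_leibniz : forall k w v, homog degp k w ->
    diff (w * v) = diff w * v + (-1) ^+ k * (w * diff v);
  forms_generated : forall P : forms -> Prop,
    (forall b, P (iota0 b)) -> (forall b, P (diff (iota0 b))) ->
    (forall w v, P w -> P v -> P (w + v)) ->
    (forall w v, P w -> P v -> P (w * v)) -> forall w, P w
}.
Arguments degp {C B} c.
Arguments iota0 {C B} c.
Arguments diff {C B} c.

Record starCalculus (C : numClosedFieldType) (B : algType C) (sB : starOp B) :=
  StarCalculus {
  star_calc :> calculus B;
  fstar : star_calc -> star_calc;
  fstarD : {morph fstar : w v / w + v};
  fstarZ : forall (c : C) w, fstar (c *: w) = c^* *: fstar w;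
  fstarK : involutive fstar;
  fstar_iota : forall b, fstar (iota0 star_calc b) = iota0 star_calc (sB b);
  fstar_deg : forall k w,
    homog (degp star_calc) k w -> homog (degp star_calc) k (fstar w);
  fstar_diff : forall w, diff star_calc (fstar w) = fstar (diff star_calc w);
  fstarM : forall k l w v,
    homog (degp star_calc) k w -> homog (degp star_calc) l v ->
    fstar (w * v) = (-1) ^+ (k * l) * (fstar v * fstar w)
}.
Arguments fstar {C B sB} s _.

Record complexStructure (C : numClosedFieldType) (B : algType C) (sB : starOp B)
    (Om : starCalculus sB) := ComplexStructure {
  bidegp : nat * nat -> {linear Om -> Om};
  bidegp_grading : is_grading bidegp;
  bidegM : forall p q p' q' (w v : Om),
    homog bidegp (p, q) w -> homog bidegp (p', q') v ->
    homog bidegp (p + p', q + q')%N (w * v);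
  bideg_total : forall k (w : Om), degp Om k w = \sum_(p < k.+1) bidegp (p : nat, k - p)%N w;
  bideg_star : forall p q (w : Om),
    homog bidegp (p, q) w -> homog bidegp (q, p) (fstar Om w);
  bideg_diff : forall p q (w : Om), homog bidegp (p, q) w ->
    diff Om w = bidegp (p.+1, q) (diff Om w) + bidegp (p, q.+1) (diff Om w)
}.

Section Forms.
Variables (C : numClosedFieldType) (B : algType C) (sB : starOp B).
Variables (Om : starCalculus sB) (cs : complexStructure Om).

Definition forms_bimod : bimod B.
Proof.
refine (@Bimod _ B Om (fun b w => iota0 Om b * w) (fun w b => w * iota0 Om b)
  _ _ _ _ _ _ _ _ _).
- by move=> *; rewrite linearD mulrDl.
- by move=> *; rewrite mulrDr.
- by move=> *; rewrite rmorphM mulrA.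
- by move=> *; rewrite linearZ /= rmorph1 -scalerAl mul1r.
- by move=> *; rewrite mulrDl.
- by move=> *; rewrite linearD mulrDr.
- by move=> *; rewrite rmorphM mulrA.
- by move=> *; rewrite linearZ /= rmorph1 -scalerAr mulr1.
- by move=> *; rewrite mulrA.
Defined.

Lemma iota0_deg b : homog (degp Om) 0%N (iota0 Om b).
Proof. by apply/iota0_im; exists b. Qed.

Lemma iota0_bideg b : homog (bidegp cs) (0, 0)%N (iota0 Om b).
Proof.
by rewrite /homog; have := bideg_total cs 0 (iota0 Om b);
  rewrite big_ord1 /= => <-; exact: iota0_deg.
Qed.

Definition deg_proj (k : nat) : bproj forms_bimod.
Proof.
refine (@BProj _ _ forms_bimod (degp Om k) _ _ _).
- by move=> w; have [-> _] := degp_grading Om; rewrite eqxx.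
- move=> b w; apply: (grading_commutes (L := fun v => iota0 Om b * v)).
  + exact: degp_grading.
  + by move=> x y; rewrite mulrDr.
  + by move=> i v hv; apply: (degM (k := 0)) hv; exact: iota0_deg.
- move=> w b; apply: (grading_commutes (L := fun v => v * iota0 Om b)).
  + exact: degp_grading.
  + by move=> x y; rewrite mulrDl.
  + by move=> i v hv; rewrite -(addn0 i); apply: degM hv _; exact: iota0_deg.
Defined.

Definition bideg_proj (pq : nat * nat) : bproj forms_bimod.
Proof.
refine (@BProj _ _ forms_bimod (bidegp cs pq) _ _ _).
- by move=> w; have [-> _] := bidegp_grading cs; rewrite eqxx.
- move=> b w; apply: (grading_commutes (L := fun v => iota0 Om b * v)).
  + exact: bidegp_grading.
  + by move=> x y; rewrite mulrDr.
  + move=> [p q] v hv; apply: (bidegM (p := 0) (q := 0)) hv; exact: iota0_bideg.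
- move=> w b; apply: (grading_commutes (L := fun v => v * iota0 Om b)).
  + exact: bidegp_grading.
  + by move=> x y; rewrite mulrDl.
  + move=> [p q] v hv; rewrite -(addn0 p) -(addn0 q).
    by apply: bidegM hv _; exact: iota0_bideg.
Defined.

(* Om^1 and Om^(p,q), and the projections onto them.  On an element that
   already lies in the target, the projection merely changes its type. *)
Definition Om1 : bimod B := summand (deg_proj 1).
Definition Ompq (p q : nat) : bimod B := summand (bideg_proj (p, q)).
Definition in1 (w : Om) : Om1 := corestr (deg_proj 1) (w : forms_bimod).
Definition inpq (p q : nat) (w : Om) : Ompq p q :=
  corestr (bideg_proj (p, q)) (w : forms_bimod).
Definition out1 (w : Om1) : Om := val w.
Definition outpq (p q : nat) (w : Ompq p q) : Om := val w.

Definition incl1 (p q : nat) (w : Ompq p q) : Om1 := in1 (outpq w).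
Definition proj1 (p q : nat) (w : Om1) : Ompq p q := inpq p q (out1 w).

Definition d0 (b : B) : Om1 := in1 (diff Om (iota0 Om b)).
Definition star_1 (w : Om1) : Om1 := in1 (fstar Om (out1 w)).

Definition del (p q : nat) (w : Ompq p q) : Ompq p.+1 q :=
  inpq p.+1 q (diff Om (outpq w)).
Definition delbar (p q : nat) (w : Ompq p q) : Ompq p q.+1 :=
  inpq p q.+1 (diff Om (outpq w)).

Definition wedge_l (p q : nat) : tensB (Ompq 0 q) (Ompq p 0) -> Ompq p q :=
  tliftB (fun v w => inpq p q (outpq v * outpq w)).
Definition wedge_r (p q : nat) : tensB (Ompq p 0) (Ompq 0 q) -> Ompq p q :=
  tliftB (fun w v => inpq p q (outpq w * outpq v)).

Record factorization := Factorization {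
  theta_l : forall p q, Ompq p q -> tensB (Ompq 0 q) (Ompq p 0);
  theta_r : forall p q, Ompq p q -> tensB (Ompq p 0) (Ompq 0 q);
  theta_lK : forall p q, cancel (@theta_l p q) (@wedge_l p q);
  wedge_lK : forall p q, cancel (@wedge_l p q) (@theta_l p q);
  theta_rK : forall p q, cancel (@theta_r p q) (@wedge_r p q);
  wedge_rK : forall p q, cancel (@wedge_r p q) (@theta_r p q)
}.

(* Holomorphic structures of Om^(1,0) and, for the opposite complex structure,
   of Om^(0,1).  Their integrability follows from [diffK] and the
   factorization, so it is not a separate condition. *)
Definition dbar10 (th : factorization) (w : Ompq 1 0) : tensB (Ompq 0 1) (Ompq 1 0) :=
  theta_l th (delbar w).
Definition dbar01_op (th : factorization) (w : Ompq 0 1) : tensB (Ompq 1 0) (Ompq 0 1) :=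
  theta_r th (del w).

Definition left_connection (E : bimod B) (nabla : E -> tensB Om1 E) : Prop :=
  linear nabla /\
  forall b e, nabla (lact b e) = lact b (nabla e) + tpB (d0 b) e.

Definition bimodule_connection (E : bimod B) (nabla : E -> tensB Om1 E) : Prop :=
  left_connection nabla /\
  exists sigma : tensB E Om1 -> tensB Om1 E, bimod_map sigma /\
    forall e b, nabla (ract e b) = ract (nabla e) b + sigma (tpB e (d0 b)).

(* sum of \overline{x_i} (x)_B w_i^* where nabla f = sum of w_i (x)_B x_i *)
Definition nabla_conj (E : bimod B) (nabla : E -> tensB Om1 E)
    (f : conjB sB E) : tensB (conjB sB E) Om1 :=
  tliftB (fun w x => tpB (conj_elt sB x) (star_1 w) : tensB (conjB sB E) Om1)
    (nabla (uncj f)).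

Definition compatible (E : bimod B) (h : conjB sB E -> homB E)
    (nabla : E -> tensB Om1 E) : Prop :=
  forall e f : E,
    d0 (herm h e f) =
      tliftB (fun w x => ract w (herm h x f)) (nabla e) +
      tliftB (fun x w => lact (heval (h x) e) w) (nabla_conj nabla (conj_elt sB f)).

(* The Chern connection of (E, dbarE, h), for the complex structure whose
   forms of type (0,1) are Om^(p,q): (p, q) = (0, 1) for the given structure
   and (p, q) = (1, 0) for the opposite one. *)
Definition chern_connection (p q : nat) (E : bimod B)
    (dbarE : E -> tensB (Ompq p q) E) (h : conjB sB E -> homB E)
    (nabla : E -> tensB Om1 E) : Prop :=
  [/\ left_connection nabla, compatible h nabla
    & forall e, tmapB (proj1 p q) id (nabla e) = dbarE e].

(* nabla (w + v) = nablaCh w + nablaChop v for w in Om^(1,0), v in Om^(0,1) *)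
Definition sum_connection (n10 : Ompq 1 0 -> tensB Om1 (Ompq 1 0))
    (n01 : Ompq 0 1 -> tensB Om1 (Ompq 0 1)) (w : Om1) : tensB Om1 Om1 :=
  tmapB id (@incl1 1 0) (n10 (proj1 1 0 w)) +
  tmapB id (@incl1 0 1) (n01 (proj1 0 1 w)).

Definition dagger (x : tensB Om1 Om1) : tensB Om1 Om1 :=
  tliftB (fun w v => tpB (star_1 v) (star_1 w) : tensB Om1 Om1) x.

Definition is_metric (g : tensB Om1 Om1) (pair : tensB Om1 Om1 -> regular_bimod B) :
    Prop :=
  [/\ bimod_map pair,
      forall w, tliftB (fun x y => lact (pair (tpB w x)) y) g = w
    & forall w, tliftB (fun x y => ract x (pair (tpB y w))) g = w].

Definition real_metric (g : tensB Om1 Om1) : Prop := dagger g = g.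

End Forms.

(* Bilinearity of the coaction of Om^k in the sense of [covariant_bimod] follows
   from [fcoact_iota] and [fcoactM]. *)
Record covariantCalculus (C : numClosedFieldType) (A : hopfStarAlg C)
    (H : hopfAlg C) (pi : hopfMap A H) (D : baseStar pi)
    (Om : starCalculus (base_star D)) := CovariantCalculus {
  fcoact : Om -> (A ⊗ Om)%type;
  fcoactP : is_coaction fcoact;
  fcoact1 : fcoact 1 = 1 ⊗ 1;
  fcoactM : forall w v, fcoact (w * v) = tmulA (fcoact w) (fcoact v);
  fcoact_iota : colinear (base_coact D) fcoact (iota0 Om);
  fcoact_star : forall w, fcoact (fstar Om w) = tmap hstar (fstar Om) (fcoact w);
  fcoact_deg : forall k w, homog (degp Om) k w ->
    tmap id (degp Om k) (fcoact w) = fcoact w;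
  fcoact_diff : colinear fcoact fcoact (diff Om)
}.
Arguments fcoact {C A H pi D Om} c _.

Section CovariantForms.
Variables (C : numClosedFieldType) (A : hopfStarAlg C) (H : hopfAlg C).
Variables (pi : hopfMap A H) (D : baseStar pi).
Variables (Om : starCalculus (base_star D)) (cc : covariantCalculus Om).
Variable cs : complexStructure Om.
Local Notation Om1 := (Om1 Om).

Definition covariant_complex : Prop :=
  forall p q w, homog (bidegp cs) (p, q) w ->
    tmap id (bidegp cs (p, q)) (fcoact cc w) = fcoact cc w.

Definition coact1 : Om1 -> (A ⊗ Om1)%type :=
  summand_coact (M := forms_bimod Om) (P := deg_proj Om 1) (fcoact cc).
Definition coactpq (p q : nat) : Ompq cs p q -> (A ⊗ Ompq cs p q)%type :=
  summand_coact (M := forms_bimod Om) (P := bideg_proj cs (p, q)) (fcoact cc).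

Definition covariant_metric (g : tensB Om1 Om1)
    (pair : tensB Om1 Om1 -> regular_bimod (coinv pi)) : Prop :=
  colinear (tens_coact coact1 coact1) (base_coact D) pair /\
  colinear (base_coact D) (tens_coact coact1 coact1) (fun b => lact b g).

(* H(\overline{w})(v) = (v, w^* ) *)
Definition hermitian_of_metric (p q : nat)
    (pair : tensB Om1 Om1 -> regular_bimod (coinv pi))
    (h : conjB (base_star D) (Ompq cs p q) -> homB (Ompq cs p q)) : Prop :=
  forall w v : Ompq cs p q, herm h v w = pair (tpB (incl1 v) (star_1 (incl1 w))).

Definition covariant_connection (nabla : Om1 -> tensB Om1 Om1) : Prop :=
  colinear coact1 (tens_coact coact1 coact1) nabla.

End CovariantForms.

Arguments coact1 {C A H pi D Om} cc _.
Arguments coactpq {C A H pi D Om} cc cs p q _.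

(* Main.v *)
Require Import Defs.
From mathcomp Require Import all_boot all_order all_algebra.
From mathcomp Require Import boolp reals complex.

Set Implicit Arguments.
Unset Strict Implicit.
Unset Printing Implicit Defensive.

Import GRing.Theory Num.Theory.
Local Open Scope ring_scope.

(** Let W be the bimodule of one-forms, p and q its projections onto the forms
of type (1,0) and (0,1), and let phi be the part of the metric that pairs p W
with q W and q W with p W.  As the star exchanges the two types, the two
Hermitian metrics together are exactly the pairing phi.

Since the Hermitian metrics are bijective, every functional (-, x) given by the
metric is phi (-, tau x) for a unique tau x; moving the coevaluation g of the
metric along tau yields a coevaluation u for phi ([transfer_metric]).  Hence phi
separates the elements of W (x) W ([contract_r_inj]), and every right linear
endomorphism f of W is the contraction against one such element
([contract_representing]).

The sum nabla of the two Chern connections is compatible with phi as a whole,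

  d phi(w, x) = phi(nabla w, x) + phi(w, (nabla x^* )^* ),

which is the compatibility of one of the two Chern connections when w and x have
different types, while both sides vanish when they have the same type
([sum_compatible]).  One half of nabla, namely
D = (q (x) 1) nabla p + (p (x) 1) nabla q, is given by the two holomorphic
structures: it is the exterior derivative followed by the inverse of a wedge
product.  Projecting the compatibility onto one type of forms at a time
expresses phi(residual w, x) for the other half of nabla through d, phi, the star
and D alone ([contract_residual]).  Both conclusions are read off from this
formula.

For the bimodule property, the ordinary Leibniz rule and the bilinearity of the
inverse wedge products give D (w b) = D(w) b + s (w (x) db) for a bimodule map s
([holo_ract]).  Inserting this in the formula shows that residual (w b) -
residual(w) b contracts with x to phi(w, s(x^* (x) (db)^* )^* ), which is bilinear
in w and db; so it is the value at w (x) db of a bimodule map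
([residual_ract], [nabla_braided]).

For covariance, d, the star, the projections and phi are colinear, and so is an
inverse of a colinear wedge product.  Thus the contraction of the residual with x
is a colinear function of (w, x), and the leg x can be cancelled because u is
coinvariant ([contract_r_coact_inj], [nabla_colinear]).  That u is coinvariant
means that tau is colinear; as (m, x) and phi(m, tau x) are the same colinear
functions of m, this follows by cancelling the leg m with the antipode
([antipode_cancel]). *)

(** * Twisted linear maps and tensors over the scalars *)

Section TwistedLinear.
Variable C : numClosedFieldType.

(** Linearity is a property of functions here because most maps below are composed
on the fly; the twist s makes the star, which is antilinear, an instance. *)
Definition twisted_linear (s : C -> C) (M N : lmodType C) (f : M -> N) : Prop :=
  {morph f : x y / x + y} /\ forall c x, f (c *: x) = s c *: f x.

Definition clinear (M N : lmodType C) (f : M -> N) : Prop := twisted_linear id f.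

Definition cbilinear (M N P : lmodType C) (f : M -> N -> P) : Prop :=
  (forall n, clinear (f^~ n)) /\ (forall m, clinear (f m)).

Lemma morph0 (U V : zmodType) (f : U -> V) : {morph f : x y / x + y} -> f 0 = 0.
Proof. by move=> fD; apply: (@addIr _ (f 0)); rewrite -fD !add0r. Qed.

Lemma morphN (U V : zmodType) (f : U -> V) :
  {morph f : x y / x + y} -> {morph f : x / - x}.
Proof.
by move=> fD x; apply: (@addIr _ (f x)); rewrite -fD !addNr morph0.
Qed.

Lemma morphB (U V : zmodType) (f : U -> V) :
  {morph f : x y / x + y} -> {morph f : x y / x - y}.
Proof. by move=> fD x y; rewrite fD (morphN fD). Qed.

Lemma clinear_id (M : lmodType C) : clinear (@id M).
Proof. by []. Qed.

Lemma twisted_comp s t (M N P : lmodType C) (f : M -> N) (g : N -> P) :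
  twisted_linear s f -> twisted_linear t g ->
  twisted_linear (t \o s) (fun x => g (f x)).
Proof.
move=> [fD fZ] [gD gZ]; split=> [x y|c x]; first by rewrite fD gD.
by rewrite fZ gZ.
Qed.

Lemma clinear_comp (M N P : lmodType C) (f : M -> N) (g : N -> P) :
  clinear f -> clinear g -> clinear (fun x => g (f x)).
Proof. exact: twisted_comp. Qed.

Lemma clinear_add (M N : lmodType C) (f g : M -> N) :
  clinear f -> clinear g -> clinear (fun x => f x + g x).
Proof.
move=> [fD fZ] [gD gZ]; split=> [x y|c x]; first by rewrite fD gD addrACA.
by rewrite fZ gZ scalerDr.
Qed.

Lemma clinear_opp (M N : lmodType C) (f : M -> N) :
  clinear f -> clinear (fun x => - f x).
Proof.
move=> [fD fZ]; split=> [x y|c x]; first by rewrite fD opprD.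
by rewrite fZ scalerN.
Qed.

Lemma clinear_linear (M N : lmodType C) (f : M -> N) : linear f -> clinear f.
Proof.
move=> fl; have f0 : f 0 = 0.
  by apply: (@addIr _ (f 0)); rewrite -{1}[f 0]scale1r -fl scaler0 !add0r.
split=> [x y|c x]; first by rewrite -[x in LHS]scale1r fl scale1r.
by rewrite -[c *: x]addr0 fl f0 addr0.
Qed.

Lemma linear_clinear (M N : lmodType C) (f : M -> N) : clinear f -> linear f.
Proof. by move=> [fD fZ] c x y; rewrite fD fZ. Qed.

Lemma bilinear_comp (M N P Q M' N' : lmodType C) (b : M -> N -> P)
    (f : M' -> M) (g : N' -> N) (h : P -> Q) :
  cbilinear b -> clinear f -> clinear g -> clinear h ->
  cbilinear (fun m n => h (b (f m) (g n))).
Proof.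
move=> [b1 b2] fl gl hl; split=> [n|m]; apply: (clinear_comp _ hl).
  exact: (clinear_comp fl (b1 (g n))).
exact: (clinear_comp gl (b2 (f m))).
Qed.

Lemma bilinear_add (M N P : lmodType C) (b b' : M -> N -> P) :
  cbilinear b -> cbilinear b' -> cbilinear (fun m n => b m n + b' m n).
Proof.
by move=> [h1 h2] [h3 h4]; split=> [n|m]; apply: clinear_add.
Qed.

Lemma bilinear_mul (A : algType C) : cbilinear (@GRing.mul A).
Proof.
split=> [b|a]; split=> [x y|c x]; rewrite ?mulrDl ?mulrDr //.
  by rewrite scalerAl.
by rewrite scalerAr.
Qed.

Lemma bilinear_pure (M N : lmodType C) : cbilinear (@tpureC C M N).
Proof.
split=> [n|m]; split=> [x y|c x]; rewrite ?tpureCDl ?tpureCDr //.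
  by rewrite tpureCZl.
by rewrite tpureCZr.
Qed.

Lemma tensC_ext (M N : lmodType C) (V : zmodType) (h h' : (M ⊗ N)%type -> V) :
  {morph h : x y / x + y} -> {morph h' : x y / x + y} ->
  (forall m n, h (m ⊗ n) = h' (m ⊗ n)) -> h =1 h'.
Proof.
move=> hD h'D hp; elim/tensC_ind => [//||x y hx hy].
  by rewrite !morph0.
by rewrite hD h'D hx hy.
Qed.

Lemma bilinear_balanced (M N P : lmodType C) (b : M -> N -> P) :
  cbilinear b -> cbalanced b.
Proof.
move=> [bl br]; split=> [m m' n|m n n'|m c n].
- by case: (bl n) => ->.
- by case: (br m) => ->.
- by case: (bl n) => _ /= ->; case: (br m) => _ ->.
Qed.

Lemma tlift_clinear (M N P : lmodType C) (b : M -> N -> P) :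
  cbilinear b -> clinear (tliftC b).
Proof.
move=> bb; have bal := bilinear_balanced bb.
split=> [x y|c x]; first exact: tliftCD.
elim/tensC_ind: x => [m n||x y hx hy].
- rewrite -tpureCZl !tliftCE //; case: bb => bl _; by case: (bl n) => _ ->.
- by rewrite scaler0 tliftC0 // scaler0.
- by rewrite scalerDr !tliftCD // hx hy scalerDr.
Qed.

Section Tmap.
Variables (s : C -> C) (M N M' N' : lmodType C) (f : M -> M') (g : N -> N').
Hypotheses (fl : twisted_linear s f) (gl : twisted_linear s g).

Lemma tmap_cbalanced : cbalanced (fun m n => f m ⊗ g n).
Proof.
case: fl gl => fD fZ [gD gZ].
split=> *; rewrite ?fD ?gD ?tpureCDl ?tpureCDr // fZ gZ.
by rewrite tpureCZl tpureCZr.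
Qed.

Lemma tmap_pure m n : tmap f g (m ⊗ n) = f m ⊗ g n.
Proof. by rewrite /tmap tliftCE //; exact: tmap_cbalanced. Qed.

Lemma tmap_additive : {morph tmap f g : x y / x + y}.
Proof. by apply: tliftCD; exact: tmap_cbalanced. Qed.

Lemma tmap_twisted : twisted_linear s (tmap f g).
Proof.
split; first exact: tmap_additive.
move=> c; elim/tensC_ind => [m n||x y hx hy].
- by rewrite -tpureCZl !tmap_pure; case: fl => _ ->; rewrite tpureCZl.
- by rewrite scaler0 (morph0 tmap_additive) scaler0.
- by rewrite scalerDr !tmap_additive hx hy scalerDr.
Qed.
End Tmap.

Lemma tmap_compose s t (M N M' N' M'' N'' : lmodType C)
    (f : M -> M') (g : N -> N') (f' : M' -> M'') (g' : N' -> N'') X :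
  twisted_linear s f -> twisted_linear s g ->
  twisted_linear t f' -> twisted_linear t g' ->
  tmap f' g' (tmap f g X) = tmap (fun x => f' (f x)) (fun y => g' (g y)) X.
Proof.
move=> fl gl fl' gl'.
have cl := twisted_comp fl fl'; have dl := twisted_comp gl gl'.
apply: (tensC_ext (h := fun X => tmap f' g' (tmap f g X))) => [x y|x y|m n].
- by rewrite !(tmap_additive fl gl, tmap_additive fl' gl').
- by rewrite (tmap_additive cl dl).
- by rewrite (tmap_pure fl gl) (tmap_pure fl' gl') (tmap_pure cl dl).
Qed.

Lemma tmap_id (M N : lmodType C) (X : (M ⊗ N)%type) : tmap id id X = X.
Proof.
have il P := @clinear_id P.
apply: (tensC_ext (h := tmap id id) (h' := id)) => [|//|m n].
  exact: tmap_additive.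
by rewrite (tmap_pure (il M) (il N)).
Qed.

Lemma tmap_sum2 (M N P : lmodType C) (f g : N -> P) (X : (M ⊗ N)%type) :
  clinear f -> clinear g ->
  tmap id (fun y => f y + g y) X = tmap id f X + tmap id g X.
Proof.
move=> fl gl; have il := @clinear_id M; have fgl := clinear_add fl gl.
apply: (tensC_ext (h := tmap id _) (h' := fun X => tmap id f X + tmap id g X)).
- exact: (tmap_additive il fgl).
- by move=> x y; rewrite (tmap_additive il fl) (tmap_additive il gl) addrACA.
- move=> m n.
  by rewrite (tmap_pure il fl) (tmap_pure il gl) (tmap_pure il fgl) tpureCDr.
Qed.

Lemma tmap_opp (M N P : lmodType C) (f : N -> P) (X : (M ⊗ N)%type) :
  clinear f -> tmap id (fun y => - f y) X = - tmap id f X.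
Proof.
move=> fl; have il := @clinear_id M; have ofl := clinear_opp fl.
apply: (tensC_ext (h := tmap id _) (h' := fun X => - tmap id f X)).
- exact: (tmap_additive il ofl).
- by move=> x y; rewrite (tmap_additive il fl) opprD.
- move=> m n; rewrite (tmap_pure il fl) (tmap_pure il ofl).
  by rewrite -scaleN1r tpureCZr scaleN1r.
Qed.

Section Tmul.
Variables (M N M' N' P Q : lmodType C) (f : M -> M' -> P) (g : N -> N' -> Q).
Hypotheses (fb : cbilinear f) (gb : cbilinear g).

Lemma tmul_balanced_in m n :
  cbilinear (fun m' n' => f m m' ⊗ g n n').
Proof.
case: fb gb => _ fr [_ gr].
have [pl pr] := bilinear_pure P Q.
split=> [n'|m'].
  exact: (clinear_comp (fr m) (pl (g n n'))).
exact: (clinear_comp (gr n) (pr (f m m'))).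
Qed.

Lemma tmul_balanced_out Y :
  cbilinear (fun m n => tliftC (fun m' n' => f m m' ⊗ g n n') Y).
Proof.
have hin m n := tlift_clinear (tmul_balanced_in m n).
case: fb gb => fl _ [gl _]; have [pl pr] := bilinear_pure P Q.
have inE m n m' n' : tliftC (fun m' n' => f m m' ⊗ g n n') (m' ⊗ n')
    = f m m' ⊗ g n n'.
  by rewrite tliftCE //; apply: bilinear_balanced; exact: tmul_balanced_in.
split=> [n|m]; split.
- move=> m1 m2 /=; move: Y; apply: tensC_ext => [|x y|m' n'].
  + by case: (hin (m1 + m2) n).
  + by case: (hin m1 n) => ->; case: (hin m2 n) => ->; rewrite addrACA.
  + by rewrite !inE; case: (fl m') => -> _; rewrite tpureCDl.
- move=> c m /=; move: Y; apply: tensC_ext => [|x y|m' n'].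
  + by case: (hin (c *: m) n).
  + by case: (hin m n) => ->; rewrite scalerDr.
  + by rewrite !inE; case: (fl m') => _ ->; rewrite tpureCZl.
- move=> n1 n2 /=; move: Y; apply: tensC_ext => [|x y|m' n'].
  + by case: (hin m (n1 + n2)).
  + by case: (hin m n1) => ->; case: (hin m n2) => ->; rewrite addrACA.
  + by rewrite !inE; case: (gl n') => -> _; rewrite tpureCDr.
- move=> c n /=; move: Y; apply: tensC_ext => [|x y|m' n'].
  + by case: (hin m (c *: n)).
  + by case: (hin m n) => ->; rewrite scalerDr.
  + by rewrite !inE; case: (gl n') => _ ->; rewrite tpureCZr.
Qed.

Lemma tmul_pure m n m' n' :
  tmul f g (m ⊗ n) (m' ⊗ n') = f m m' ⊗ g n n'.
Proof.
rewrite /tmul tliftCE; last exact: bilinear_balanced (tmul_balanced_out _).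
by rewrite tliftCE //; exact: bilinear_balanced (tmul_balanced_in _ _).
Qed.

Lemma tmul_bilinear : cbilinear (tmul f g).
Proof.
split=> [Y|X]; first exact: tlift_clinear (tmul_balanced_out Y).
have hl Y := tlift_clinear (tmul_balanced_out Y).
have hin m n := tlift_clinear (tmul_balanced_in m n).
have outE m n Y : tmul f g (m ⊗ n) Y = tliftC (fun m' n' => f m m' ⊗ g n n') Y.
  by rewrite /tmul tliftCE //; exact: bilinear_balanced (tmul_balanced_out _).
split=> [Y Y'|c Y]; move: X; apply: tensC_ext.
- by case: (hl (Y + Y')).
- move=> x y; case: (hl Y) => hD _; case: (hl Y') => hD' _.
  by rewrite {1 2}/tmul hD hD' addrACA.
- by move=> m n; rewrite !outE; case: (hin m n) => ->.
- by case: (hl (c *: Y)).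
- move=> x y; case: (hl Y) => hD _.
  by rewrite {1}/tmul hD scalerDr.
- by move=> m n; rewrite !outE; case: (hin m n) => _ ->.
Qed.

Lemma tmulDl Y : {morph (tmul f g)^~ Y : x y / x + y}.
Proof. by case: tmul_bilinear => h _; case: (h Y). Qed.
Lemma tmulDr X : {morph tmul f g X : x y / x + y}.
Proof. by case: tmul_bilinear => _ h; case: (h X). Qed.
End Tmul.

Lemma tensC_ext2 (M N M' N' : lmodType C) (V : zmodType)
    (h h' : (M ⊗ N)%type -> (M' ⊗ N')%type -> V) :
  (forall Y, {morph h^~ Y : x y / x + y}) -> (forall X, {morph h X : x y / x + y}) ->
  (forall Y, {morph h'^~ Y : x y / x + y}) ->
  (forall X, {morph h' X : x y / x + y}) ->
  (forall m n m' n', h (m ⊗ n) (m' ⊗ n') = h' (m ⊗ n) (m' ⊗ n')) ->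
  forall X Y, h X Y = h' X Y.
Proof.
move=> hl hr hl' hr' hp X Y; move: X; apply: tensC_ext => // m n.
by move: Y; apply: tensC_ext.
Qed.

Lemma tmul_tmap (A M N M' N' P Q : lmodType C) (f : A -> A -> A)
    (b : M -> N -> P) (k : M' -> M) (l : N' -> N) (h : P -> Q) X Y :
  cbilinear f -> cbilinear b -> clinear k -> clinear l -> clinear h ->
  tmap id h (tmul f b (tmap id k X) (tmap id l Y)) =
  tmul f (fun m n => h (b (k m) (l n))) X Y.
Proof.
move=> fb bb kl ll hl; have il := @clinear_id A.
have cb := bilinear_comp bb kl ll hl.
move: X Y; apply: tensC_ext2 => [Y x y|X x y|Y x y|X x y|m n m' n'].
- by rewrite (tmap_additive il kl) (tmulDl fb bb) (tmap_additive il hl).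
- by rewrite (tmap_additive il ll) (tmulDr fb bb) (tmap_additive il hl).
- exact: (tmulDl fb cb).
- exact: (tmulDr fb cb).
- rewrite (tmap_pure il kl) (tmap_pure il ll) (tmul_pure fb bb).
  by rewrite (tmap_pure il hl) (tmul_pure fb cb).
Qed.

(** Coassociative bookkeeping: a rebracketing of b1 and b2 as b3 and b4 passes to
the Sweedler legs because the product of A is associative.  All identities
between coactions of iterated contractions are instances of it. *)
Lemma tmul_assoc (A : algType C) (M N L P Q K : lmodType C)
    (b1 : M -> N -> P) (b2 : P -> L -> K) (b3 : N -> L -> Q) (b4 : M -> Q -> K)
    (X : (A ⊗ M)%type) (Y : (A ⊗ N)%type) (Z : (A ⊗ L)%type) :
  cbilinear b1 -> cbilinear b2 -> cbilinear b3 -> cbilinear b4 ->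
  (forall m n l, b2 (b1 m n) l = b4 m (b3 n l)) ->
  tmul *%R b2 (tmul *%R b1 X Y) Z = tmul *%R b4 X (tmul *%R b3 Y Z).
Proof.
move=> h1 h2 h3 h4 h; have hm := bilinear_mul A.
move: X; apply: tensC_ext => [x y|x y|a m].
- by rewrite (tmulDl hm h1) (tmulDl hm h2).
- by rewrite (tmulDl hm h4).
move: Y Z; apply: tensC_ext2 => [Z x y|Y x y|Z x y|Y x y|a' n a'' l].
- by rewrite (tmulDr hm h1) (tmulDl hm h2).
- by rewrite (tmulDr hm h2).
- by rewrite (tmulDl hm h3) (tmulDr hm h4).
- by rewrite (tmulDr hm h3) (tmulDr hm h4).
- rewrite (tmul_pure hm h1) (tmul_pure hm h2) (tmul_pure hm h3) (tmul_pure hm h4).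
  by rewrite mulrA h.
Qed.

End TwistedLinear.

(** * Bimodules and balanced tensors *)

Section BimoduleTensors.
Variables (C : numClosedFieldType) (B : algType C).
Local Notation bimod := (bimod B).

Lemma tensB_ext (M N : bimod) (V : zmodType) (h h' : tensB M N -> V) :
  {morph h : x y / x + y} -> {morph h' : x y / x + y} ->
  (forall m n, h (tpB m n) = h' (tpB m n)) -> h =1 h'.
Proof.
move=> hD h'D hp; elim/tensB_ind => [//||x y hx hy]; first by rewrite !morph0.
by rewrite hD h'D hx hy.
Qed.

Lemma bimod_map_clinear (M N : bimod) (f : M -> N) : bimod_map f -> clinear f.
Proof. by move=> [fD fl _]; split=> // c x; rewrite -!lactC fl. Qed.

Lemma bimod_map_id (M : bimod) : bimod_map (@id M).
Proof. by []. Qed.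

Lemma bimod_map_comp (M N P : bimod) (f : M -> N) (g : N -> P) :
  bimod_map f -> bimod_map g -> bimod_map (fun x => g (f x)).
Proof.
move=> [fD fl fr] [gD gl gr]; split=> [x y|b x|x b].
- by rewrite fD gD.
- by rewrite fl gl.
- by rewrite fr gr.
Qed.

Lemma bimod_map_add (M N : bimod) (f g : M -> N) :
  bimod_map f -> bimod_map g -> bimod_map (fun x => f x + g x).
Proof.
move=> [fD fl fr] [gD gl gr]; split=> [x y|b m|m b].
- by rewrite fD gD addrACA.
- by rewrite fl gl lactDr.
- by rewrite fr gr ractDl.
Qed.

Lemma lact0 (M : bimod) b : lact b (0 : M) = 0.
Proof. by apply: (morph0 (f := lact b)) => x y; exact: lactDr. Qed.
Lemma lactN (M : bimod) b (m : M) : lact b (- m) = - lact b m.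
Proof. by apply: (morphN (f := lact b)) => x y; exact: lactDr. Qed.
Lemma ractN (M : bimod) (m : M) b : ract (- m) b = - ract m b.
Proof. by apply: (morphN (f := ract^~ b)) => x y; exact: ractDl. Qed.

Lemma ract1 (M : bimod) (m : M) : ract m 1 = m.
Proof. by rewrite -[1](scale1r 1) ractC scale1r. Qed.

Lemma bimod_map_opp (M N : bimod) (f : M -> N) :
  bimod_map f -> bimod_map (fun x => - f x).
Proof.
move=> [fD fl fr]; split=> [x y|b x|x b].
- by rewrite fD opprD.
- by rewrite fl lactN.
- by rewrite fr ractN.
Qed.

Lemma bilinear_lact (M : bimod) : cbilinear (fun b (m : M) => lact b m).
Proof.
split=> [m|b]; split=> [x y|c x]; rewrite ?lactDl ?lactDr //.
  by rewrite -[X in _ = X]lactC lactA -scalerAl mul1r.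
by rewrite -!lactC !lactA -scalerAl -scalerAr mul1r mulr1.
Qed.

Lemma bilinear_ract (M : bimod) : cbilinear (fun (m : M) b => ract m b).
Proof.
split=> [b|m]; split=> [x y|c x]; rewrite ?ractDl ?ractDr //.
  by rewrite -!ractC !ractA -scalerAl -scalerAr mul1r mulr1.
by rewrite -[X in _ = X]ractC ractA -scalerAr mulr1.
Qed.

Lemma tpBDl (M N : bimod) (m m' : M) (n : N) :
  tpB (m + m') n = tpB m n + tpB m' n.
Proof. by case: (tpB_balanced M N). Qed.
Lemma tpBDr (M N : bimod) (m : M) (n n' : N) :
  tpB m (n + n') = tpB m n + tpB m n'.
Proof. by case: (tpB_balanced M N). Qed.
Lemma tpBM (M N : bimod) (m : M) b (n : N) :
  tpB (ract m b) n = tpB m (lact b n).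
Proof. by case: (tpB_balanced M N) => _ _ ->. Qed.
Lemma lact_tpB (M N : bimod) b (m : M) (n : N) :
  lact b (tpB m n : tensB M N) = tpB (lact b m) n.
Proof. exact: tlactE. Qed.
Lemma ract_tpB (M N : bimod) b (m : M) (n : N) :
  ract (tpB m n : tensB M N) b = tpB m (ract n b).
Proof. exact: tractE. Qed.

Definition bimod_form (M N P : bimod) (f : M -> N -> P) : Prop :=
  [/\ bbalanced f, forall b m n, f (lact b m) n = lact b (f m n)
    & forall m n b, f m (ract n b) = ract (f m n) b].

Section Form.
Variables (M N P : bimod) (f : M -> N -> P).
Hypothesis ff : bimod_form f.

Lemma bimod_form_lift : bimod_map (tliftB f : tensB M N -> P).
Proof.
case: ff => fb fl fr; have fD := tliftBD fb; split=> // [b X|X b]; move: X.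
- apply: (tensB_ext (h := fun X => tliftB f (lact b X))
    (h' := fun X => lact b (tliftB f X))) => [x y|x y|m n].
  + by rewrite lactDr fD.
  + by rewrite fD lactDr.
  + by rewrite lact_tpB !tliftBE ?fl.
- apply: (tensB_ext (h := fun X => tliftB f (ract X b))
    (h' := fun X => ract (tliftB f X) b)) => [x y|x y|m n].
  + by rewrite ractDl fD.
  + by rewrite fD ractDl.
  + by rewrite ract_tpB !tliftBE ?fr.
Qed.

Lemma bimod_form_bilinear : cbilinear f.
Proof.
case: ff => [[fDl fDr fM] fl fr].
split=> [n|m]; split=> [x y|c x]; rewrite ?fDl ?fDr //.
  by rewrite -!lactC fl.
by rewrite -!ractC fr.
Qed.
End Form.

Lemma bimod_form_tpB (M N : bimod) : bimod_form (fun m n => tpB m n : tensB M N).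
Proof.
by split=> [|b m n|m n b]; rewrite ?lact_tpB ?ract_tpB //; exact: tpB_balanced.
Qed.

Lemma bilinear_tpB (M N : bimod) : cbilinear (fun m n => tpB m n : tensB M N).
Proof. exact: bimod_form_bilinear (bimod_form_tpB M N). Qed.

Lemma bimod_form_comp (M N P M' N' Q : bimod) (f : M -> N -> P)
    (k : M' -> M) (l : N' -> N) (h : P -> Q) :
  bimod_form f -> bimod_map k -> bimod_map l -> bimod_map h ->
  bimod_form (fun m n => h (f (k m) (l n))).
Proof.
move=> [[fDl fDr fM] fl fr] [kD kl kr] [lD ll lr] [hD hl hr].
split=> [|b m n|m n b]; first split=> *.
- by rewrite kD fDl hD.
- by rewrite lD fDr hD.
- by rewrite kr ll fM.
- by rewrite kl fl hl.
- by rewrite lr fr hr.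
Qed.

Section TmapB.
Variables (M N M' N' : bimod) (f : M -> M') (g : N -> N').
Hypotheses (fm : bimod_map f) (gm : bimod_map g).

Lemma tmapB_form : bimod_form (fun m n => tpB (f m) (g n) : tensB M' N').
Proof.
exact: (bimod_form_comp (bimod_form_tpB M' N') fm gm (bimod_map_id (tensB M' N'))).
Qed.

Lemma tmapB_map : bimod_map (tmapB f g).
Proof. exact: bimod_form_lift tmapB_form. Qed.

Lemma tmapBE m n : tmapB f g (tpB m n) = tpB (f m) (g n).
Proof. by rewrite /tmapB tliftBE //; case: tmapB_form. Qed.

Lemma tmapBD : {morph tmapB f g : x y / x + y}.
Proof. by case: tmapB_map. Qed.
End TmapB.

Lemma tmapB_compose (M N M' N' M'' N'' : bimod) (f : M -> M') (g : N -> N')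
    (f' : M' -> M'') (g' : N' -> N'') X :
  bimod_map f -> bimod_map g -> bimod_map f' -> bimod_map g' ->
  tmapB f' g' (tmapB f g X) = tmapB (fun x => f' (f x)) (fun y => g' (g y)) X.
Proof.
move=> fm gm fm' gm'.
have cm := bimod_map_comp fm fm'; have dm := bimod_map_comp gm gm'.
apply: (tensB_ext (h := fun X => tmapB f' g' (tmapB f g X))) => [x y|x y|m n].
- by rewrite !(tmapBD fm gm, tmapBD fm' gm').
- exact: (tmapBD cm dm).
- by rewrite (tmapBE fm gm) (tmapBE fm' gm') (tmapBE cm dm).
Qed.

Lemma tmapB_id (M N : bimod) (X : tensB M N) : tmapB id id X = X.
Proof.
have il (P : bimod) := @bimod_map_id P.
apply: (tensB_ext (h := tmapB id id) (h' := id)) => [|//|m n].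
  exact: tmapBD.
by rewrite (tmapBE (il M) (il N)).
Qed.

End BimoduleTensors.

(** * Contraction of tensors with a metric *)

Section Contractions.
Variables (C : numClosedFieldType) (B : algType C) (W : bimod B).
Local Notation WW := (tensB W W).
Variable phi : W -> W -> regular_bimod B.
Hypothesis phi_form : bimod_form phi.

(** For a metric phi with coevaluation u = sum of x_i (x) y_i, the tensor X is
recovered as the sum of contract_r X x_i (x) y_i; contract_mid is that expression
with u replaced by an arbitrary tensor, so that it can be moved through coactions
and through induction on tensors. *)
Definition contract_r (X : WW) (x : W) : W :=
  tliftB (fun w y => ract w (phi y x)) X.

Definition contract_l (w : W) (X : WW) : W :=
  tliftB (fun y x => lact (phi w y) x) X.

Definition contract_mid (X : WW) (c : WW) : WW :=
  tliftB (fun x y => tpB (contract_r X x) y : WW) c.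

Lemma phiDl w w' x : phi (w + w') x = phi w x + phi w' x.
Proof. by case: phi_form => [[-> _ _] _ _]. Qed.
Lemma phiDr w x x' : phi w (x + x') = phi w x + phi w x'.
Proof. by case: phi_form => [[_ -> _] _ _]. Qed.
Lemma phiM w b x : phi (ract w b) x = phi w (lact b x).
Proof. by case: phi_form => [[_ _ ->] _ _]. Qed.
Lemma phi_lact b w x : phi (lact b w) x = b * phi w x.
Proof. by case: phi_form => [_ -> _]. Qed.
Lemma phi_ract w x b : phi w (ract x b) = phi w x * b.
Proof. by case: phi_form => [_ _ ->]. Qed.

Lemma contract_r_bal x : bbalanced (fun w y : W => ract w (phi y x)).
Proof.
by split=> *; rewrite ?ractDl ?phiDl ?ractDr // phi_lact ractA.
Qed.

Lemma contract_l_bal w : bbalanced (fun y x : W => lact (phi w y) x).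
Proof.
by split=> *; rewrite ?lactDr ?phiDr ?lactDl // phi_ract lactA.
Qed.

Lemma contract_rE w y x : contract_r (tpB w y) x = ract w (phi y x).
Proof. exact: tliftBE (contract_r_bal x). Qed.
Lemma contract_lE w y x : contract_l w (tpB y x) = lact (phi w y) x.
Proof. exact: tliftBE (contract_l_bal w). Qed.
Lemma contract_rDl X Y x : contract_r (X + Y) x = contract_r X x + contract_r Y x.
Proof. exact: tliftBD (contract_r_bal x) _ _. Qed.
Lemma contract_lDr w X Y : contract_l w (X + Y) = contract_l w X + contract_l w Y.
Proof. exact: tliftBD (contract_l_bal w) _ _. Qed.

Lemma contract_rDr X x x' : contract_r X (x + x') = contract_r X x + contract_r X x'.
Proof.
move: X; apply: (tensB_ext (h := fun X => contract_r X (x + x'))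
  (h' := fun X => contract_r X x + contract_r X x')) => [X Y|X Y|w y].
- exact: contract_rDl.
- by rewrite !contract_rDl addrACA.
- by rewrite !contract_rE phiDr ractDr.
Qed.

Lemma contract_r_form : bimod_form contract_r.
Proof.
split; first split.
- exact: contract_rDl.
- exact: contract_rDr.
- move=> X b x; move: X.
  apply: (tensB_ext (h := fun X : WW => contract_r (ract X b) x)
    (h' := fun X => contract_r X (lact b x))) => [X Y|X Y|w y].
  + by rewrite ractDl contract_rDl.
  + by rewrite contract_rDl.
  + by rewrite ract_tpB !contract_rE phiM.
- move=> b X x; move: X.
  apply: (tensB_ext (h := fun X : WW => contract_r (lact b X) x)
    (h' := fun X => lact b (contract_r X x))) => [X Y|X Y|w y].
  + by rewrite lactDr contract_rDl.
  + by rewrite contract_rDl lactDr.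
  + by rewrite lact_tpB !contract_rE lractA.
- move=> X x b; move: X.
  apply: (tensB_ext (h := fun X : WW => contract_r X (ract x b))
    (h' := fun X => ract (contract_r X x) b)) => [X Y|X Y|w y].
  + by rewrite contract_rDl.
  + by rewrite contract_rDl ractDl.
  + by rewrite !contract_rE phi_ract ractA.
Qed.

Lemma contract_l_form : bimod_form contract_l.
Proof.
split; first split.
- move=> w w' X; move: X.
  apply: (tensB_ext (h := contract_l (w + w'))
    (h' := fun X => contract_l w X + contract_l w' X)) => [X Y|X Y|y x].
  + exact: contract_lDr.
  + by rewrite !contract_lDr addrACA.
  + by rewrite !contract_lE phiDl lactDl.
- exact: contract_lDr.
- move=> w b X; move: X.
  apply: (tensB_ext (h := contract_l (ract w b))
    (h' := fun X => contract_l w (lact b X))) => [X Y|X Y|y x].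
  + exact: contract_lDr.
  + by rewrite lactDr contract_lDr.
  + by rewrite lact_tpB !contract_lE phiM.
- move=> b w X; move: X.
  apply: (tensB_ext (h := contract_l (lact b w))
    (h' := fun X => lact b (contract_l w X))) => [X Y|X Y|y x].
  + exact: contract_lDr.
  + by rewrite contract_lDr lactDr.
  + by rewrite !contract_lE phi_lact lactA.
- move=> w X b; move: X.
  apply: (tensB_ext (h := fun X : WW => contract_l w (ract X b))
    (h' := fun X => ract (contract_l w X) b)) => [X Y|X Y|y x].
  + by rewrite ractDl contract_lDr.
  + by rewrite contract_lDr ractDl.
  + by rewrite ract_tpB !contract_lE lractA.
Qed.

Lemma contract_mid_bal X : bbalanced (fun x y => tpB (contract_r X x) y : WW).
Proof.
case: contract_r_form => [[_ rD _] _ rr].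
by split=> *; rewrite ?rD ?tpBDl ?tpBDr // rr tpBM.
Qed.

Lemma contract_midE X x y : contract_mid X (tpB x y) = tpB (contract_r X x) y.
Proof. exact: tliftBE (contract_mid_bal X). Qed.

Lemma contract_midDr X c c' :
  contract_mid X (c + c') = contract_mid X c + contract_mid X c'.
Proof. exact: tliftBD (contract_mid_bal X) _ _. Qed.

Lemma contract_mid_bilinear : cbilinear contract_mid.
Proof.
have [rl rr] := bimod_form_bilinear contract_r_form.
have [pl pr] := bilinear_tpB W W.
split=> [c|X]; split.
- move=> X Y /=; move: c; apply: tensB_ext => [c c'|c c'|x y].
  + exact: contract_midDr.
  + by rewrite !contract_midDr addrACA.
  + by rewrite !contract_midE contract_rDl tpBDl.
- move=> k X /=; move: c; apply: tensB_ext => [c c'|c c'|x y].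
  + exact: contract_midDr.
  + by rewrite contract_midDr scalerDr.
  + by rewrite !contract_midE; case: (rl x) => _ /= ->; case: (pl y) => _ /= ->.
- exact: contract_midDr.
- move=> k c; move: c; apply: (tensB_ext (h := fun c => contract_mid X (k *: c))
     (h' := fun c => k *: contract_mid X c)) => [c c'|c c'|x y].
  + by rewrite scalerDr contract_midDr.
  + by rewrite contract_midDr scalerDr.
  + case: (pr x) => _ /= <-; rewrite !contract_midE.
    by case: (pr (contract_r X x)) => _ /= ->.
Qed.

Variable u : WW.
Hypothesis u_l : forall w, contract_l w u = w.
Hypothesis u_r : forall z, contract_r u z = z.

Lemma contract_mid_coev X : contract_mid X u = X.
Proof.
move: X; apply: (tensB_ext (h := fun X => contract_mid X u) (h' := id))
  => [X Y|//|w v].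
  by case: contract_mid_bilinear => h _; case: (h u) => ->.
rewrite -[in RHS](u_l v); move: u; apply: tensB_ext => [c c'|c c'|x y].
- exact: contract_midDr.
- by rewrite contract_lDr tpBDr.
- by rewrite contract_midE contract_rE contract_lE tpBM.
Qed.

(** X is recovered from its contractions by contract_mid_coev. *)
Lemma contract_r_inj X Y :
  (forall x, contract_r X x = contract_r Y x) -> X = Y.
Proof.
move=> XY; rewrite -(contract_mid_coev X) -(contract_mid_coev Y).
by congr (tliftB _ u); apply/funext => x; apply/funext => y; rewrite XY.
Qed.

(** The sum of f(x_i) (x) y_i, the tensor whose contractions are the values of f
when f is right linear. *)
Definition representing (f : W -> W) : WW := tliftB (fun x y => tpB (f x) y : WW) u.

Lemma contract_representing (f : W -> W) z :
  {morph f : x y / x + y} -> (forall x b, f (ract x b) = ract (f x) b) ->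
  contract_r (representing f) z = f z.
Proof.
move=> fD fr; rewrite -[in RHS](u_r z) /representing.
have bal : bbalanced (fun x y => tpB (f x) y : WW).
  by split=> *; rewrite ?fD ?tpBDl ?tpBDr // fr tpBM.
move: u; apply: (tensB_ext (h := fun c => contract_r (tliftB _ c) z)
  (h' := fun c => f (contract_r c z))) => [c c'|c c'|x y].
- by rewrite (tliftBD bal) contract_rDl.
- by rewrite contract_rDl fD.
- by rewrite (tliftBE _ _ bal) !contract_rE fr.
Qed.

End Contractions.

(** * Connections compatible with a pairing of two types of forms *)

Section Splitting.
Variables (C : numClosedFieldType) (B : algType C) (sB : starOp B) (W : bimod B).
Local Notation WW := (tensB W W).
Variables (star : W -> W).

Record bimod_star : Prop := BimodStar {
  bstarD : {morph star : w v / w + v};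
  bstar_l : forall b w, star (lact b w) = ract (star w) (sB b);
  bstar_r : forall w b, star (ract w b) = lact (sB b) (star w);
  bstarK : involutive star
}.
Hypothesis starP : bimod_star.

Definition flip_star (X : WW) : WW :=
  tliftB (fun w v => tpB (star v) (star w) : WW) X.

Lemma flip_star_bal : bbalanced (fun w v => tpB (star v) (star w) : WW).
Proof.
case: starP => sD sl sr _.
by split=> *; rewrite ?sD ?tpBDl ?tpBDr // sr sl tpBM.
Qed.

Lemma flip_starE w v : flip_star (tpB w v) = tpB (star v) (star w).
Proof. exact: tliftBE flip_star_bal. Qed.
Lemma flip_starD X Y : flip_star (X + Y) = flip_star X + flip_star Y.
Proof. exact: tliftBD flip_star_bal _ _. Qed.

Lemma flip_star_l b X : flip_star (lact b X) = ract (flip_star X) (sB b).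
Proof.
move: X; apply: (tensB_ext (h := fun X : WW => flip_star (lact b X))
  (h' := fun X => ract (flip_star X) (sB b))) => [X Y|X Y|w v].
- by rewrite lactDr flip_starD.
- by rewrite flip_starD ractDl.
- by rewrite lact_tpB !flip_starE ract_tpB (bstar_l starP).
Qed.

Lemma flip_star_r X b : flip_star (ract X b) = lact (sB b) (flip_star X).
Proof.
move: X; apply: (tensB_ext (h := fun X : WW => flip_star (ract X b))
  (h' := fun X => lact (sB b) (flip_star X))) => [X Y|X Y|w v].
- by rewrite ractDl flip_starD.
- by rewrite flip_starD lactDr.
- by rewrite ract_tpB !flip_starE lact_tpB (bstar_r starP).
Qed.

Variables (p q : W -> W) (d : B -> W).
Hypotheses (pm : bimod_map p) (qm : bimod_map q).
Hypothesis pq1 : forall w, p w + q w = w.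
Hypothesis star_p : forall w, star (p w) = q (star w).
Hypothesis dstar : forall b, d (sB b) = star (d b).

Variable phi : W -> W -> regular_bimod B.
Hypothesis phi_form : bimod_form phi.
Hypothesis phi_pq : forall w x, phi (p w) x = phi w (q x).
Variable u : WW.
Hypothesis u_l : forall w, contract_l phi w u = w.
Hypothesis u_r : forall z, contract_r phi u z = z.

Variables nabla D : W -> WW.
Hypothesis nablaD : {morph nabla : x y / x + y}.
Hypothesis nabla_p : forall w, tmapB id p (nabla w) = nabla (p w).
Hypothesis nabla_phi : forall w x,
  d (phi w x) =
  contract_r phi (nabla w) x + contract_l phi w (flip_star (nabla (star x))).
Hypothesis D_nabla : forall w,
  D w = tmapB q id (nabla (p w)) + tmapB p id (nabla (q w)).

Let pD : {morph p : x y / x + y}. Proof. by case: pm. Qed.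
Let qD : {morph q : x y / x + y}. Proof. by case: qm. Qed.
Let idm := @bimod_map_id C B W.
Let rform := contract_r_form phi_form.
Let lform := contract_l_form phi_form.

(** The half of nabla in which the two tensor factors have the same type. *)
Definition residual (w : W) : WW :=
  tmapB p id (nabla (p w)) + tmapB q id (nabla (q w)).

Lemma nabla_split w : nabla w = D w + residual w.
Proof.
rewrite D_nabla /residual addrACA.
have E (X : WW) : tmapB q id X + tmapB p id X = X.
  apply: (tensB_ext (h := fun X => tmapB q id X + tmapB p id X) (h' := id))
      => [x y|//|x y].
    by rewrite (tmapBD qm idm) (tmapBD pm idm) addrACA.
  by rewrite (tmapBE qm idm) (tmapBE pm idm) -tpBDl addrC pq1.
rewrite E [_ (nabla (q w)) + _]addrC E.
by rewrite -nablaD pq1.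
Qed.

Lemma star_q w : star (q w) = p (star w).
Proof. by rewrite -{1}[w](bstarK starP) -star_p (bstarK starP). Qed.

Lemma phi_qp w x : phi (q w) x = phi w (p x).
Proof.
by apply: (@addrI _ (phi (p w) x)); rewrite -(phiDl phi_form) pq1 phi_pq
  -(phiDr phi_form) addrC pq1.
Qed.

Lemma nabla_q w : tmapB id q (nabla w) = nabla (q w).
Proof.
apply: (@addrI _ (nabla (p w))); rewrite -nablaD pq1 -nabla_p.
apply: (tensB_ext (h := fun X => tmapB id p X + tmapB id q X) (h' := id))
    => [x y|//|x y].
  by rewrite (tmapBD idm qm) (tmapBD idm pm) addrACA.
by rewrite (tmapBE idm qm) (tmapBE idm pm) -tpBDr pq1.
Qed.

Lemma contract_r_map f X x : bimod_map f ->
  contract_r phi (tmapB f id X) x = f (contract_r phi X x).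
Proof.
move=> fm; have [fD _ fr] := fm; move: X.
apply: (tensB_ext (h := fun X => contract_r phi (tmapB f id X) x)
  (h' := fun X => f (contract_r phi X x))) => [X Y|X Y|w y].
- by rewrite (tmapBD fm idm) (contract_rDl phi_form).
- by rewrite (contract_rDl phi_form) fD.
- by rewrite (tmapBE fm idm) !(contract_rE phi_form) fr.
Qed.

Lemma contract_l_flip f f' w X :
  bimod_map f -> bimod_map f' -> (forall y, star (f y) = f' (star y)) ->
  contract_l phi w (flip_star (tmapB f id X)) =
  f' (contract_l phi w (flip_star X)).
Proof.
move=> fm fm' ff'; have [fD' fl' _] := fm'; move: X.
apply: (tensB_ext (h := fun X => contract_l phi w (flip_star (tmapB f id X)))
  (h' := fun X => f' (contract_l phi w (flip_star X)))) => [X Y|X Y|x y].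
- by rewrite (tmapBD fm idm) flip_starD (contract_lDr phi_form).
- by rewrite flip_starD (contract_lDr phi_form) fD'.
- by rewrite (tmapBE fm idm) !flip_starE !(contract_lE phi_form) ff' fl'.
Qed.

Lemma contract_l_block f f' w X :
  bimod_map f -> bimod_map f' -> (forall y, star (f y) = f' (star y)) ->
  (forall y, phi (f w) y = phi w (f' y)) ->
  contract_l phi (f w) (flip_star X) =
  contract_l phi w (flip_star (tmapB id f X)).
Proof.
move=> fm fm' ff' phif; move: X.
apply: (tensB_ext (h := fun X => contract_l phi (f w) (flip_star X))
  (h' := fun X => contract_l phi w (flip_star (tmapB id f X)))) => [X Y|X Y|x y].
- by rewrite flip_starD (contract_lDr phi_form).
- by rewrite (tmapBD idm fm) flip_starD (contract_lDr phi_form).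
- by rewrite (tmapBE idm fm) !flip_starE !(contract_lE phi_form) phif ff'.
Qed.

(** Compatibility is used at (p w, x) and projected by p, and at (q w, x) and
projected by q.  In the second term of the compatibility the types of w and of
the projection then select from nabla x^* precisely the components in D. *)
Lemma contract_residual w x :
  contract_r phi (residual w) x =
  p (d (phi (p w) x)) + q (d (phi (q w) x))
  - contract_l phi w (flip_star (D (star x))).
Proof.
rewrite !nabla_phi pD qD D_nabla flip_starD (contract_lDr phi_form).
rewrite /residual (contract_rDl phi_form) !contract_r_map //.
rewrite (contract_l_block _ pm qm star_p (phi_pq w)).
rewrite (contract_l_block _ qm pm star_q (phi_qp w)).
rewrite nabla_p nabla_q.
rewrite (contract_l_flip _ _ qm pm star_q) (contract_l_flip _ _ pm qm star_p).
by rewrite [X in _ = X - _]addrACA addrK.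
Qed.

Variable s : WW -> WW.
Hypothesis sm : bimod_map s.
Hypothesis Dr : forall w b, D (ract w b) = ract (D w) b + s (tpB w (d b)).

Let sD : {morph s : x y / x + y}. Proof. by case: sm. Qed.

(** The map s conjugated by the star.  It appears because residual is controlled
through D applied to x^*. *)
Definition conj_braid (xi x : W) : WW := flip_star (s (tpB (star x) (star xi))).

(** The generalized braiding of the residual half: the transpose, for phi, of the
conjugate of s. *)
Definition residual_braid (w xi : W) : WW :=
  representing u (fun x => contract_l phi w (conj_braid xi x)).

Lemma contract_residual_braid w xi z :
  contract_r phi (residual_braid w xi) z = contract_l phi w (conj_braid xi z).
Proof.
case: sm => _ sl sr.
apply: (contract_representing phi_form u_r) => [x y|x b]; rewrite /conj_braid.
  rewrite (bstarD starP) tpBDl sD flip_starD.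
  exact: contract_lDr.
rewrite (bstar_r starP) -lact_tpB sl flip_star_l starK.
by case: lform => _ _ ->.
Qed.

Lemma residual_braid_form : bimod_form residual_braid.
Proof.
case: sm => _ sl sr; case: rform => [[rDl rDr rM] rl rr].
case: lform => [[lDl lDr lM] ll lr].
have inj := contract_r_inj phi_form u_l.
split; first split.
- move=> w w' xi; apply: inj => z.
  by rewrite rDl !contract_residual_braid lDl.
- move=> w xi xi'; apply: inj => z.
  rewrite rDl !contract_residual_braid /conj_braid (bstarD starP) tpBDr sD.
  by rewrite flip_starD lDr.
- move=> w b xi; apply: inj => z.
  rewrite !contract_residual_braid /conj_braid (bstar_l starP) -ract_tpB sr.
  by rewrite flip_star_r starK lM.
- move=> b w xi; apply: inj => z.
  by rewrite rl !contract_residual_braid ll.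
- move=> w xi b; apply: inj => z.
  rewrite rM !contract_residual_braid /conj_braid (bstar_l starP).
  by rewrite (bstar_r starP) tpBM.
Qed.

(** Both sides contract to the same thing: by contract_residual only the last term
D((b x)^* ) = D(x^* b^* ) fails to be balanced, by s(x^* (x) d b^* ). *)
Lemma residual_ract w b :
  residual (ract w b) = ract (residual w) b + residual_braid w (d b).
Proof.
case: rform => [[rDl rDr rM] rl rr].
case: lform => [[lDl lDr lM] ll lr].
have [_ _ pr] := pm; have [_ _ qr] := qm.
apply: (contract_r_inj phi_form u_l) => x.
rewrite contract_residual [RHS]rDl rM contract_residual_braid contract_residual.
rewrite pr qr !(phiM phi_form) -[RHS]addrA; congr (_ + _).
rewrite (bstar_l starP) Dr /conj_braid dstar flip_starD flip_star_r starK.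
by rewrite lDr lM opprD subrK.
Qed.

Theorem nabla_braided : exists sigma : WW -> WW, bimod_map sigma /\
  forall w b, nabla (ract w b) = ract (nabla w) b + sigma (tpB w (d b)).
Proof.
have bf := residual_braid_form; have bm := bimod_form_lift bf.
exists (fun X => s X + tliftB residual_braid X); split.
  exact: bimod_map_add.
move=> w b; have [bal _ _] := bf; rewrite (tliftBE _ _ bal) !nabla_split.
by rewrite Dr residual_ract ractDl addrACA.
Qed.

End Splitting.

(** * Colinear functions of two variables *)

Section Bicolinear.
Variables (C : numClosedFieldType) (A : hopfAlg C).

Definition bicolinear (M N L : lmodType C) (dM : M -> (A ⊗ M)%type)
    (dN : N -> (A ⊗ N)%type) (dL : L -> (A ⊗ L)%type) (b : M -> N -> L) : Prop :=
  forall m n, dL (b m n) = tmul *%R b (dM m) (dN n).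

Let hm := bilinear_mul A.

Lemma bicolinear_comp (M N L M' N' L' : lmodType C)
    (dM : M -> (A ⊗ M)%type) (dN : N -> (A ⊗ N)%type) (dL : L -> (A ⊗ L)%type)
    (dM' : M' -> (A ⊗ M')%type) (dN' : N' -> (A ⊗ N')%type)
    (dL' : L' -> (A ⊗ L')%type) (b : M -> N -> L)
    (f : M' -> M) (g : N' -> N) (h : L -> L') :
  cbilinear b -> clinear f -> clinear g -> clinear h ->
  bicolinear dM dN dL b -> colinear dM' dM f -> colinear dN' dN g ->
  colinear dL dL' h ->
  bicolinear dM' dN' dL' (fun m n => h (b (f m) (g n))).
Proof.
move=> bb fl gl hl bc fc gc hc m n.
by rewrite hc bc fc gc (tmul_tmap _ _ hm bb fl gl hl).
Qed.

Lemma tmul_add (M N L : lmodType C) (b b' : M -> N -> L) X Y :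
  cbilinear b -> cbilinear b' ->
  tmul *%R (fun m n => b m n + b' m n) X Y =
  tmul *%R b X Y + tmul *%R b' X Y :> (A ⊗ L)%type.
Proof.
move=> bb bb'; have bs := bilinear_add bb bb'; move: X Y.
apply: (tensC_ext2 (h := fun X Y => tmul *%R (fun m n => b m n + b' m n) X Y)
  (h' := fun X Y => tmul *%R b X Y + tmul *%R b' X Y))
  => [Y x y|X x y|Y x y|X x y|m n m' n'].
- exact: (tmulDl hm bs).
- exact: (tmulDr hm bs).
- by rewrite (tmulDl hm bb) (tmulDl hm bb') addrACA.
- by rewrite (tmulDr hm bb) (tmulDr hm bb') addrACA.
- by rewrite (tmul_pure hm bs) (tmul_pure hm bb) (tmul_pure hm bb') tpureCDr.
Qed.

Lemma bicolinear_add (M N L : lmodType C) (dM : M -> (A ⊗ M)%type)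
    (dN : N -> (A ⊗ N)%type) (dL : L -> (A ⊗ L)%type) (b b' : M -> N -> L) :
  cbilinear b -> cbilinear b' -> {morph dL : x y / x + y} ->
  bicolinear dM dN dL b -> bicolinear dM dN dL b' ->
  bicolinear dM dN dL (fun m n => b m n + b' m n).
Proof. by move=> bb bb' dD bc bc' m n; rewrite dD bc bc' tmul_add. Qed.

Lemma colinear_comp (M N P : lmodType C) (dM : M -> (A ⊗ M)%type)
    (dN : N -> (A ⊗ N)%type) (dP : P -> (A ⊗ P)%type) (f : M -> N) (g : N -> P) :
  clinear f -> clinear g -> colinear dM dN f -> colinear dN dP g ->
  colinear dM dP (fun x => g (f x)).
Proof.
by move=> fl gl fc gc m; rewrite gc fc (tmap_compose _ _ fl _ gl).
Qed.

Lemma colinear_add (M N : lmodType C) (dM : M -> (A ⊗ M)%type)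
    (dN : N -> (A ⊗ N)%type) (f g : M -> N) :
  clinear f -> clinear g -> {morph dN : x y / x + y} ->
  colinear dM dN f -> colinear dM dN g -> colinear dM dN (fun x => f x + g x).
Proof. by move=> fl gl dD fc gc m; rewrite dD fc gc -tmap_sum2. Qed.

Lemma colinear_opp (M N : lmodType C) (dM : M -> (A ⊗ M)%type)
    (dN : N -> (A ⊗ N)%type) (f : M -> N) :
  clinear f -> {morph dN : x y / x + y} ->
  colinear dM dN f -> colinear dM dN (fun x => - f x).
Proof. by move=> fl dD fc m; rewrite (morphN dD) fc tmap_opp. Qed.

Lemma leg_mul_pure (N : lmodType C) (a b : A) (n : N) :
  tmap (fun x => a * x) id (b ⊗ n) = (a * b) ⊗ n.
Proof. by case: hm => _ h; rewrite (tmap_pure (h a) (@clinear_id C N)). Qed.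

Lemma leg_mul_bilinear (M N : lmodType C) (k : M -> A) : clinear k ->
  cbilinear (fun a (Y : (A ⊗ N)%type) => tmap (fun x => k a * x) id Y).
Proof.
move=> [kD kZ]; have il := @clinear_id C N.
have hl a : clinear (fun x : A => k a * x) by case: hm => _ h; exact: h.
split=> [Y|a]; last exact: (tmap_twisted (hl a) il).
split=> [a a'|c a]; move: Y; apply: tensC_ext => [x y|x y|b n].
- exact: (tmap_additive (hl _) il).
- by rewrite !(tmap_additive (hl _) il) addrACA.
- by rewrite !leg_mul_pure kD mulrDl tpureCDl.
- exact: (tmap_additive (hl _) il).
- by rewrite (tmap_additive (hl _) il) scalerDr.
- by rewrite !leg_mul_pure kZ -scalerAl tpureCZl.
Qed.

(** S(m_(-1)) b(m_(0), n)_(-1) (x) b(m_(0), n)_(0) = n_(-1) (x) b(m, n_(0)): a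
colinear function of two variables determines the coaction of the second one,
since S(m_(-2)) m_(-1) collapses to the counit. *)
Lemma antipode_cancel (M N L : lmodType C) (dM : M -> (A ⊗ M)%type)
    (dN : N -> (A ⊗ N)%type) (dL : L -> (A ⊗ L)%type) (b : M -> N -> L) m n :
  is_coaction dM -> cbilinear b -> bicolinear dM dN dL b ->
  tliftC (fun a m0 => tmap (fun x => antipode a * x) id (dL (b m0 n))) (dM m) =
  tmap id (b m) (dN n).
Proof.
move=> [dl dassoc dcounit] bb bc.
have dcl := clinear_linear dl; have il := @clinear_id C A.
have mb := tmul_bilinear hm bb.
have Sl : clinear (antipode : A -> A).
  by apply: clinear_linear => a x y; exact: linearP.
have Sb := leg_mul_bilinear L Sl.
(* a (x) Y is sent to S(a) Y_(-1) n_(-1) (x) b(Y_(0), n_(0)); it is applied to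
   m_(-2) (x) m_(-1) (x) m_(0) *)
pose G : (A ⊗ (A ⊗ M))%type -> (A ⊗ L)%type :=
  tliftC (fun a Y => tmap (fun x => antipode a * x) id (tmul *%R b Y (dN n))).
have Gb : cbilinear (fun a (Y : (A ⊗ M)%type) =>
    tmap (fun x => antipode a * x) id (tmul *%R b Y (dN n))).
  case: Sb => S1 S2; split=> [Y|a]; first exact: S1.
  by case: mb => ml _; exact: (clinear_comp (ml _) (S2 a)).
have [GD GZ] : clinear G := tlift_clinear Gb.
have GE a Y : G (a ⊗ Y) =
    tmap (fun x => antipode a * x) id (tmul *%R b Y (dN n)).
  by rewrite /G tliftCE //; exact: bilinear_balanced.
have dLb : cbilinear (fun a m0 => tmap (fun x => antipode a * x) id (dL (b m0 n))).
  have -> : (fun a m0 => tmap (fun x => antipode a * x) id (dL (b m0 n))) =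
    (fun a m0 => tmap (fun x => antipode a * x) id (tmul *%R b (dM m0) (dN n))).
    by apply/funext => a; apply/funext => m0; rewrite bc.
  case: Gb => Gl Gr; split=> [m0|a]; first exact: Gl.
  exact: (clinear_comp dcl (Gr a)).
(* the left-hand side, with the coaction of m_(0) made explicit *)
have step1 X : tliftC (fun a m0 => tmap (fun x => antipode a * x) id (dL (b m0 n))) X
    = G (tmap id dM X).
  move: X; apply: tensC_ext => [x y|x y|a m0].
  - by case: (tlift_clinear dLb).
  - by rewrite (tmap_additive il dcl) GD.
  - rewrite (tmap_pure il dcl) GE tliftCE ?bc //; exact: bilinear_balanced.
rewrite step1 -dassoc.
have eb : cbilinear (fun (a : A) (m0 : M) => (counit a : C) *: m0).
  split=> [m0|a]; split=> [x y|c x].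
  - by rewrite raddfD scalerDl.
  - by rewrite linearZ /= -scalerA.
  - exact: scalerDr.
  - by rewrite !scalerA mulrC.
have bl y : clinear (b y) by case: bb => _ h; exact: h.
have bm' : clinear (fun y => tmap id (b y) (dN n)).
  split=> [y y'|c y]; move: (dN n); apply: tensC_ext => [z t|z t|a k].
  - exact: (tmap_additive il (bl _)).
  - by rewrite !(tmap_additive il (bl _)) addrACA.
  - rewrite !(tmap_pure il (bl _)); case: bb => h _; case: (h k) => -> _.
    by rewrite tpureCDr.
  - exact: (tmap_additive il (bl _)).
  - by rewrite (tmap_additive il (bl _)) scalerDr.
  - rewrite !(tmap_pure il (bl _)); case: bb => h _; case: (h k) => _ ->.
    by rewrite tpureCZr.
have cml : clinear (comul : A -> (A ⊗ A)%type).
  by apply: clinear_linear => a x y; exact: linearP.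
have asb (m0 : M) : cbilinear (fun x y : A => x ⊗ (y ⊗ m0)).
  have [p1 p2] := bilinear_pure A (A ⊗ M)%type; have [p3 p4] := bilinear_pure A M.
  by split=> [y|x]; [exact: (p1 (y ⊗ m0))|exact: (clinear_comp (p3 m0) (p2 x))].
have asb' : cbilinear (fun (x : (A ⊗ A)%type) (p : M) =>
    tliftC (fun m n => m ⊗ (n ⊗ p)) x).
  split=> [p0|x]; first exact: tlift_clinear (asb p0).
  split=> [y z|c y]; move: x; apply: tensC_ext => [z1 z2|z1 z2|a k].
  - by case: (tlift_clinear (asb (y + z))).
  - by case: (tlift_clinear (asb y)) => -> _; case: (tlift_clinear (asb z)) => -> _;
      rewrite addrACA.
  - by rewrite !tliftCE ?tpureCDr //; apply: bilinear_balanced; exact: asb.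
  - by case: (tlift_clinear (asb (c *: y))).
  - by case: (tlift_clinear (asb y)) => -> _; rewrite scalerDr.
  - by rewrite !tliftCE ?tpureCZr //; apply: bilinear_balanced; exact: asb.
(* coassociativity has brought the two legs of the coproduct together *)
have step2 X : G (tassoc (tmap comul id X)) =
    tmap id (b (tliftC (fun a m0 => (counit a : C) *: m0) X)) (dN n).
  have [eD _] := tlift_clinear eb; have [aD _] := tlift_clinear asb'.
  have iM := @clinear_id C M.
  move: X; apply: tensC_ext => [x y|x y|a m0].
  - by rewrite (tmap_additive cml iM) /tassoc aD GD.
  - by rewrite eD; case: bm' => ->.
  rewrite (tmap_pure cml iM) /tassoc tliftCE; last exact: bilinear_balanced.
  rewrite tliftCE; last exact: bilinear_balanced.
  case: bm' => _ ->.
  have aeq (Z : (A ⊗ A)%type) : G (tliftC (fun x y => x ⊗ (y ⊗ m0)) Z) =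
      tmap (fun x => tliftC (fun a1 a2 => antipode a1 * a2) Z * x) id
           (tmap id (b m0) (dN n)).
    have am : cbilinear (fun a1 a2 : A => antipode a1 * a2).
      split=> [y|x]; split=> [z t|c z].
      + by rewrite linearD mulrDl.
      + by rewrite linearZ /= -scalerAl.
      + exact: mulrDr.
      + by rewrite -scalerAr.
    have [tD _] := tlift_clinear (asb m0); have [aD' _] := tlift_clinear am.
    have [kl _] := leg_mul_bilinear L (@clinear_id C A).
    move: Z; apply: tensC_ext => [z t|z t|x y].
    - by rewrite tD GD.
    - by rewrite aD'; case: (kl (tmap id (b m0) (dN n))) => ->.
    rewrite !tliftCE ?GE; try exact: bilinear_balanced.
    move: (dN n); apply: tensC_ext => [z t|z t|c k].
    - by rewrite (tmulDr hm bb); case: Sb => _ h; case: (h x) => ->.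
    - rewrite (tmap_additive il (bl m0)).
      by case: hm => _ h; rewrite (tmap_additive (h _) (@clinear_id C L)).
    - by rewrite (tmul_pure hm bb) (tmap_pure il (bl m0)) !leg_mul_pure mulrA.
  rewrite aeq antipode_l.
  move: (dN n); apply: tensC_ext => [z t|z t|c k].
  - rewrite (tmap_additive il (bl m0)).
    by case: hm => _ h; rewrite (tmap_additive (h _) (@clinear_id C L)).
  - by rewrite (tmap_additive il (bl m0)) scalerDr.
  - by rewrite (tmap_pure il (bl m0)) leg_mul_pure -scalerAl mul1r tpureCZl.
by rewrite step2 dcounit.
Qed.

End Bicolinear.

(** * Covariance of compatible connections *)

Section CovariantBimodule.
Variables (C : numClosedFieldType) (A : hopfStarAlg C) (H : hopfAlg C).
Variables (pi : hopfMap A H) (D0 : baseStar pi).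
Local Notation B := (coinv pi).
Local Notation dB := (base_coact D0).
Local Notation sB := (base_star D0).
Variables (W : bimod B) (dW : W -> (A ⊗ W)%type).
Hypothesis dW_cov : covariant_bimod D0 dW.
Local Notation WW := (tensB W W).
Local Notation dWW := (tens_coact dW dW).

Let hm := bilinear_mul A.
Let il := @clinear_id C.

Lemma coact_clinear : clinear dW.
Proof. by case: dW_cov => [[dl _ _] _]; exact: clinear_linear. Qed.

Let dD : {morph dW : x y / x + y}. Proof. by case: coact_clinear. Qed.

Lemma tmul_lact1 (M : bimod B) (X : (A ⊗ M)%type) :
  tmul *%R lact (1 ⊗ (1 : B)) X = X.
Proof.
have lb := bilinear_lact M.
move: X; apply: (tensC_ext (h' := id)) => [|//|a m]; first exact: (tmulDr hm lb).
by rewrite (tmul_pure hm lb) mul1r lact1.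
Qed.

Lemma tmul_ract1 (M : bimod B) (X : (A ⊗ M)%type) :
  tmul *%R ract X (1 ⊗ (1 : B)) = X.
Proof.
have rb := bilinear_ract M.
move: X; apply: (tensC_ext (h := fun X => tmul *%R ract X _) (h' := id))
  => [|//|a m]; first exact: (tmulDl hm rb).
by rewrite (tmul_pure hm rb) mulr1 ract1.
Qed.

Lemma lact_bicolinear : bicolinear dB dW dW lact.
Proof.
move=> b m; case: dW_cov => _ h; have := h b m 1.
by rewrite ract1 /coact_lr base_coact1 tmul_ract1.
Qed.

Lemma ract_bicolinear : bicolinear dW dB dW ract.
Proof.
move=> m b; case: dW_cov => _ h; have := h 1 m b.
by rewrite lact1 /coact_lr base_coact1 tmul_lact1.
Qed.

Let lb := bilinear_lact W.
Let rb := bilinear_ract W.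
Let tb := bilinear_tpB W W.

(** Balancedness over B is the compatibility of dW with the two actions; it makes
the diagonal coaction well defined. *)
Lemma tens_coact_bal : bbalanced (fun m n : W => tmul *%R (tpB : W -> W -> WW) (dW m) (dW n)).
Proof.
split=> [m m' n|m n n'|m b n].
- by rewrite dD (tmulDl hm tb).
- by rewrite dD (tmulDr hm tb).
- rewrite ract_bicolinear lact_bicolinear.
  by apply: tmul_assoc => // x y z; exact: tpBM.
Qed.

Lemma tens_coactD : {morph dWW : x y / x + y}.
Proof. exact: tliftBD tens_coact_bal. Qed.

Lemma tpB_bicolinear : bicolinear dW dW dWW tpB.
Proof. by move=> m n; rewrite /tens_coact (tliftBE _ _ tens_coact_bal). Qed.

Lemma colinear_tmapB (f g : W -> W) : bimod_map f -> bimod_map g ->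
  colinear dW dW f -> colinear dW dW g -> colinear dWW dWW (tmapB f g).
Proof.
move=> fm gm fc gc X; have fgm := tmapB_map fm gm.
have fgl := bimod_map_clinear fgm.
have fl := bimod_map_clinear fm; have gl := bimod_map_clinear gm.
move: X; apply: (tensB_ext (h := fun X => dWW (tmapB f g X))
  (h' := fun X => tmap id (tmapB f g) (dWW X))) => [X Y|X Y|x y].
- by rewrite (tmapBD fm gm) tens_coactD.
- by rewrite tens_coactD (tmap_additive (@il A) fgl).
- rewrite (tmapBE fm gm) !tpB_bicolinear fc gc.
  rewrite -[X in tmul _ _ X _ = _]tmap_id.
  have := tmul_tmap (dW x) (dW y) hm tb (@il W) (@il W) fgl.
  rewrite !tmap_id => ->.
  have := tmul_tmap (dW x) (dW y) hm tb fl gl (@il WW).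
  rewrite !tmap_id => ->.
  by congr (tmul _ _ _ _); apply/funext => m; apply/funext => n; rewrite (tmapBE fm gm).
Qed.

Section Contract.
Variable phi : W -> W -> regular_bimod B.
Hypothesis phi_form : bimod_form phi.
Hypothesis phi_bicol : bicolinear dW dW dB phi.

Let pb := bimod_form_bilinear phi_form.
Let crb := bimod_form_bilinear (contract_r_form phi_form).
Let clb := bimod_form_bilinear (contract_l_form phi_form).

Lemma contract_r_bicolinear : bicolinear dWW dW dW (contract_r phi).
Proof.
move=> X x; move: X; apply: (tensB_ext (h := fun X => dW (contract_r phi X x))
  (h' := fun X => tmul *%R (contract_r phi) (dWW X) (dW x))) => [X Y|X Y|w y].
- by rewrite (contract_rDl phi_form) dD.
- by rewrite tens_coactD (tmulDl hm crb).
- rewrite (contract_rE phi_form) ract_bicolinear phi_bicol tpB_bicolinear.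
  apply/esym; apply: tmul_assoc => // m n l; exact: contract_rE.
Qed.

Lemma contract_l_bicolinear : bicolinear dW dWW dW (contract_l phi).
Proof.
move=> w; apply: (tensB_ext (h := fun X => dW (contract_l phi w X))
  (h' := fun X => tmul *%R (contract_l phi) (dW w) (dWW X))) => [X Y|X Y|y x].
- by rewrite (contract_lDr phi_form) dD.
- by rewrite tens_coactD (tmulDr hm clb).
- rewrite (contract_lE phi_form) lact_bicolinear phi_bicol tpB_bicolinear.
  apply: tmul_assoc => // m n l; apply/esym; exact: contract_lE.
Qed.

Variable u : WW.
Hypothesis u_l : forall w, contract_l phi w u = w.
Hypothesis u_coinv : dWW u = 1 ⊗ u.

(** The leg x_(-1) is cancelled by tensoring with a second vector y and then
replacing x (x) y by the coinvariant u, which contributes the leg 1 and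
reconstructs the tensor. *)
Lemma contract_r_coact_inj (Z Z' : (A ⊗ WW)%type) :
  (forall x, tmul *%R (contract_r phi) Z (dW x) =
             tmul *%R (contract_r phi) Z' (dW x)) -> Z = Z'.
Proof.
move=> ZZ'; have cmb := contract_mid_bilinear phi_form.
have E c : tmul *%R (contract_mid phi) Z (dWW c) =
           tmul *%R (contract_mid phi) Z' (dWW c).
  move: c; apply: tensB_ext => [c c'|c c'|x y].
  - by rewrite tens_coactD (tmulDr hm cmb).
  - by rewrite tens_coactD (tmulDr hm cmb).
  rewrite tpB_bicolinear.
  have F Y : tmul *%R (contract_mid phi) Y (tmul *%R tpB (dW x) (dW y)) =
      tmul *%R (tpB : W -> W -> WW) (tmul *%R (contract_r phi) Y (dW x)) (dW y).
    apply/esym; apply: tmul_assoc => // m n l; apply/esym.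
    exact: contract_midE.
  by rewrite !F ZZ'.
have G (Y : (A ⊗ WW)%type) : tmul *%R (contract_mid phi) Y (1 ⊗ u) = Y.
  move: Y; apply: (tensC_ext (h := fun Y => tmul *%R (contract_mid phi) Y (1 ⊗ u))
    (h' := id)) => [|//|a X]; first by move=> y y'; rewrite (tmulDl hm cmb).
  by rewrite (tmul_pure hm cmb) mulr1 (contract_mid_coev phi_form).
by rewrite -(G Z) -(G Z') -u_coinv E.
Qed.
End Contract.

Variable star : W -> W.
Hypothesis starP : bimod_star sB star.
Hypothesis star_col : forall w, dW (star w) = tmap hstar star (dW w).

Lemma star_twisted : twisted_linear (fun c : C => c^* ) star.
Proof.
split; first exact: (bstarD starP).
by move=> c x; rewrite -lactC (bstar_l starP) star_alg ractC.
Qed.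

Lemma hstar_twisted : twisted_linear (fun c : C => c^* ) (hstar : A -> A).
Proof. by split; [exact: starD|exact: starZ]. Qed.

Lemma flip_star_twisted : twisted_linear (fun c : C => c^* ) (flip_star star).
Proof.
split; first exact: (flip_starD starP).
by move=> c x; rewrite -lactC (flip_star_l starP) star_alg ractC.
Qed.

Lemma flip_star_coact X :
  dWW (flip_star star X) = tmap hstar (flip_star star) (dWW X).
Proof.
have fD := flip_starD starP; have st := star_twisted.
have ht := hstar_twisted; have ft := flip_star_twisted.
move: X; apply: (tensB_ext (h := fun X => dWW (flip_star star X))
  (h' := fun X => tmap hstar (flip_star star) (dWW X))) => [X Y|X Y|w v].
- by rewrite fD tens_coactD.
- by rewrite tens_coactD (tmap_additive ht ft).
- rewrite (flip_starE starP) !tpB_bicolinear !star_col.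
  move: (dW w) (dW v).
  apply: (tensC_ext2 (h := fun X Y => tmul *%R (tpB : W -> W -> WW)
      (tmap hstar star Y) (tmap hstar star X))
    (h' := fun X Y => tmap hstar (flip_star star) (tmul *%R tpB X Y)))
    => [Y X X'|X Y Y'|Y X X'|X Y Y'|a x b y].
  + by rewrite (tmap_additive ht st) (tmulDr hm tb).
  + by rewrite (tmap_additive ht st) (tmulDl hm tb).
  + by rewrite (tmulDl hm tb) (tmap_additive ht ft).
  + by rewrite (tmulDr hm tb) (tmap_additive ht ft).
  + rewrite !(tmap_pure ht st) !(tmul_pure hm tb) (tmap_pure ht ft).
    by rewrite (flip_starE starP) starM.
Qed.

(** Conjugating by the star is an antilinear operation applied twice, so the two
stars on the A-leg cancel. *)
Lemma flip_star_conj_colinear (D : W -> WW) : clinear D -> colinear dW dWW D ->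
  colinear dW dWW (fun x => flip_star star (D (star x))).
Proof.
move=> Dl Dc x; have st := star_twisted; have ht := hstar_twisted.
have ft := flip_star_twisted.
rewrite flip_star_coact Dc star_col (tmap_compose _ ht st (@il A) Dl).
have ct := twisted_comp st Dl; have aht := twisted_comp ht (@il A).
rewrite (tmap_compose _ aht ct ht ft).
congr (tmap _ _ _); apply/funext => a; exact: starK.
Qed.

Variables (p q : W -> W) (d : B -> W).
Hypotheses (pm : bimod_map p) (qm : bimod_map q).
Hypothesis pq1 : forall w, p w + q w = w.
Hypothesis star_p : forall w, star (p w) = q (star w).
Hypotheses (pc : colinear dW dW p) (qc : colinear dW dW q).
Hypotheses (dl : clinear d) (dc : colinear dB dW d).

Variable phi : W -> W -> regular_bimod B.
Hypothesis phi_form : bimod_form phi.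
Hypothesis phi_bicol : bicolinear dW dW dB phi.
Hypothesis phi_pq : forall w x, phi (p w) x = phi w (q x).
Variable u : WW.
Hypothesis u_l : forall w, contract_l phi w u = w.
Hypothesis u_coinv : dWW u = 1 ⊗ u.

Variables nabla D : W -> WW.
Hypothesis nabla_clinear : clinear nabla.
Hypothesis nabla_p : forall w, tmapB id p (nabla w) = nabla (p w).
Hypothesis nabla_phi : forall w x,
  d (phi w x) =
  contract_r phi (nabla w) x + contract_l phi w (flip_star star (nabla (star x))).
Hypothesis D_nabla : forall w,
  D w = tmapB q id (nabla (p w)) + tmapB p id (nabla (q w)).
Hypothesis Dc : colinear dW dWW D.

(** D is colinear by hypothesis.  For the residual half, contract_residual
expresses its contraction with x as a colinear function of w and x, and
contract_r_coact_inj removes x. *)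
Theorem nabla_colinear : colinear dW dWW nabla.
Proof.
have pl := bimod_map_clinear pm; have ql := bimod_map_clinear qm.
have idm := bimod_map_id W.
have nD : {morph nabla : x y / x + y} by case: nabla_clinear.
have plm := bimod_map_clinear (tmapB_map pm idm).
have qlm := bimod_map_clinear (tmapB_map qm idm).
have Dl : clinear D.
  have -> : D = (fun w => tmapB q id (nabla (p w)) + tmapB p id (nabla (q w))).
    exact/funext.
  apply: clinear_add.
    exact: (clinear_comp pl (clinear_comp nabla_clinear qlm)).
  exact: (clinear_comp ql (clinear_comp nabla_clinear plm)).
pose N := residual p q nabla.
have Nl : clinear N.
  apply: clinear_add.
    exact: (clinear_comp pl (clinear_comp nabla_clinear plm)).
  exact: (clinear_comp ql (clinear_comp nabla_clinear qlm)).
have nablaE : nabla = (fun w => D w + N w).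
  by apply/funext => w; exact: (nabla_split pm qm pq1 nD D_nabla).
have pb := bimod_form_bilinear phi_form.
have crb := bimod_form_bilinear (contract_r_form phi_form).
have clb := bimod_form_bilinear (contract_l_form phi_form).
have [sl sc] : clinear (fun x => flip_star star (D (star x))) /\
    colinear dW dWW (fun x => flip_star star (D (star x))).
  split; last exact: flip_star_conj_colinear.
  have h := twisted_comp (twisted_comp star_twisted Dl) flip_star_twisted.
  by split=> [x y|c x]; [case: h => ->|case: h => _ ->; rewrite /= conjCK].
have fE : (fun w x => contract_r phi (N w) x) = (fun w x =>
    (p (d (phi (p w) x)) + q (d (phi (q w) x)))
     + - contract_l phi w (flip_star star (D (star x)))).
  apply/funext => w; apply/funext => x.
  exact: (contract_residual starP pm qm pq1 star_p phi_form phi_pq nD nabla_p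
           nabla_phi D_nabla).
have bicol : bicolinear dW dW dW (fun w x => contract_r phi (N w) x).
  have pdl := clinear_comp dl pl; have qdl := clinear_comp dl ql.
  have opl : clinear (fun w : W => - w) by exact: clinear_opp.
  have opc : colinear dW dW (fun w : W => - w).
    by apply: (@colinear_opp _ _ _ _ dW dW id) => // x; rewrite tmap_id.
  have idc : colinear dW dW id by move=> x; rewrite tmap_id.
  have pdc := colinear_comp dl pl dc pc; have qdc := colinear_comp dl ql dc qc.
  have iW := @il W.
  have b1 := bilinear_comp pb pl iW pdl; have b2 := bilinear_comp pb ql iW qdl.
  rewrite fE; apply: bicolinear_add => //.
  - exact: bilinear_add b1 b2.
  - exact: (bilinear_comp clb iW sl opl).
  - apply: bicolinear_add => //.
      exact: (bicolinear_comp pb pl iW pdl phi_bicol pc idc pdc).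
    exact: (bicolinear_comp pb ql iW qdl phi_bicol qc idc qdc).
  - apply: (bicolinear_comp clb iW sl opl _ idc sc opc).
    exact: contract_l_bicolinear.
have Nc : colinear dW dWW N.
  move=> w; apply: (contract_r_coact_inj phi_form u_l u_coinv) => x.
  rewrite -(contract_r_bicolinear phi_form phi_bicol) bicol.
  have := tmul_tmap (dW w) (dW x) hm crb Nl (@il W) (@il W).
  by rewrite !tmap_id => ->.
rewrite nablaE; apply: colinear_add => //; exact: tens_coactD.
Qed.

End CovariantBimodule.

(** * Moving a covariant metric to another pairing *)

Section TransferMetric.
Variables (C : numClosedFieldType) (A : hopfStarAlg C) (H : hopfAlg C).
Variables (pi : hopfMap A H) (D0 : baseStar pi).
Local Notation B := (coinv pi).
Local Notation dB := (base_coact D0).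
Variables (W : bimod B) (dW : W -> (A ⊗ W)%type).
Hypothesis dW_cov : covariant_bimod D0 dW.
Local Notation WW := (tensB W W).
Local Notation dWW := (tens_coact dW dW).

Variables psi phi : W -> W -> regular_bimod B.
Hypotheses (psi_form : bimod_form psi) (phi_form : bimod_form phi).
Hypothesis psi_bicol : bicolinear dW dW dB psi.
Hypothesis phi_bicol : bicolinear dW dW dB phi.
Variable g : WW.
Hypothesis g_l : forall w, contract_l psi w g = w.
Hypothesis g_coinv : dWW g = 1 ⊗ g.
Hypothesis represent : forall x, exists y, forall w, psi w x = phi w y.
Hypothesis nondegenerate : forall y, (forall w, phi w y = 0) -> y = 0.

Let il := @clinear_id C A.

Lemma phi_injr y y' : (forall w, phi w y = phi w y') -> y = y'.
Proof.
move=> h; apply/eqP; rewrite -subr_eq0; apply/eqP/nondegenerate => w.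
have wD : {morph phi w : x z / x + z} by move=> x z; exact: phiDr.
by rewrite (morphB wD) h subrr.
Qed.

(** The identity of W is contract_r phi u, a sum of maps z -> x_i phi(y_i, z) that
factor through the pairings. *)
Lemma pairing_leg_inj (u : WW) (Z Z' : (A ⊗ W)%type) :
  (forall z, contract_r phi u z = z) ->
  (forall m, tmap id (phi m) Z = tmap id (phi m) Z') -> Z = Z'.
Proof.
move=> u_r ZZ'; have [pl pr] := bimod_form_bilinear phi_form.
have [rl rr] := bilinear_ract W.
have [_ cr] := bimod_form_bilinear (contract_r_form phi_form).
have E (Y : (A ⊗ W)%type) : tmap id (contract_r phi u) Y = Y.
  have -> : contract_r phi u = id by exact/funext.
  exact: tmap_id.
rewrite -(E Z) -(E Z'); clear E u_r; move: u.
have S c c' (Y : (A ⊗ W)%type) : tmap id (contract_r phi (c + c')) Y =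
    tmap id (contract_r phi c) Y + tmap id (contract_r phi c') Y :> (A ⊗ W)%type.
  rewrite -tmap_sum2 //; congr (tmap _ _ _).
  by apply/funext => z; exact: contract_rDl.
apply: tensB_ext => [c c'|c c'|x y]; rewrite ?S //.
have F (Y : (A ⊗ W)%type) : tmap id (contract_r phi (tpB x y)) Y =
    tmap id (fun b => ract x b) (tmap id (phi y) Y) :> (A ⊗ W)%type.
  rewrite (tmap_compose _ il (pr y) il (rr x)); congr (tmap _ _ _).
  by apply/funext => z; exact: contract_rE.
by rewrite !F ZZ'.
Qed.

(** With psi(w, x) = phi(w, tau x) and g the coevaluation of psi, the coevaluation
of phi is (tau (x) id) g. *)
Lemma transfer_metric : exists u : WW,
  [/\ forall w, contract_l phi w u = w, forall z, contract_r phi u z = z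
    & dWW u = 1 ⊗ u].
Proof.
have [tau tauP] := boolp.choice represent.
have idm := bimod_map_id W.
have tm : bimod_map tau.
  split=> [x y|b x|x b]; apply: phi_injr => w.
  - by rewrite (phiDr phi_form) -!tauP (phiDr psi_form).
  - by rewrite -(phiM phi_form) -!tauP (phiM psi_form).
  - by rewrite (phi_ract phi_form) -!tauP (phi_ract psi_form).
pose u := tmapB tau id g.
have cl w X : contract_l phi w (tmapB tau id X) = contract_l psi w X.
  move: X; apply: (tensB_ext (h := fun X => contract_l phi w (tmapB tau id X))
      (h' := contract_l psi w)) => [X Y|X Y|x y].
  - by rewrite (tmapBD tm idm) (contract_lDr phi_form).
  - by rewrite (contract_lDr psi_form).
  - by rewrite (tmapBE tm idm) (contract_lE phi_form) (contract_lE psi_form) -tauP.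
have u_l w : contract_l phi w u = w by rewrite cl g_l.
have u_r z : contract_r phi u z = z.
  apply: phi_injr => w; rewrite -[in RHS](g_l w) /u.
  move: g; apply: (tensB_ext
      (h := fun X => phi w (contract_r phi (tmapB tau id X) z))
      (h' := fun X => phi (contract_l psi w X) z)) => [X Y|X Y|x y].
  - by rewrite (tmapBD tm idm) (contract_rDl phi_form) (phiDr phi_form).
  - by rewrite (contract_lDr psi_form) (phiDl phi_form).
  - rewrite (tmapBE tm idm) (contract_rE phi_form) (contract_lE psi_form).
    by rewrite (phi_ract phi_form) (phi_lact phi_form) -tauP.
exists u; split=> //.
(* only the coinvariance of u is left, that is, the colinearity of tau *)
have tl := bimod_map_clinear tm; have [_ pr] := bimod_form_bilinear phi_form.
have coP : is_coaction dW by case: dW_cov.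
have tc : colinear dW dW tau.
  move=> x; apply: (pairing_leg_inj u_r) => m.
  rewrite (tmap_compose _ il tl il (pr m)).
  rewrite -(antipode_cancel m (tau x) coP (bimod_form_bilinear phi_form) phi_bicol).
  have -> : (fun y => phi m (tau y)) = psi m by apply/funext => y; rewrite tauP.
  rewrite -(antipode_cancel m x coP (bimod_form_bilinear psi_form) psi_bicol).
  by congr (tliftC _ _); apply/funext => a; apply/funext => m0; rewrite tauP.
have idc : colinear dW dW id by move=> x; rewrite tmap_id.
have ul := bimod_map_clinear (tmapB_map tm idm).
by rewrite (colinear_tmapB dW_cov tm idm tc idc) g_coinv (tmap_pure il ul).
Qed.

End TransferMetric.

(** * One-forms of a complex structure *)

Section OneForms.
Variables (C : numClosedFieldType) (B : algType C) (sB : starOp B).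
Variables (Om : starCalculus sB) (cs : complexStructure Om).
Local Notation W := (Om1 Om).
Local Notation WW := (tensB W W).

Lemma out1_inj : injective (@out1 _ _ _ Om).
Proof. exact: val_inj. Qed.

Lemma outpq_inj a b : injective (@outpq _ _ _ Om cs a b).
Proof. exact: val_inj. Qed.

Lemma out1_homog (w : W) : degp Om 1 (out1 w) = out1 w.
Proof. exact: (eqP (summand_valP w)). Qed.

Lemma outpq_homog a b (w : Ompq cs a b) : bidegp cs (a, b) (outpq w) = outpq w.
Proof. exact: (eqP (summand_valP w)). Qed.

Lemma bidegpE i j (v : Om) :
  bidegp cs i (bidegp cs j v) = if i == j then bidegp cs j v else 0.
Proof. by have [-> _] := bidegp_grading cs. Qed.

Lemma in1_map : bimod_map (@in1 _ _ _ Om : forms_bimod Om -> W).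
Proof.
split=> [x y|b x|x b]; apply: val_inj => /=.
- exact: linearD.
- exact: (bprojl (deg_proj Om 1) b x).
- exact: (bprojr (deg_proj Om 1) x b).
Qed.

Lemma inpq_map a b : bimod_map (inpq cs a b : forms_bimod Om -> Ompq cs a b).
Proof.
split=> [x y|c x|x c]; apply: val_inj => /=.
- exact: linearD.
- exact: (bprojl (bideg_proj cs (a, b)) c x).
- exact: (bprojr (bideg_proj cs (a, b)) x c).
Qed.

Lemma out1_map : bimod_map (@out1 _ _ _ Om : W -> forms_bimod Om).
Proof. by []. Qed.

Lemma out1D (w v : W) : out1 (w + v) = out1 w + out1 v. Proof. by []. Qed.
Lemma out1_lact b (w : W) : out1 (lact b w) = iota0 Om b * out1 w.
Proof. by []. Qed.
Lemma out1_ract (w : W) b : out1 (ract w b) = out1 w * iota0 Om b.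
Proof. by []. Qed.

Lemma outpq_map a b : bimod_map (@outpq _ _ _ Om cs a b : Ompq cs a b -> forms_bimod Om).
Proof. by []. Qed.

Lemma proj1_map a b : bimod_map (proj1 cs a b).
Proof. exact: (bimod_map_comp out1_map (inpq_map a b)). Qed.

Lemma incl1_map a b : bimod_map (@incl1 _ _ _ Om cs a b).
Proof. exact: (bimod_map_comp (outpq_map a b) in1_map). Qed.

Lemma degp1E (v : Om) : degp Om 1 v = bidegp cs (1, 0)%N v + bidegp cs (0, 1)%N v.
Proof. by rewrite (bideg_total cs) big_ord_recl big_ord1 /= addrC. Qed.

(** Hypotheses a + b = 1 let one argument serve both types of one-forms: (a, b) is
one of the types and (b, a) the other. *)
Lemma type1_cases a b : (a + b = 1)%N -> (a, b) = (1, 0)%N \/ (a, b) = (0, 1)%N.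
Proof. by case: a b => [|[|a]] [|[|b]] //; [right|left]. Qed.

Lemma type1_neq a b : (a + b = 1)%N -> ((a, b) == (b, a)) = false.
Proof. by move=> /type1_cases [] [-> ->]. Qed.

Lemma bidegp_degp1 a b (v : Om) : (a + b = 1)%N ->
  degp Om 1 (bidegp cs (a, b) v) = bidegp cs (a, b) v.
Proof.
by move=> /type1_cases [] [-> ->]; rewrite degp1E !bidegpE /= ?addr0 ?add0r.
Qed.

Lemma out1_incl1 a b (x : Ompq cs a b) : (a + b = 1)%N -> out1 (incl1 x) = outpq x.
Proof.
by move=> ab; rewrite -[LHS]/(degp Om 1 (outpq x)) -(outpq_homog x) bidegp_degp1.
Qed.

Definition part a b (w : W) : W := incl1 (proj1 cs a b w).

Lemma part_map a b : bimod_map (part a b).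
Proof. exact: (bimod_map_comp (proj1_map a b) (incl1_map a b)). Qed.

Lemma out1_part a b w : (a + b = 1)%N -> out1 (part a b w) = bidegp cs (a, b) (out1 w).
Proof. by move=> ab; rewrite /part out1_incl1. Qed.

Lemma part_sum w : part 1 0 w + part 0 1 w = w.
Proof.
apply: out1_inj; case: out1_map => -> _ _; rewrite !out1_part //.
by rewrite -degp1E out1_homog.
Qed.

Lemma proj1_incl1 a b (x : Ompq cs a b) : (a + b = 1)%N -> proj1 cs a b (incl1 x) = x.
Proof.
move=> ab; apply: outpq_inj.
by rewrite -[LHS]/(bidegp cs (a, b) (out1 (incl1 x))) out1_incl1 // outpq_homog.
Qed.

Lemma proj1_incl1_op a b (x : Ompq cs a b) : (a + b = 1)%N ->
  proj1 cs b a (incl1 x) = 0.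
Proof.
move=> ab; apply: outpq_inj.
rewrite -[LHS]/(bidegp cs (b, a) (out1 (incl1 x))) out1_incl1 //.
by rewrite -outpq_homog bidegpE eq_sym type1_neq.
Qed.

Lemma part_incl1 a b (x : Ompq cs a b) : (a + b = 1)%N -> part a b (incl1 x) = incl1 x.
Proof. by move=> ab; rewrite /part proj1_incl1. Qed.

Lemma incl1_0 a b : incl1 (0 : Ompq cs a b) = 0.
Proof. by apply: morph0; case: (incl1_map a b). Qed.

Lemma part_incl1_op a b (x : Ompq cs a b) : (a + b = 1)%N ->
  part b a (incl1 x) = 0.
Proof. by move=> ab; rewrite /part proj1_incl1_op // incl1_0. Qed.

Lemma part_part a b w : (a + b = 1)%N -> part a b (part a b w) = part a b w.
Proof. exact: part_incl1. Qed.

Lemma part_part_op a b w : (a + b = 1)%N -> part b a (part a b w) = 0.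
Proof. exact: part_incl1_op. Qed.

Lemma fstar_bidegp a b (v : Om) :
  fstar Om (bidegp cs (a, b) v) = bidegp cs (b, a) (fstar Om v).
Proof.
have [_ ps] := bidegp_grading cs; have [s _ ->] := ps v.
apply: (big_ind (fun v => fstar Om (bidegp cs (a, b) v) =
    bidegp cs (b, a) (fstar Om v))) => [|x y hx hy|[c d] _].
- by rewrite !linear0 (morph0 (@fstarD _ _ _ Om)) linear0.
- by rewrite linearD !fstarD hx hy linearD.
- have h : homog (bidegp cs) (c, d) (bidegp cs (c, d) v).
    by rewrite /homog bidegpE eqxx.
  rewrite -[in RHS](bideg_star h) !bidegpE.
  have -> : ((b, a) == (d, c)) = ((a, b) == (c, d)) by rewrite !xpair_eqE andbC.
  case: eqP => [_|_]; first by rewrite (bideg_star h).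
  exact: (morph0 (@fstarD _ _ _ Om)).
Qed.

Lemma out1_star (w : W) : out1 (star_1 w) = fstar Om (out1 w).
Proof.
rewrite -[LHS]/(degp Om 1 (fstar Om (out1 w))).
by rewrite (fstar_deg (k := 1%N)) // /homog out1_homog.
Qed.

Lemma star_part a b w : (a + b = 1)%N -> star_1 (part a b w) = part b a (star_1 w).
Proof.
move=> ab; have ba : (b + a = 1)%N by rewrite addnC.
apply: out1_inj; rewrite out1_star (out1_part _ ab) (out1_part _ ba) out1_star.
exact: fstar_bidegp.
Qed.

Lemma star_1P : bimod_star sB (@star_1 _ _ _ Om).
Proof.
split=> [x y|b w|w b|w]; apply: out1_inj.
- by rewrite out1D !out1_star out1D fstarD.
- rewrite out1_ract !out1_star out1_lact.
  rewrite (fstarM (k := 0%N) (l := 1%N)) ?fstar_iota ?mul1r //.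
    exact: iota0_deg.
  exact: out1_homog.
- rewrite out1_lact !out1_star out1_ract.
  rewrite (fstarM (k := 1%N) (l := 0%N)) ?fstar_iota ?mul1r //.
    exact: out1_homog.
  exact: iota0_deg.
- by rewrite !out1_star fstarK.
Qed.

Lemma out1_d0 b : out1 (d0 Om b) = diff Om (iota0 Om b).
Proof. exact: (diff_deg (iota0_deg Om b)). Qed.

Lemma d0_star b : d0 Om (sB b) = star_1 (d0 Om b).
Proof.
by apply: out1_inj; rewrite out1_star !out1_d0 -fstar_iota fstar_diff.
Qed.

Lemma d0_clinear : clinear (d0 Om).
Proof.
have il := bimod_map_clinear in1_map.
apply: (clinear_comp _ il); apply: clinear_linear => c x y.
by rewrite !linearP.
Qed.

Definition wedge1 (X : WW) : Om := tliftB (fun x y => out1 x * out1 y : forms_bimod Om) X.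

Lemma wedge1_form : bimod_form (fun x y : W => out1 x * out1 y : forms_bimod Om).
Proof.
split; first split.
- by move=> m m' n; rewrite out1D mulrDl.
- by move=> m n n'; rewrite out1D mulrDr.
- by move=> m b n; rewrite out1_lact out1_ract mulrA.
- by move=> b m n; rewrite out1_lact /= mulrA.
- by move=> m n b; rewrite out1_ract /= mulrA.
Qed.

Lemma wedge1_map : bimod_map (wedge1 : WW -> forms_bimod Om).
Proof. exact: bimod_form_lift wedge1_form. Qed.

Lemma wedge1E x y : wedge1 (tpB x y) = out1 x * out1 y.
Proof. by case: wedge1_form => h _ _; exact: tliftBE h. Qed.

Section Factor.
Variables a b : nat.
Hypothesis ab : (a + b = 1)%N.

(** For (a, b) = (1, 0) this is the product of (0,1)-forms with (1,0)-forms, for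
(a, b) = (0, 1) the product in the other order. *)
Definition wedge_ba : tensB (Ompq cs b a) (Ompq cs a b) -> Ompq cs 1 1 :=
  tliftB (fun v w => inpq cs 1 1 (outpq v * outpq w)).

Lemma wedge_ba_form : bimod_form (fun (v : Ompq cs b a) (w : Ompq cs a b) =>
  inpq cs 1 1 (outpq v * outpq w)).
Proof.
have [iD il ir] := inpq_map 1 1.
split; first split.
- by move=> m m' n; case: (outpq_map b a) => -> _ _; rewrite mulrDl iD.
- by move=> m n n'; case: (outpq_map a b) => -> _ _; rewrite mulrDr iD.
- move=> m c n; case: (outpq_map b a) => _ _ ->; case: (outpq_map a b) => _ -> _ /=.
  by rewrite mulrA.
- by move=> c m n; case: (outpq_map b a) => _ -> _; rewrite -il /= mulrA.
- by move=> m n c; case: (outpq_map a b) => _ _ ->; rewrite -ir /= mulrA.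
Qed.

Lemma wedge_ba_map : bimod_map wedge_ba.
Proof. exact: bimod_form_lift wedge_ba_form. Qed.

Lemma wedge_baE v w : wedge_ba (tpB v w) = inpq cs 1 1 (outpq v * outpq w).
Proof. by case: wedge_ba_form => h _ _; exact: tliftBE h. Qed.

Variable theta : Ompq cs 1 1 -> tensB (Ompq cs b a) (Ompq cs a b).
Hypotheses (thetaK : cancel theta wedge_ba) (wedgeK : cancel wedge_ba theta).

Lemma theta_map : bimod_map theta.
Proof.
have [wD wl wr] := wedge_ba_map.
split=> [x y|c x|x c]; apply: (can_inj wedgeK); rewrite ?wD ?wl ?wr !thetaK //.
Qed.

(** theta followed by the inclusion into the square of the one-forms; it extends to
all forms by projecting to type (1,1). *)
Definition factor (v : Om) : WW :=
  tmapB (@incl1 _ _ _ Om cs b a) (@incl1 _ _ _ Om cs a b) (theta (inpq cs 1 1 v)).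

Let ba : (b + a = 1)%N. Proof. by rewrite addnC. Qed.
Let iba := incl1_map b a.
Let iab := incl1_map a b.
Let inclm := tmapB_map iba iab.

Lemma factor_map : bimod_map (factor : forms_bimod Om -> WW).
Proof. exact: (bimod_map_comp (bimod_map_comp (inpq_map 1 1) theta_map) inclm). Qed.

Lemma wedge1_incl X :
  wedge1 (tmapB (@incl1 _ _ _ Om cs b a) (@incl1 _ _ _ Om cs a b) X) =
  outpq (wedge_ba X).
Proof.
move: X; apply: (tensB_ext (V := forms_bimod Om)
    (h := fun X => wedge1 (tmapB (@incl1 _ _ _ Om cs b a) (@incl1 _ _ _ Om cs a b) X))
    (h' := fun X => outpq (wedge_ba X))) => [X Y|X Y|x y].
- by rewrite (tmapBD iba iab); case: wedge1_map => ->.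
- by case: wedge_ba_map => ->.
- rewrite (tmapBE iba iab) wedge1E wedge_baE !out1_incl1 //.
  rewrite -[RHS]/(bidegp cs (1, 1)%N (outpq x * outpq y)).
  rewrite -{1}ba -{1}ab; apply/esym; apply: bidegM; exact: outpq_homog.
Qed.

Lemma wedge1_factor v : wedge1 (factor v) = bidegp cs (1, 1)%N v.
Proof. by rewrite /factor wedge1_incl thetaK. Qed.

Lemma tmapB_partE X : tmapB (part b a) (part a b) X =
  tmapB (@incl1 _ _ _ Om cs b a) (@incl1 _ _ _ Om cs a b)
    (tmapB (proj1 cs b a) (proj1 cs a b) X).
Proof. by rewrite tmapB_compose //; exact: proj1_map. Qed.

Lemma factor_wedge1 X :
  factor (wedge1 (tmapB (part b a) (part a b) X)) = tmapB (part b a) (part a b) X.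
Proof.
rewrite tmapB_partE wedge1_incl /factor.
have -> Y : inpq cs 1 1 (outpq (wedge_ba Y)) = wedge_ba Y.
  by apply: outpq_inj; exact: outpq_homog.
by rewrite wedgeK.
Qed.

Lemma part_factor v : tmapB (part b a) (part a b) (factor v) = factor v.
Proof.
rewrite tmapB_partE /factor [tmapB (proj1 cs b a) _ _](tmapB_compose _ iba iab
  (proj1_map b a) (proj1_map a b)).
have -> : (fun x => proj1 cs b a (@incl1 _ _ _ Om cs b a x)) = id.
  by apply/funext => x; rewrite proj1_incl1.
have -> : (fun x => proj1 cs a b (@incl1 _ _ _ Om cs a b x)) = id.
  by apply/funext => x; rewrite proj1_incl1.
by rewrite tmapB_id.
Qed.

Lemma factor_bidegp v : factor (bidegp cs (1, 1)%N v) = factor v.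
Proof.
rewrite /factor; congr (tmapB _ _ (theta _)); apply: outpq_inj.
by rewrite -[LHS]/(bidegp cs (1, 1)%N (bidegp cs (1, 1)%N v)) bidegpE eqxx.
Qed.

(** The holomorphic structure of the forms of type (a, b), read as a map on all
one-forms with values in the square of the one-forms. *)
Definition holo (w : W) : WW := factor (diff Om (out1 (part a b w))).

Lemma holo_clinear : clinear holo.
Proof.
have pl := bimod_map_clinear (part_map a b).
have ol := bimod_map_clinear out1_map.
have fl := bimod_map_clinear factor_map.
have dl : clinear (diff Om) by apply: clinear_linear => k x y; exact: linearP.
exact: (clinear_comp (clinear_comp (clinear_comp pl ol) dl) fl).
Qed.

Definition holo_braid (X : WW) : WW := - factor (wedge1 (tmapB (part a b) id X)).

Lemma holo_braid_map : bimod_map holo_braid.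
Proof.
apply: bimod_map_opp; apply: (bimod_map_comp _ factor_map).
apply: (bimod_map_comp _ wedge1_map); apply: tmapB_map => //; exact: part_map.
Qed.

(** The derivative of w c is dw c - w dc since w has degree one, and factor is
right linear; the second term is the braiding, which is minus the inverse of one
wedge product composed with the other. *)
Lemma holo_ract w c :
  holo (ract w c) = ract (holo w) c + holo_braid (tpB w (d0 Om c)).
Proof.
have [_ _ pr] := part_map a b; have [_ _ or] := out1_map.
have [fD _ fr] := factor_map.
rewrite /holo /holo_braid pr or -fr.
rewrite (tmapBE (part_map a b) (bimod_map_id W)) wedge1E out1_d0.
rewrite -(morphN fD) -fD /= (diff_leibniz (k := 1%N)); last exact: out1_homog.
by rewrite expr1 mulN1r.
Qed.

End Factor.
End OneForms.

(** * Covariance of the calculus on one-forms *)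

Section CovariantForms.
Variables (C : numClosedFieldType) (A : hopfStarAlg C) (H : hopfAlg C).
Variables (pi : hopfMap A H) (D0 : baseStar pi).
Variables (Om : starCalculus (base_star D0)) (cc : covariantCalculus Om).
Variables (cs : complexStructure Om) (cs_cov : covariant_complex cc cs).
Local Notation B := (coinv pi).
Local Notation dB := (base_coact D0).
Local Notation W := (Om1 Om).
Local Notation WW := (tensB W W).
Local Notation dW := (coact1 cc).
Local Notation dWW := (tens_coact dW dW).
Hypothesis W_cov : covariant_bimod D0 dW.

Let il := @clinear_id C A.
Let hm := bilinear_mul A.

Lemma fcoact_clinear : clinear (fcoact cc).
Proof. by case: (fcoactP cc) => h _ _; exact: clinear_linear. Qed.

Lemma linear_clin (M N : lmodType C) (f : {linear M -> N}) : clinear f.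
Proof. by apply: clinear_linear => c x y; exact: linearP. Qed.

Let inl : clinear (@in1 _ _ _ Om : Om -> W).
Proof. exact: (bimod_map_clinear (in1_map Om)). Qed.
Let outl : clinear (@out1 _ _ _ Om : W -> Om).
Proof. exact: (bimod_map_clinear (out1_map Om)). Qed.

Lemma out1_colinear : colinear dW (fcoact cc) (@out1 _ _ _ Om : W -> Om).
Proof.
move=> w; rewrite -[dW w]/(tmap id (@in1 _ _ _ Om) (fcoact cc (out1 w))).
rewrite (tmap_compose _ il inl il outl).
by rewrite -[LHS](fcoact_deg cc (k := 1%N)) //; exact: out1_homog.
Qed.

(** A map of one-forms induced by a map of all forms inherits its compatibility
with the coactions, colinear or star-colinear according to hs. *)
Lemma coact1_read s (hs : A -> A) (f : W -> W) (F : Om -> Om) :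
  twisted_linear s hs -> twisted_linear s F ->
  (forall w, out1 (f w) = F (out1 w)) ->
  (forall w : W, fcoact cc (F (out1 w)) = tmap hs F (fcoact cc (out1 w))) ->
  forall w, dW (f w) = tmap hs f (dW w).
Proof.
move=> hl Fl fF Fc w.
rewrite -[LHS]/(tmap id (@in1 _ _ _ Om) (fcoact cc (out1 (f w)))) fF Fc.
rewrite out1_colinear (tmap_compose _ il outl hl Fl).
have h1 := twisted_comp il hl; have h2 := twisted_comp outl Fl.
rewrite (tmap_compose _ h1 h2 il inl); congr (tmap _ _ _).
apply/funext => x; rewrite -fF; apply: out1_inj; exact: out1_homog.
Qed.

Lemma tmap_to0 (M N P : lmodType C) (X : (M ⊗ N)%type) (f : N -> P) :
  (forall y, f y = 0) -> tmap id f X = 0.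
Proof.
move=> f0; have fl : clinear f.
  by split=> [x y|c x]; rewrite !f0 ?addr0 ?scaler0.
have iM := @clinear_id C M.
elim/tensC_ind: X => [m n||x y hx hy].
- by rewrite (tmap_pure iM fl) f0 -(scale0r 0) tpureCZr scale0r.
- exact: (morph0 (tmap_additive iM fl)).
- by rewrite (tmap_additive iM fl) hx hy addr0.
Qed.

(** The coaction preserves each bidegree, and a form is the sum of its
homogeneous components. *)
Lemma bidegp_colinear i : colinear (fcoact cc) (fcoact cc) (bidegp cs i).
Proof.
move=> v; have bl j := linear_clin (bidegp cs j).
have [dD _] := fcoact_clinear; have bD := tmap_additive il (bl i).
have [_ ps] := bidegp_grading cs; have [s _ ->] := ps v.
apply: (big_ind (fun v => fcoact cc (bidegp cs i v) =
    tmap id (bidegp cs i) (fcoact cc v))) => [|x y hx hy|[c d] _].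
- by rewrite linear0 (morph0 dD) (morph0 bD).
- by rewrite linearD !dD hx hy bD.
- have h : homog (bidegp cs) (c, d) (bidegp cs (c, d) v).
    by rewrite /homog bidegpE eqxx.
  rewrite bidegpE -[in RHS](cs_cov h) (tmap_compose _ il (bl _) il (bl _)).
  case: eqP => [->|/eqP ne].
    rewrite -[LHS](cs_cov h); congr (tmap _ _ _); apply/funext => y.
    by rewrite bidegpE eqxx.
  rewrite (morph0 dD) tmap_to0 // => y.
  by rewrite bidegpE (negPf ne).
Qed.

Lemma part_colinear a b : (a + b = 1)%N -> colinear dW dW (@part _ _ _ _ cs a b).
Proof.
move=> ab; apply: (coact1_read il (linear_clin (bidegp cs (a, b)))) => w.
  exact: out1_part.
exact: bidegp_colinear.
Qed.

Lemma star_1_coact w : dW (star_1 w) = tmap hstar (@star_1 _ _ _ Om) (dW w).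
Proof.
move: w; apply: (coact1_read (s := fun c : C => c^* ) (F := fstar Om)).
- exact: hstar_twisted.
- by split; [exact: fstarD|exact: fstarZ].
- exact: out1_star.
- by move=> w; exact: fcoact_star.
Qed.

Lemma d0_colinear : colinear dB dW (d0 Om).
Proof.
move=> b; rewrite -[LHS]/(tmap id (@in1 _ _ _ Om) (fcoact cc (out1 (d0 Om b)))).
have iol := linear_clin (iota0 Om); have dl := linear_clin (diff Om).
rewrite out1_d0 (fcoact_diff cc) (fcoact_iota cc).
rewrite (tmap_compose _ il iol il dl).
by rewrite (tmap_compose _ il (clinear_comp iol dl) il inl).
Qed.

Lemma wedge1_colinear : colinear dWW (fcoact cc) (@wedge1 _ _ _ Om).
Proof.
have [wD _ _] := wedge1_map Om; have wl := bimod_map_clinear (wedge1_map Om).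
have tb := bilinear_tpB W W; have [dD _] := fcoact_clinear.
have ob := bilinear_mul Om.
move=> X; move: X; apply: (tensB_ext (h := fun X => fcoact cc (wedge1 X))
  (h' := fun X => tmap id (@wedge1 _ _ _ Om : WW -> Om) (dWW X))) => [X Y|X Y|x y].
- by rewrite wD dD.
- by rewrite (tens_coactD W_cov) (tmap_additive il wl).
- rewrite wedge1E fcoactM !out1_colinear (tpB_bicolinear W_cov).
  have := tmul_tmap (dW x) (dW y) hm ob outl outl (@clinear_id C Om).
  rewrite tmap_id /tmulA => ->.
  have := tmul_tmap (dW x) (dW y) hm tb (@clinear_id C W) (@clinear_id C W) wl.
  rewrite !tmap_id => ->.
  congr (tmul _ _ _ _); apply/funext => m; apply/funext => n.
  by rewrite wedge1E.
Qed.

Section HoloColinear.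
Variables a b : nat.
Hypothesis ab : (a + b = 1)%N.
Variable theta : Ompq cs 1 1 -> tensB (Ompq cs b a) (Ompq cs a b).
Hypotheses (thetaK : cancel theta (@wedge_ba _ _ _ _ cs a b)).
Hypotheses (wedgeK : cancel (@wedge_ba _ _ _ _ cs a b) theta).

(** The exterior derivative is colinear; so is the inverse wedge product, because
the coaction of holo w stays in the tensors of type (b, a) (x) (a, b), on which
factor inverts the colinear map wedge1. *)
Lemma holo_colinear : colinear dW dWW (holo theta).
Proof.
move=> w; have ba : (b + a = 1)%N by rewrite addnC.
have pab := @part_map _ _ _ _ cs a b; have pba := @part_map _ _ _ _ cs b a.
have Kl := bimod_map_clinear (tmapB_map pba pab).
have wl : clinear (@wedge1 _ _ _ Om : WW -> Om).
  exact: bimod_map_clinear (wedge1_map Om).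
have fl : clinear (factor theta : Om -> WW).
  exact: bimod_map_clinear (factor_map thetaK wedgeK).
have Z1 : tmap id (tmapB (part cs b a) (part cs a b)) (dWW (holo theta w)) =
    dWW (holo theta w).
  rewrite -(colinear_tmapB W_cov pba pab (part_colinear ba) (part_colinear ab)).
  by rewrite part_factor.
have Z2 : tmap id (fun X : WW => factor theta (wedge1 X)) (dWW (holo theta w)) =
    dWW (holo theta w).
  rewrite -{1}Z1 (tmap_compose _ il Kl il (clinear_comp wl fl)) -[RHS]Z1.
  congr (tmap _ _ _); apply/funext => X; exact: factor_wedge1.
have pl := bimod_map_clinear pab; have dl := linear_clin (diff Om).
have bl := linear_clin (bidegp cs (1, 1)%N).
have l1 : clinear (fun w : W => out1 (part cs a b w)) := clinear_comp pl outl.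
have l2 := clinear_comp l1 dl; have l3 := clinear_comp l2 bl.
have c3 : colinear dW (fcoact cc)
    (fun w => bidegp cs (1, 1)%N (diff Om (out1 (part cs a b w)))).
  apply: (colinear_comp l2 bl _ (bidegp_colinear _)).
  apply: (colinear_comp l1 dl _ (fcoact_diff cc)).
  exact: (colinear_comp pl outl (part_colinear ab) out1_colinear).
rewrite -Z2 -(tmap_compose _ il wl il fl) -wedge1_colinear.
rewrite /holo (wedge1_factor ab thetaK) c3 (tmap_compose _ il l3 il fl).
congr (tmap _ _ _); apply/funext => x; exact: factor_bidegp.
Qed.
End HoloColinear.

End CovariantForms.

(** * Chern connections as maps on all one-forms *)

Section ChernBlock.
Variables (C : numClosedFieldType) (B : algType C) (sB : starOp B).
Variables (Om : starCalculus sB) (cs : complexStructure Om).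
Local Notation W := (Om1 Om).
Local Notation WW := (tensB W W).
Variable psi : W -> W -> regular_bimod B.
Hypothesis psi_form : bimod_form psi.
Local Notation P := (part cs).

(** The part of the metric that both Hermitian metrics see. *)
Definition cross (w x : W) : regular_bimod B :=
  psi (P 1 0 w) (P 0 1 x) + psi (P 0 1 w) (P 1 0 x).

Lemma cross_form : bimod_form cross.
Proof.
have im := @bimod_map_id _ B (regular_bimod B).
have f1 := bimod_form_comp psi_form (@part_map _ _ _ _ cs 1 0) (@part_map _ _ _ _ cs 0 1) im.
have f2 := bimod_form_comp psi_form (@part_map _ _ _ _ cs 0 1) (@part_map _ _ _ _ cs 1 0) im.
case: f1 f2 => [[l1 r1 m1] f1 g1] [[l2 r2 m2] f2 g2]; rewrite /cross.
split; first split.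
- by move=> *; rewrite l1 l2 addrACA.
- by move=> *; rewrite r1 r2 addrACA.
- by move=> *; rewrite m1 m2.
- by move=> *; rewrite f1 f2 lactDr.
- by move=> *; rewrite g1 g2 ractDl.
Qed.

Let psi0l x : psi 0 x = 0.
Proof. by apply: (morph0 (f := psi^~ x)) => y z; exact: phiDl. Qed.
Let psi0r x : psi x 0 = 0.
Proof. by apply: (morph0 (f := psi x)) => y z; exact: phiDr. Qed.

Section Type1.
Variables a b : nat.
Hypothesis ab : (a + b = 1)%N.
Let ba : (b + a = 1)%N. Proof. by rewrite addnC. Qed.

Lemma crossE w x : cross w x = psi (P a b w) (P b a x) + psi (P b a w) (P a b x).
Proof. by have [] := type1_cases ab => [] [-> ->] //; rewrite addrC. Qed.

Lemma cross_part w x : cross (P a b w) x = psi (P a b w) (P b a x).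
Proof.
rewrite crossE (part_part _ _ ab) (part_part_op _ _ ab) psi0l addr0 //.
Qed.

Lemma cross_partr w x : cross w (P b a x) = psi (P a b w) (P b a x).
Proof.
rewrite crossE (part_part _ _ ba) (part_part_op _ _ ba) psi0r addr0 //.
Qed.

Lemma cross_pq w x : cross (P a b w) x = cross w (P b a x).
Proof. by rewrite cross_part cross_partr. Qed.

Variable theta : Ompq cs 1 1 -> tensB (Ompq cs b a) (Ompq cs a b).
Variable h : conjB sB (Ompq cs a b) -> homB (Ompq cs a b).
Hypothesis h_psi : forall w v : Ompq cs a b,
  herm h v w = psi (incl1 v) (star_1 (incl1 w)).
Variable nab : Ompq cs a b -> tensB W (Ompq cs a b).
Hypothesis nab_chern :
  chern_connection (fun w => theta (inpq cs 1 1 (diff Om (outpq w)))) h nab.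

(** A connection on the forms of type (a, b), extended by zero to the other
type. *)
Definition extend_connection (w : W) : WW :=
  tmapB id (@incl1 _ _ _ Om cs a b) (nab (proj1 cs a b w)).

Let im := bimod_map_id W.
Let iab := @incl1_map _ _ _ _ cs a b.
Let im' := bimod_map_id (Ompq cs a b).
Let inclm := tmapB_map im iab.

Lemma nab_clinear : clinear nab.
Proof. by case: nab_chern => [[h1 _] _ _]; exact: clinear_linear. Qed.

Lemma extend_clinear : clinear extend_connection.
Proof.
apply: (clinear_comp _ (bimod_map_clinear inclm)).
apply: (clinear_comp _ nab_clinear).
exact: bimod_map_clinear (@proj1_map _ _ _ _ cs a b).
Qed.

Lemma nab0 : nab 0 = 0.
Proof. by apply: morph0; case: nab_clinear. Qed.

Lemma extend_part w : extend_connection (P a b w) = extend_connection w.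
Proof. by rewrite /extend_connection /part proj1_incl1. Qed.

Lemma extend_part_op w : extend_connection (P b a w) = 0.
Proof.
rewrite /extend_connection /part (proj1_incl1_op _ ba) nab0.
by apply: morph0; case: inclm.
Qed.

Lemma part_extend w : tmapB id (P a b) (extend_connection w) = extend_connection w.
Proof.
rewrite /extend_connection (tmapB_compose _ im iab im (@part_map _ _ _ _ cs a b)).
by congr (tmapB _ _ _); apply/funext => x; rewrite part_incl1.
Qed.

Lemma part_extend_op w : tmapB id (P b a) (extend_connection w) = 0.
Proof.
rewrite -part_extend (tmapB_compose _ im (@part_map _ _ _ _ cs a b) im (@part_map _ _ _ _ cs b a)).
have pm : bimod_map (fun x : W => P b a (P a b x)).
  exact: (bimod_map_comp (@part_map _ _ _ _ cs a b) (@part_map _ _ _ _ cs b a)).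
elim/tensB_ind: (extend_connection w) => [x y||x y hx hy].
- rewrite (tmapBE im pm) part_part_op // -(lact0 W 0) -tpBM.
  have -> : ract x (0 : B) = 0.
    by apply: (morph0 (f := fun b => ract x b)) => c d; exact: ractDr.
  by apply: (morph0 (f := fun x : W => tpB x (0 : W) : WW)) => c d; exact: tpBDl.
- by apply: morph0; exact: tmapBD.
- by rewrite (tmapBD im pm) hx hy addr0.
Qed.

Lemma extend_leibniz c w : extend_connection (lact c w) =
  lact c (extend_connection w) + tpB (d0 Om c) (P a b w).
Proof.
case: nab_chern => [[_ hl] _ _]; have [_ pl _] := @proj1_map _ _ _ _ cs a b.
have [iD il _] := inclm.
by rewrite /extend_connection pl hl iD il (tmapBE im iab).
Qed.

Lemma extend_holo w : tmapB (P b a) id (extend_connection w) = holo theta w.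
Proof.
case: nab_chern => _ _ hd.
have pba := @proj1_map _ _ _ _ cs b a; have iba := @incl1_map _ _ _ _ cs b a.
rewrite /extend_connection (tmapB_compose _ im iab (@part_map _ _ _ _ cs b a) im).
rewrite /holo /factor (out1_part _ _ ab).
have := hd (proj1 cs a b w).
rewrite -[outpq (proj1 cs a b w)]/(bidegp cs (a, b) (out1 w)) => <-.
by rewrite (tmapB_compose _ pba im' iba iab).
Qed.

(** Compatibility with the Hermitian metric h, evaluated at the component e of w and
the component f of x^*: then (incl f)^* is the component of x of the other type,
and the conjugate of nabla f becomes the flipped star of its extension. *)
Lemma extend_compatible w x :
  d0 Om (psi (P a b w) (P b a x)) =
  contract_r cross (extend_connection w) x +
  contract_l cross w (flip_star (@star_1 _ _ _ Om) (extend_connection (star_1 x))).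
Proof.
case: nab_chern => _ compat _.
have sP := star_1P Om; have cf := cross_form.
set e := proj1 cs a b w; set f := proj1 cs a b (star_1 x).
have starf : star_1 (incl1 f) = P b a x.
  rewrite -[incl1 f]/(P a b (star_1 x)) (star_part _ _ ab).
  by rewrite (bstarK sP).
rewrite -starf -[P a b w]/(incl1 e) -h_psi compat; congr (_ + _).
(* the term with nabla e *)
- have bal : bbalanced (fun (w0 : W) (y : Ompq cs a b) => ract w0 (herm h y f)).
    have -> : (fun (w0 : W) (y : Ompq cs a b) => ract w0 (herm h y f)) =
        (fun w0 y => ract w0 (cross (incl1 y) x)).
      apply/funext => w0; apply/funext => y; rewrite h_psi starf.
      by rewrite -(part_incl1 y ab) cross_part.
    have [b1 b2 b3] := contract_r_bal cf x; have [iD il _] := iab.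
    by split=> [m m' n|m n n'|m k n]; rewrite ?iD ?il ?b1 ?b2 ?b3.
  rewrite /extend_connection -/e; move: (nab e).
  apply: (tensB_ext (h' := fun X => contract_r cross (tmapB id _ X) x))
    => [X Y|X Y|y v].
  + exact: (tliftBD bal).
  + by rewrite (tmapBD im iab) (contract_rDl cf).
  + rewrite (tliftBE _ _ bal) (tmapBE im iab) (contract_rE cf) h_psi starf.
    by rewrite -(part_incl1 v ab) cross_part (part_incl1 _ ab).
(* the term with the conjugate of nabla f *)
- have E (v : Ompq cs a b) : heval (h (conj_elt sB v)) e = cross w (star_1 (incl1 v)).
    rewrite -[LHS]/(herm h e v) h_psi -[in RHS](part_incl1 v ab) (star_part _ _ ab).
    by rewrite cross_partr -(star_part _ _ ab) (part_incl1 _ ab).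
  have bal1 : bbalanced (fun (w0 : W) (v : Ompq cs a b) =>
      tpB (conj_elt sB v) (star_1 w0) : tensB (conjB sB (Ompq cs a b)) W).
    split=> [m m' n|m n n'|m k n].
    + by rewrite (bstarD sP) tpBDr.
    + exact: tpBDl.
    + rewrite (bstar_r sP) -tpBM; congr (tpB _ _).
      by rewrite -[k in RHS](starK sB).
  have bal2 : bbalanced (fun (v : conjB sB (Ompq cs a b)) (w0 : W) =>
      lact (heval (h v) e) w0).
    have -> : (fun (v : conjB sB (Ompq cs a b)) (w0 : W) => lact (heval (h v) e) w0) =
       (fun v w0 => lact (cross w (star_1 (incl1 (uncj v)))) w0).
      by apply/funext => v; apply/funext => w0; rewrite -E.
    have [b1 b2 b3] := contract_l_bal cf w; have [iD il ir] := iab.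
    split=> [m m' n|m n n'|m k n].
    + by rewrite -b1 -(bstarD sP) -iD.
    + exact: b2.
    + by rewrite -b3 -[k in RHS](starK sB) -(bstar_l sP) -il.
  rewrite /nabla_conj /extend_connection -/f -[uncj _]/f; move: (nab f).
  apply: (tensB_ext (h := fun X => tliftB _ (tliftB _ X))
    (h' := fun X => contract_l cross w (flip_star _ (tmapB id _ X))))
    => [X Y|X Y|y v].
  + by rewrite (tliftBD bal1) (tliftBD bal2).
  + by rewrite (tmapBD im iab) (flip_starD sP) (contract_lDr cf).
  + rewrite (tliftBE _ _ bal1) (tliftBE _ _ bal2) (tmapBE im iab).
    by rewrite (flip_starE sP) (contract_lE cf) E.
Qed.

Hypothesis h_herm : hermitian_metric h.

(** Surjectivity of the Hermitian metric: the functional (-, x) on forms of type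
(a, b) is its value at some conjugate form. *)
Lemma herm_represent x : exists v : Ompq cs a b, forall w,
  psi (P a b w) x = psi (P a b w) (star_1 (incl1 v)).
Proof.
case: h_herm => _ [g _ gK] _; have [iD il _] := iab.
pose F (v : Ompq cs a b) : B := psi (incl1 v) x.
have FP : F \in @lhom_pred _ B (Ompq cs a b).
  apply/asboolP; split=> [m m'|c m]; rewrite /F.
    by rewrite iD (phiDl psi_form).
  by rewrite il (phi_lact psi_form).
exists (uncj (g (LHom FP))) => w.
rewrite -[P a b w]/(incl1 (proj1 cs a b w)) -h_psi /herm.
by rewrite -[conj_elt _ _]/(g (LHom FP)) gK.
Qed.

Lemma herm_nondegenerate y : (forall w, cross w y = 0) -> P b a y = 0.
Proof.
case: h_herm => [[hD _ _] hb _] y0; have sP := star_1P Om.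
pose f := proj1 cs a b (star_1 y).
have starf : star_1 (incl1 f) = P b a y.
  by rewrite -[incl1 f]/(P a b (star_1 y)) (star_part _ _ ab) (bstarK sP).
have f0 : conj_elt sB f = 0.
  apply: (bij_inj hb); rewrite (morph0 hD); apply/val_inj/funext => v.
  rewrite -[LHS]/(herm h v f) h_psi starf -(part_incl1 v ab) -cross_part.
  by rewrite y0.
rewrite -starf -[f]/(uncj (conj_elt sB f)) f0.
by rewrite incl1_0 (morph0 (bstarD sP)).
Qed.

End Type1.
End ChernBlock.

(** * The sum of the two Chern connections *)

Section SumConnection.
Variables (C : numClosedFieldType) (B : algType C) (sB : starOp B).
Variables (Om : starCalculus sB) (cs : complexStructure Om) (th : factorization cs).
Local Notation W := (Om1 Om).
Local Notation WW := (tensB W W).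
Local Notation P := (part cs).
Variable psi : W -> W -> regular_bimod B.
Hypothesis psi_form : bimod_form psi.
Variable h1 : conjB sB (Ompq cs 1 0) -> homB (Ompq cs 1 0).
Variable h2 : conjB sB (Ompq cs 0 1) -> homB (Ompq cs 0 1).
Hypothesis h1_psi : forall w v, herm h1 v w = psi (incl1 v) (star_1 (incl1 w)).
Hypothesis h2_psi : forall w v, herm h2 v w = psi (incl1 v) (star_1 (incl1 w)).
Variable nablaCh : Ompq cs 1 0 -> tensB W (Ompq cs 1 0).
Variable nablaChop : Ompq cs 0 1 -> tensB W (Ompq cs 0 1).
Hypothesis nablaCh_chern : chern_connection (dbar10 th) h1 nablaCh.
Hypothesis nablaChop_chern : chern_connection (dbar01_op th) h2 nablaChop.

Let e1 : (1 + 0 = 1)%N := erefl.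
Let e2 : (0 + 1 = 1)%N := erefl.
Let P1 := part_map cs 1 0.
Let P2 := part_map cs 0 1.
Let im := bimod_map_id W.
Let theta1 : Ompq cs 1 1 -> tensB (Ompq cs 0 1) (Ompq cs 1 0) := @theta_l _ _ _ _ _ th 1 1.
Let theta2 : Ompq cs 1 1 -> tensB (Ompq cs 1 0) (Ompq cs 0 1) := @theta_r _ _ _ _ _ th 1 1.
Let th1K : cancel theta1 (@wedge_ba _ _ _ _ cs 1 0) := @theta_lK _ _ _ _ _ th 1 1.
Let wed1K : cancel (@wedge_ba _ _ _ _ cs 1 0) theta1 := @wedge_lK _ _ _ _ _ th 1 1.
Let th2K : cancel theta2 (@wedge_ba _ _ _ _ cs 0 1) := @theta_rK _ _ _ _ _ th 1 1.
Let wed2K : cancel (@wedge_ba _ _ _ _ cs 0 1) theta2 := @wedge_rK _ _ _ _ _ th 1 1.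
Let ch1 : chern_connection (fun w => theta1 (inpq cs 1 1 (diff Om (outpq w)))) h1 nablaCh
  := nablaCh_chern.
Let ch2 : chern_connection (fun w => theta2 (inpq cs 1 1 (diff Om (outpq w)))) h2 nablaChop
  := nablaChop_chern.
Local Notation nabla := (sum_connection nablaCh nablaChop).
Local Notation phi := (cross cs psi).

Lemma sum_connectionE w :
  nabla w = extend_connection nablaCh w + extend_connection nablaChop w.
Proof. by []. Qed.

Lemma sum_clinear : clinear nabla.
Proof. exact: clinear_add (extend_clinear ch1) (extend_clinear ch2). Qed.

Lemma sum_part w : tmapB id (P 1 0) (nabla w) = nabla (P 1 0 w).
Proof.
rewrite !sum_connectionE (tmapBD im P1) (part_extend e1) (part_extend_op e2).
by rewrite (extend_part e1) (extend_part_op e2 ch2).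
Qed.

(** phi (w, x) is a sum of two terms, one for each Chern connection. *)
Lemma sum_compatible w x : d0 Om (phi w x) =
  contract_r phi (nabla w) x +
  contract_l phi w (flip_star (@star_1 _ _ _ Om) (nabla (star_1 x))).
Proof.
have cf := cross_form cs psi_form; have [dD _] := d0_clinear Om.
rewrite /cross dD (extend_compatible psi_form e1 h1_psi ch1).
rewrite (extend_compatible psi_form e2 h2_psi ch2) !sum_connectionE.
rewrite (contract_rDl cf) (flip_starD (star_1P Om)) (contract_lDr cf).
by rewrite addrACA.
Qed.

Definition sum_holo (w : W) : WW := holo theta1 w + holo theta2 w.

Lemma sum_holoE w : sum_holo w =
  tmapB (P 0 1) id (nabla (P 1 0 w)) + tmapB (P 1 0) id (nabla (P 0 1 w)).
Proof.
rewrite !sum_connectionE (extend_part_op e2 ch2) (extend_part_op e1 ch1).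
rewrite addr0 add0r (extend_part e1) (extend_part e2).
by rewrite (extend_holo e1 ch1) (extend_holo e2 ch2).
Qed.

Lemma sum_left_connection : left_connection nabla.
Proof.
split; first exact: linear_clinear sum_clinear.
move=> b w; rewrite !sum_connectionE (extend_leibniz ch1) (extend_leibniz ch2).
by rewrite addrACA -lactDr -tpBDr part_sum.
Qed.

Theorem sum_bimodule_connection (u : WW) :
  (forall w, contract_l phi w u = w) -> (forall z, contract_r phi u z = z) ->
  bimodule_connection nabla.
Proof.
move=> u_l u_r; split; first exact: sum_left_connection.
have [nD _] := sum_clinear.
have sm := bimod_map_add (holo_braid_map th1K wed1K) (holo_braid_map th2K wed2K).
apply: (nabla_braided (star_1P Om) P1 P2 (part_sum cs)
  (fun w => star_part cs w e1) (@d0_star _ _ _ Om) (cross_form cs psi_form)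
  (cross_pq cs psi_form e1) u_l u_r nD sum_part sum_compatible sum_holoE sm).
move=> w b; rewrite /sum_holo (holo_ract th1K wed1K) (holo_ract th2K wed2K).
by rewrite ractDl addrACA.
Qed.

Hypotheses (h1_herm : hermitian_metric h1) (h2_herm : hermitian_metric h2).

(** The two components of y come from the two Hermitian metrics. *)
Lemma cross_represent x : exists y, forall w, psi w x = phi w y.
Proof.
have [v1 v1P] := herm_represent psi_form h1_psi h1_herm x.
have [v2 v2P] := herm_represent psi_form h2_psi h2_herm x.
have cf := cross_form cs psi_form.
exists (star_1 (incl1 v1) + star_1 (incl1 v2)) => w.
rewrite -(part_incl1 v1 e1) -(part_incl1 v2 e2) !star_part //.
rewrite (phiDr cf) (cross_partr cs psi_form e1) (cross_partr cs psi_form e2).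
rewrite -!star_part // !part_incl1 // -v1P -v2P -(phiDl psi_form).
by rewrite part_sum.
Qed.

Lemma cross_nondegenerate y : (forall w, phi w y = 0) -> y = 0.
Proof.
move=> y0; rewrite -(part_sum cs y).
rewrite (herm_nondegenerate psi_form e1 h1_psi h1_herm y0).
by rewrite (herm_nondegenerate psi_form e2 h2_psi h2_herm y0) addr0.
Qed.

End SumConnection.

Section Covariance.
Variables (C : numClosedFieldType) (A : hopfStarAlg C) (H : hopfAlg C).
Variables (pi : hopfMap A H) (D : baseStar pi).
Variables (Om : starCalculus (base_star D)) (cc : covariantCalculus Om).
Variables (cs : complexStructure Om) (cs_cov : covariant_complex cc cs).
Variable th : factorization cs.
Hypothesis W_cov : covariant_bimod D (coact1 cc).
Variables (g : tensB (Om1 Om) (Om1 Om))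
  (pair : tensB (Om1 Om) (Om1 Om) -> regular_bimod (coinv pi)).
Hypotheses (g_metric : is_metric g pair) (g_cov : covariant_metric cc g pair).
Local Notation sB := (base_star D).
Variable h1 : conjB sB (Ompq cs 1 0) -> homB (Ompq cs 1 0).
Variable h2 : conjB sB (Ompq cs 0 1) -> homB (Ompq cs 0 1).
Hypotheses (h1_herm : hermitian_metric h1) (h2_herm : hermitian_metric h2).
Hypothesis h1_g : hermitian_of_metric pair h1.
Hypothesis h2_g : hermitian_of_metric pair h2.
Variable nablaCh : Ompq cs 1 0 -> tensB (Om1 Om) (Ompq cs 1 0).
Variable nablaChop : Ompq cs 0 1 -> tensB (Om1 Om) (Ompq cs 0 1).
Hypothesis nablaCh_chern : chern_connection (dbar10 th) h1 nablaCh.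
Hypothesis nablaChop_chern : chern_connection (dbar01_op th) h2 nablaChop.
Local Notation W := (Om1 Om).
Local Notation dW := (coact1 cc).
Local Notation dB := (base_coact D).
Local Notation dWW := (tens_coact dW dW).

Let psi (w x : W) : regular_bimod (coinv pi) := pair (tpB w x).
Local Notation phi := (cross cs psi).
Local Notation nabla := (sum_connection nablaCh nablaChop).

Let psi_form : bimod_form psi.
Proof.
case: g_metric => [[pD pl pr] _ _]; rewrite /psi.
split; first split.
- by move=> *; rewrite tpBDl pD.
- by move=> *; rewrite tpBDr pD.
- by move=> *; rewrite tpBM.
- by move=> *; rewrite -lact_tpB pl.
- by move=> *; rewrite -ract_tpB pr.
Qed.

Let psi_bicol : bicolinear dW dW dB psi.
Proof.
case: g_metric => [pm _ _] w x; case: g_cov => pc _.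
have hm := bilinear_mul A; have pl := bimod_map_clinear pm.
have iW := @clinear_id C W.
rewrite /psi pc (tpB_bicolinear W_cov).
have := tmul_tmap (dW w) (dW x) hm (bilinear_tpB W W) iW iW pl.
by rewrite !tmap_id.
Qed.

Let cross_bicol : bicolinear dW dW dB phi.
Proof.
have pb := bimod_form_bilinear psi_form.
have il := @clinear_id C (regular_bimod (coinv pi)).
have p1 := bimod_map_clinear (part_map cs 1 0).
have p2 := bimod_map_clinear (part_map cs 0 1).
have idc : colinear dB dB id by move=> x; rewrite tmap_id.
have c1 : colinear dW dW (part cs 1 0) by exact: part_colinear.
have c2 : colinear dW dW (part cs 0 1) by exact: part_colinear.
apply: bicolinear_add.
- exact: (bilinear_comp pb p1 p2 il).
- exact: (bilinear_comp pb p2 p1 il).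
- by case: (base_coactP D) => /clinear_linear [].
- exact: (bicolinear_comp pb p1 p2 il psi_bicol c1 c2 idc).
- exact: (bicolinear_comp pb p2 p1 il psi_bicol c2 c1 idc).
Qed.

Let g_coinv : dWW g = 1 ⊗ g.
Proof.
case: g_cov => _ /(_ 1); rewrite lact1 base_coact1 => ->.
have gl : clinear (fun b => lact b g) by case: (bilinear_lact (tensB W W)).
by rewrite (tmap_pure (@clinear_id C A) gl) lact1.
Qed.

Theorem sum_covariant_bimodule_connection :
  bimodule_connection nabla /\ covariant_connection cc nabla.
Proof.
have cf := cross_form cs psi_form.
have e1 : (1 + 0 = 1)%N by [].
have g_l w : contract_l psi w g = w by case: g_metric => _ h _; exact: h.
have [u [u_l u_r u_c]] := transfer_metric W_cov psi_form cf psi_bicol cross_bicol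
  g_l g_coinv (cross_represent psi_form h1_g h2_g h1_herm h2_herm)
  (cross_nondegenerate psi_form h1_g h2_g h1_herm h2_herm).
split.
  exact: (sum_bimodule_connection psi_form h1_g h2_g nablaCh_chern nablaChop_chern
    u_l u_r).
have p1 : colinear dW dW (part cs 1 0) by exact: part_colinear.
have p2 : colinear dW dW (part cs 0 1) by exact: part_colinear.
have hc1 := holo_colinear cs_cov W_cov e1
  (theta_lK th (p := 1) (q := 1)) (wedge_lK th (p := 1) (q := 1)).
have hc2 := holo_colinear cs_cov W_cov (erefl : (0 + 1 = 1)%N)
  (theta_rK th (p := 1) (q := 1)) (wedge_rK th (p := 1) (q := 1)).
have Dc : colinear dW dWW (sum_holo th).
  apply: colinear_add hc1 hc2; last exact: (tens_coactD W_cov).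
  - exact: (holo_clinear (theta_lK th (p := 1) (q := 1)) (wedge_lK th (p := 1) (q := 1))).
  - exact: (holo_clinear (theta_rK th (p := 1) (q := 1)) (wedge_rK th (p := 1) (q := 1))).
exact: (nabla_colinear W_cov (star_1P Om) (star_1_coact cc)
  (part_map cs 1 0) (part_map cs 0 1) (part_sum cs)
  (fun w => star_part cs w e1) p1 p2 (d0_clinear Om) (d0_colinear cc)
  cf cross_bicol (cross_pq cs psi_form e1) u_l u_c
  (sum_clinear nablaCh_chern nablaChop_chern)
  (sum_part nablaCh nablaChop_chern)
  (sum_compatible psi_form h1_g h2_g nablaCh_chern nablaChop_chern)
  (sum_holoE nablaCh_chern nablaChop_chern) Dc).
Qed.

End Covariance.

Theorem corollary5p9 (R : realType)
  (A : hopfStarAlg (R[i])%C) (H : hopfAlg (R[i])%C) (pi : hopfMap A H)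
  (pi_surj : forall h : H, exists a : A, pi a = h)
  (A_ff : faithfully_flat pi)
  (D : baseStar pi)
  (Om : starCalculus (base_star D)) (cc : covariantCalculus Om)
  (cs : complexStructure Om) (cs_cov : covariant_complex cc cs)
  (th : factorization cs)
  (Om1_mod0 : mod0 D (coact1 cc))
  (Om10_simple : simple_mod0 D (coactpq cc cs 1 0))
  (Om01_simple : simple_mod0 D (coactpq cc cs 0 1))
  (Om10_Om01 : ~ isomorphic (coactpq cc cs 1 0) (coactpq cc cs 0 1))
  (g : tensB (Om1 Om) (Om1 Om))
  (pair : tensB (Om1 Om) (Om1 Om) -> regular_bimod (coinv pi))
  (g_metric : is_metric g pair) (g_real : real_metric g)
  (g_cov : covariant_metric cc g pair)
  (h1 : conjB (base_star D) (Ompq cs 1 0) -> homB (Ompq cs 1 0))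
  (h1_herm : hermitian_metric h1)
  (h1_cov : hermitian_covariant (coactpq cc cs 1 0) h1)
  (h1_g : hermitian_of_metric pair h1)
  (h2 : conjB (base_star D) (Ompq cs 0 1) -> homB (Ompq cs 0 1))
  (h2_herm : hermitian_metric h2)
  (h2_cov : hermitian_covariant (coactpq cc cs 0 1) h2)
  (h2_g : hermitian_of_metric pair h2)
  (nablaCh : Ompq cs 1 0 -> tensB (Om1 Om) (Ompq cs 1 0))
  (nablaCh_chern : chern_connection (dbar10 th) h1 nablaCh)
  (nablaChop : Ompq cs 0 1 -> tensB (Om1 Om) (Ompq cs 0 1))
  (nablaChop_chern : chern_connection (dbar01_op th) h2 nablaChop) :
  bimodule_connection (sum_connection nablaCh nablaChop) /\
  covariant_connection cc (sum_connection nablaCh nablaChop).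
Proof.
case: Om1_mod0 => W_cov _.
exact: (sum_covariant_bimodule_connection cs_cov W_cov g_metric g_cov
  h1_herm h2_herm h1_g h2_g nablaCh_chern nablaChop_chern).
Qed.
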